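(* Let $Y(u)\in\mathbb{R}^m_{>0}$ be a solution of $\frac{dY_i}{du}=-Y_iF_i(Y)$, $1\le i\le m$, with $\sum_iY_i(0)\le c_0$, where $c_0$ is as in the context, and let $g_{a,\vec b}(\tau)$ be the corresponding ancient solution of the Ricci flow on the circle bundle $P_Q$. Then: (i) $g_{a,\vec b}(\tau)$ is of type I as $\tau\to\infty$, i.e., there is a constant $C<\infty$ such that for $\tau$ large $$\tau\cdot\sup_{x\in P_Q}|\mathrm{Rm}_{g_{a,\vec b}(\tau)}(x)|_{g_{a,\vec b}(\tau)}\le C;$$ (ii) for any $\kappa>0$, the solution $g_{a,\vec b}(\tau)$ is not $\kappa$-noncollapsed at all scales.
   Context: For $1\le i\le m$, $(M_i,g_i)$ is a compact Kähler–Einstein manifold of complex dimension $n_i$, $\mathrm{Rc}(g_i)=p_ig_i$ with $p_i$ a positive integer, with Kähler form $\omega_i$, scaled so that $\frac1{2\pi}[\omega_i]$ is integral and represents a torsion-free indivisible class in $H^2(M_i,\mathbb{Z})$. Let $q_1,\dots,q_m$ be nonzero integers and $P_Q\to M_1\times\cdots\times M_m$ the principal circle bundle with Euler class $\frac1{2\pi}\sum_iq_i[\omega_i]$, with principal connection $\sigma$ of curvature form $d\sigma=\sum_iq_i\omega_i$. Consider metrics $g_{a,\vec b}(\tau)=a(\tau)\,\sigma\otimes\sigma+\sum_ib_i(\tau)g_i$, $a,b_i>0$ ($g_i$ pulled back). With $\tau=-t$ the backwards Ricci flow for $g_{a,\vec b}(\tau)$ is $$\frac{da}{d\tau}=\sum_{i}n_iq_i^2\frac{a^2}{b_i^2},\qquad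 \frac{db_i}{d\tau}=2p_i-q_i^2\frac{a}{b_i}.$$ An ancient solution is one existing for all $t\in(-\infty,T)$ for some finite $T$. Put $Y_i=a/b_i$, $u=\int_0^\tau\frac{d\zeta}{a(\zeta)}$, $E(Y)=\sum_in_iq_i^2Y_i^2$, $F_i(Y)=2p_iY_i-q_i^2Y_i^2-E(Y)$. Then the flow becomes $\frac{d\ln a}{du}=E(Y)$, $\frac{dY_i}{du}=-Y_iF_i(Y)$. Conversely, a solution $Y(u)\in\mathbb{R}^m_{>0}$ and a choice of $a(0)>0$ determine the corresponding $g_{a,\vec b}(\tau)$ by $a(u)=a(0)\exp\int_0^uE(Y(\zeta))d\zeta$, $\tau(u)=\int_0^ua(\zeta)d\zeta$, $b_i=a/Y_i$. $c_0>0$ is a constant (which exists) such that every solution $Y(u)\in\mathbb{R}^m_{\ge0}$ with $\sum_iY_i(0)\le c_0$ satisfies $\lim_{u\to\infty}Y(u)=0$, and if $Y(u)\in\mathbb{R}^m_{>0}$ then the corresponding $g_{a,\vec b}(\tau)$ is an ancient solution, defined for all $\tau\ge0$. $\kappa$-noncollapsed at all scales is meant in Perelman's sense: for every time, point $x$ and radius $\rho>0$, if $|\mathrm{Rm}|\le\rho^{-2}$ on the ball $B(x,\rho)$ then $\mathrm{Vol}\,B(x,\rho)\ge\kappa\rho^{\dim P_Q}$. *)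

(* Defs.v *)
From HB Require Import structures.
From mathcomp Require Import all_boot all_order all_algebra.
From mathcomp Require Import all_classical all_reals all_analysis.

Set Implicit Arguments.
Unset Strict Implicit.
Unset Printing Implicit Defensive.

Import Order.TTheory GRing.Theory Num.Theory numFieldNormedType.Exports.

Local Open Scope classical_set_scope.
Local Open Scope ring_scope.

(* Vectors are rows, so a linear map is a matrix acting on the right
   ([jacobian] follows this convention), a bilinear form B is the matrix with
   B(u, v) = u *m B *m v^T, and a covector is a column. *)

Section SmoothFunctions.
Context {R : realType} {d : nat}.

Definition partial (i : 'I_d) (f : 'rV[R]_d -> R) : 'rV[R]_d -> R :=
  fun x => 'D_(delta_mx 0 i) f x.

(* C^oo on the open set U: every iterated partial derivative is
   differentiable at every point of U. *)
Definition smooth (U : set 'rV[R]_d) (f : 'rV[R]_d -> R) : Prop :=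
  forall (s : seq 'I_d) x, U x -> differentiable (foldr partial f s) x.

End SmoothFunctions.

(* chart_inv is only meaningful on chart_img. *)
Record chart (R : realType) (d : nat) (T : topologicalType) := Chart {
  chart_dom : set T;
  chart_map : T -> 'rV[R]_d;
  chart_inv : 'rV[R]_d -> T }.

Definition chart_img (R : realType) d (T : topologicalType)
  (c : chart R d T) : set 'rV[R]_d := chart_map c @` chart_dom c.

Definition is_chart (R : realType) d (T : topologicalType)
    (c : chart R d T) : Prop :=
  [/\ open (chart_dom c), open (chart_img c),
      forall p, chart_dom c p -> chart_inv c (chart_map c p) = p,
      forall p, chart_dom c p -> {for p, continuous (chart_map c)} &
      forall x, chart_img c x -> {for x, continuous (chart_inv c)}].

(* chart_at selects a chart around each point; the tangent space at p is
   identified with R^d through the chart chart_at p. *)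
Record manifold (R : realType) (d : nat) := Manifold {
  carrier :> topologicalType;
  atlas : set (chart R d carrier);
  chart_at : carrier -> chart R d carrier;
  manifold_hausdorff : hausdorff_space carrier;
  manifold_second_countable : @second_countable carrier;
  atlas_chart : forall c, atlas c -> is_chart c;
  atlas_smooth : forall c c', atlas c -> atlas c' -> forall k,
    smooth (chart_map c @` (chart_dom c `&` chart_dom c'))
           (fun x => chart_map c' (chart_inv c x) 0 k);
  chart_at_atlas : forall p, atlas (chart_at p);
  chart_at_dom : forall p, chart_dom (chart_at p) p }.

Section Tensors.
Context {R : realType} {d : nat} {M : manifold R d}.

Definition coord (p : M) : 'rV[R]_d := chart_map (chart_at p) p.

Definition smooth_to e (U : set 'rV[R]_e) (f : 'rV[R]_e -> M) : Prop :=
  (forall x, U x -> {for x, continuous f}) /\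
  (forall c, atlas c -> forall k,
     smooth (U `&` f @^-1` chart_dom c) (fun x => chart_map c (f x) 0 k)).

(* The differential of f at z, from R^e to the tangent space at f z. *)
Definition diffmx e (f : 'rV[R]_e -> M) (z : 'rV[R]_e) : 'M[R]_(e, d) :=
  jacobian (chart_map (chart_at (f z)) \o f) z.

Definition velocity (f : R -> M) (t : R) : 'rV[R]_d :=
  derive1 (chart_map (chart_at (f t)) \o f) t.

(* A field of bilinear forms B p (covectors s p) on the tangent spaces; its
   components in the chart c are given by the pullback along chart_inv c. *)
Definition pull2 (B : M -> 'M[R]_d) e (f : 'rV[R]_e -> M) (z : 'rV[R]_e) :
    'M[R]_e := diffmx f z *m B (f z) *m (diffmx f z)^T.

Definition pull1 (s : M -> 'cV[R]_d) e (f : 'rV[R]_e -> M) (z : 'rV[R]_e) :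
    'cV[R]_e := diffmx f z *m s (f z).

Definition comp2 (B : M -> 'M[R]_d) (c : chart R d M) : 'rV[R]_d -> 'M[R]_d :=
  pull2 B (chart_inv c).

Definition comp1 (s : M -> 'cV[R]_d) (c : chart R d M) : 'rV[R]_d -> 'cV[R]_d :=
  pull1 s (chart_inv c).

Definition smooth2 (B : M -> 'M[R]_d) : Prop := forall c, atlas c ->
  forall i j, smooth (chart_img c) (fun x => comp2 B c x i j).

Definition smooth1 (s : M -> 'cV[R]_d) : Prop := forall c, atlas c ->
  forall i, smooth (chart_img c) (fun x => comp1 s c x i 0).

Definition riemannian_metric (g : M -> 'M[R]_d) : Prop :=
  [/\ smooth2 g,
      forall p, (g p)^T = g p &
      forall p (v : 'rV[R]_d), v != 0 -> 0 < (v *m g p *m v^T) 0 0].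

Definition closed2 (w : M -> 'M[R]_d) : Prop :=
  forall c, atlas c -> forall x, chart_img c x -> forall i j k : 'I_d,
    partial i (fun y => comp2 w c y j k) x
    + partial j (fun y => comp2 w c y k i) x
    + partial k (fun y => comp2 w c y i j) x = 0.

(* ds = w *)
Definition exterior_derivative_is (s : M -> 'cV[R]_d) (w : M -> 'M[R]_d) :
    Prop :=
  forall c, atlas c -> forall x, chart_img c x -> forall j k : 'I_d,
    partial j (fun y => comp1 s c y k 0) x
    - partial k (fun y => comp1 s c y j 0) x = comp2 w c x j k.

End Tensors.

Section Maps.
Context {R : realType} {d e : nat} {M : manifold R d} {N : manifold R e}.

Definition smooth_map (f : M -> N) : Prop :=
  forall c, @atlas R d M c -> smooth_to (chart_img c) (f \o chart_inv c).

Definition tangent (f : M -> N) (p : M) : 'M[R]_(d, e) :=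
  diffmx (f \o chart_inv (chart_at p)) (coord p).

Definition pullback2 (f : M -> N) (B : N -> 'M[R]_e) (p : M) : 'M[R]_d :=
  tangent f p *m B (f p) *m (tangent f p)^T.

Definition pullback1 (f : M -> N) (s : N -> 'cV[R]_e) (p : M) : 'cV[R]_d :=
  tangent f p *m s (f p).

End Maps.

Section Curvature.
Context {R : realType} {d : nat}.
Implicit Types (G : 'rV[R]_d -> 'M[R]_d) (x : 'rV[R]_d).

(* Gamma^k_{ij} *)
Definition christoffel G (k i j : 'I_d) x : R :=
  2^-1 * \sum_l invmx (G x) k l *
    (partial i (fun y => G y j l) x + partial j (fun y => G y i l) x
     - partial l (fun y => G y i j) x).

(* R^l_{ijk}, with R(e_i, e_j) e_k = R^l_{ijk} e_l and
   R(X, Y) = [nabla_X, nabla_Y] - nabla_[X, Y] *)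
Definition curvature G (l i j k : 'I_d) x : R :=
  partial i (christoffel G l j k) x - partial j (christoffel G l i k) x
  + \sum_a (christoffel G l i a x * christoffel G a j k x
            - christoffel G l j a x * christoffel G a i k x).

Definition ricci G x : 'M[R]_d :=
  \matrix_(j, k) \sum_i curvature G i i j k x.

Definition curvature_norm G x : R :=
  Num.sqrt (\sum_l \sum_l' \sum_i \sum_i' \sum_j \sum_j' \sum_k \sum_k'
    G x l l' * invmx (G x) i i' * invmx (G x) j j' * invmx (G x) k k' *
    curvature G l i j k x * curvature G l' i' j' k' x).

End Curvature.

(* The Lebesgue integral over R^d of a nonnegative Borel function, as an
   iterated integral. *)
Fixpoint integral_rV (R : realType) (d : nat) :
    ('rV[R]_d -> \bar R) -> \bar R :=
  match d with
  | 0 => fun f => f 0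
  | d'.+1 => fun f =>
      (\int[lebesgue_measure]_x
         integral_rV (fun v : 'rV[R]_d' => f (row_mx (x%:M : 'rV[R]_1) v)))%E
  end.

Section Riemannian.
Context {R : realType} {d : nat} {M : manifold R d}.
Variable g : M -> 'M[R]_d.

Definition Rm_norm (p : M) : R := curvature_norm (comp2 g (chart_at p)) (coord p).

Definition einstein (lambda : R) : Prop :=
  forall c, atlas c -> forall x, chart_img c x ->
    ricci (comp2 g c) x = lambda *: comp2 g c x.

Definition smooth_curve (f : R -> M) : Prop :=
  smooth_to [set: 'rV[R]_1] (fun z => f (z 0 0)).

Definition speed (f : R -> M) (t : R) : R :=
  Num.sqrt ((velocity f t *m g (f t) *m (velocity f t)^T) 0 0).

Definition curve_length (f : R -> M) : R :=
  Rintegral lebesgue_measure `[0, 1] (speed f).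

(* There is a piecewise smooth path of length l from x to y. *)
Inductive joined : M -> M -> R -> Prop :=
| joined_refl x : joined x x 0
| joined_cons f y l :
    smooth_curve f -> joined (f 1) y l -> joined (f 0) y (curve_length f + l).

Definition metric_ball (x : M) (r : R) : set M :=
  [set y | exists2 l, joined x y l & l < r].

(* The integral of sqrt (det g) over an open set A contained in the domain of
   the chart c. *)
Definition chart_volume (c : chart R d M) (A : set M) : \bar R :=
  integral_rV (fun x =>
    (Num.sqrt (\det (comp2 g c x)) * \1_(chart_map c @` A) x)%:E).

(* The (outer) Riemannian measure, generated by the chart volumes of open
   sets in the same way as Lebesgue outer measure is generated by the
   lengths of intervals. *)
Definition volume (A : set M) : \bar R :=
  ereal_inf [set v | exists (c : nat -> chart R d M) (O : nat -> set M),
    [/\ forall k, atlas (c k) /\ open (O k) /\ O k `<=` chart_dom (c k),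
        A `<=` \bigcup_k O k &
        v = (\sum_(0 <= k <oo) chart_volume (c k) (O k))%E]].

End Riemannian.

(* A smooth singular k-simplex is the restriction to the standard simplex of
   a smooth map from R^(k+1); a k-cochain is a function of such maps that
   depends only on this restriction. *)

Section Cohomology.
Context {R : realType} {d : nat} {M : manifold R d}.

Definition std_simplex k : set 'rV[R]_k.+1 :=
  [set x | (forall i, 0 <= x 0 i) /\ \sum_i x 0 i = 1].

Definition simplex k (s : 'rV[R]_k.+1 -> M) : Prop := smooth_to setT s.

Definition is_cochain (A : pzRingType) k (c : ('rV[R]_k.+1 -> M) -> A) : Prop :=
  forall s s', simplex s -> simplex s' ->
    (forall x, std_simplex x -> s x = s' x) -> c s = c s'.

Definition coface k (i : 'I_k.+1) (x : 'rV[R]_k) : 'rV[R]_k.+1 :=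
  \row_j oapp (fun j' => x 0 j') 0 (unlift i j).

Definition coboundary (A : pzRingType) k (c : ('rV[R]_k.+1 -> M) -> A)
    (s : 'rV[R]_k.+2 -> M) : A :=
  \sum_(i < k.+2) (-1) ^+ i * c (s \o coface i).

Definition cocycle (A : pzRingType) k (c : ('rV[R]_k.+1 -> M) -> A) : Prop :=
  is_cochain c /\ forall s, simplex s -> coboundary c s = 0.

Definition cohomologous (A : pzRingType) k (c c' : ('rV[R]_k.+2 -> M) -> A) :
    Prop :=
  exists2 b : ('rV[R]_k.+1 -> M) -> A, is_cochain b &
    forall s, simplex s -> c s = c' s + coboundary b s.

Definition non_torsion k (c : ('rV[R]_k.+2 -> M) -> int) : Prop :=
  forall N : nat, (0 < N)%N -> ~ cohomologous (fun s => c s *+ N) (fun=> 0).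

Definition indivisible k (c : ('rV[R]_k.+2 -> M) -> int) : Prop :=
  forall (N : nat) c', (1 < N)%N -> cocycle c' ->
    ~ cohomologous c (fun s => c' s *+ N).

Definition simplex_param (z : 'rV[R]_2) : 'rV[R]_3 :=
  \row_j [:: 1 - z 0 0 - z 0 1; z 0 0; z 0 1]`_j.

Definition integral2 (w : M -> 'M[R]_d) (s : 'rV[R]_3 -> M) : R :=
  Rintegral lebesgue_measure `[0, 1] (fun x =>
    Rintegral lebesgue_measure `[0, 1 - x] (fun y =>
      pull2 w (s \o simplex_param) (\row_j [:: x; y]`_j) 0 1)).

(* The closed 2-form w represents, in real cohomology, the image of a
   non-torsion, indivisible integral class. *)
Definition primitive_integral_class (w : M -> 'M[R]_d) : Prop :=
  exists c : ('rV[R]_3 -> M) -> int,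
    [/\ cocycle c, non_torsion c, indivisible c &
        cohomologous (integral2 w) (fun s => (c s)%:~R)].

End Cohomology.

(* Multiplication by i on C^n = R^n + R^n, (x, y) |-> x + i y *)
Definition J0 (R : realType) n : 'M[R]_(n + n) := block_mx 0 1%:M (- 1%:M) 0.
Arguments J0 {R n}.

(* In the complex charts, hence on each tangent space, the complex structure
   is J0. *)
Definition holomorphic_atlas (R : realType) n (M : manifold R (n + n)) : Prop :=
  forall c c', @atlas R (n + n) M c -> @atlas R (n + n) M c' ->
  forall x, (chart_map c @` (chart_dom c `&` chart_dom c')) x ->
    let D := jacobian (chart_map c' \o chart_inv c) x in J0 *m D = D *m J0.

(* w(u, v) = g(J u, v) *)
Definition kahler_form (R : realType) n (M : manifold R (n + n))
  (g : M -> 'M[R]_(n + n)) (x : M) : 'M[R]_(n + n) := J0 *m g x.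

Definition compact_kahler_einstein (R : realType) n (M : manifold R (n + n))
    (g : M -> 'M[R]_(n + n)) (lambda : R) : Prop :=
  [/\ compact [set: M] /\ connected [set: M],
      holomorphic_atlas M,
      riemannian_metric g /\ (forall x, J0 *m g x *m J0^T = g x),
      closed2 (kahler_form g) &
      einstein g lambda].

Section CircleBundle.
Context {R : realType} {m d : nat} {e : 'I_m -> nat}.
Context {B : forall i, manifold R (e i)} {P : manifold R d}.

(* The circle is R / 2 pi Z, acting freely on P through act; the projection onto the
   product of the B i is given by its components. It is a surjective
   submersion whose fibres are the orbits of the free action. *)
Definition principal_circle_bundle (act : R -> P -> P)
    (proj : forall i, P -> B i) : Prop :=
  [/\ [/\ forall p, act 0 p = p,
          forall s t p, act (s + t) p = act s (act t p) &
          forall c, @atlas R d P c ->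
            smooth_to [set z : 'rV[R]_(1 + d) | chart_img c (rsubmx z)]
              (fun z => act (lsubmx z 0 0) (chart_inv c (rsubmx z)))],
      forall t p, act t p = p <-> exists k : int, t = 2 * pi * k%:~R,
      forall i, smooth_map (proj i),
      (forall x : forall i, B i, exists p, forall i, proj i p = x i) /\
      (forall p p', (forall i, proj i p = proj i p') <->
                    exists t, p' = act t p) &
      forall p (v : forall i, 'rV[R]_(e i)), exists w : 'rV[R]_d,
        forall i, w *m tangent (proj i) p = v i].

Definition fundamental_field (act : R -> P -> P) (p : P) : 'rV[R]_d :=
  derive1 (chart_map (chart_at p) \o act^~ p) 0.

Definition principal_connection (act : R -> P -> P) (s : P -> 'cV[R]_d) : Prop :=
  [/\ smooth1 s,
      forall p, fundamental_field act p *m s p = 1%:M &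
      forall t p, pullback1 (act t) s p = s p].

(* sum_i q_i w_i, pulled back to P *)
Definition curvature_form (proj : forall i, P -> B i) (q : 'I_m -> int)
    (w : forall i, B i -> 'M[R]_(e i)) (p : P) : 'M[R]_d :=
  \sum_i (q i)%:~R *: pullback2 (proj i) (w i) p.

Definition bundle_metric (proj : forall i, P -> B i) (s : P -> 'cV[R]_d)
    (g : forall i, B i -> 'M[R]_(e i)) (a : R) (b : 'I_m -> R) (p : P) :
    'M[R]_d :=
  a *: (s p *m (s p)^T) + \sum_i b i *: pullback2 (proj i) (g i) p.

End CircleBundle.

Section Flow.
Context {R : realType} {m : nat}.
Variables (n p : 'I_m -> nat) (q : 'I_m -> int).

Definition E (y : 'I_m -> R) : R :=
  \sum_i (n i)%:R * (q i)%:~R ^+ 2 * y i ^+ 2.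

Definition F (i : 'I_m) (y : 'I_m -> R) : R :=
  2 * (p i)%:R * y i - (q i)%:~R ^+ 2 * y i ^+ 2 - E y.

Definition Y_solution (Y : R -> 'I_m -> R) : Prop :=
  forall i, Y^~ i @ (0 : R)^'+ --> Y 0 i /\
    forall u : R, 0 < u -> is_derive u 1 (Y^~ i) (- Y u i * F i (Y u)).

Definition a_of_u (a0 : R) (Y : R -> 'I_m -> R) (u : R) : R :=
  a0 * expR (Rintegral lebesgue_measure `[0, u] (fun z => E (Y z))).

Definition tau_of_u (a0 : R) (Y : R -> 'I_m -> R) (u : R) : R :=
  Rintegral lebesgue_measure `[0, u] (a_of_u a0 Y).

(* a and b, functions of tau, are determined by Y and a(0) = a0. *)
Definition corresponding (a0 : R) (Y : R -> 'I_m -> R)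
    (a : R -> R) (b : R -> 'I_m -> R) : Prop :=
  forall u : R, 0 <= u ->
    a (tau_of_u a0 Y u) = a_of_u a0 Y u /\
    forall i, b (tau_of_u a0 Y u) i = a_of_u a0 Y u / Y u i.

(* The backwards Ricci flow of the bundle metrics, on [0, +oo[ *)
Definition ancient_solution (a : R -> R) (b : R -> 'I_m -> R) : Prop :=
  [/\ forall t : R, 0 <= t -> 0 < a t /\ forall i, 0 < b t i,
      a @ (0 : R)^'+ --> a 0 /\ forall i, b^~ i @ (0 : R)^'+ --> b 0 i &
      forall t : R, 0 < t ->
        is_derive t 1 a
          (\sum_i (n i)%:R * (q i)%:~R ^+ 2 * (a t ^+ 2 / b t i ^+ 2)) /\
        forall i, is_derive t 1 (b^~ i)
          (2 * (p i)%:R - (q i)%:~R ^+ 2 * (a t / b t i))].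

Definition small_data_constant (c0 : R) : Prop :=
  0 < c0 /\ forall Y, Y_solution Y ->
    (forall u : R, 0 <= u -> forall i, 0 <= Y u i) -> \sum_i Y 0 i <= c0 ->
    (forall i, Y^~ i @ +oo_R --> (0 : R)) /\
    ((forall u : R, 0 <= u -> forall i, 0 < Y u i) ->
     forall a0 a b, 0 < a0 -> corresponding a0 Y a b ->
       (forall t : R, 0 <= t -> exists2 u, 0 <= u & tau_of_u a0 Y u = t) /\
       ancient_solution a b).

End Flow.

Section Asymptotics.
Context {R : realType} {d : nat} {P : manifold R d}.
Variable g : R -> P -> 'M[R]_d.

Definition type_I : Prop :=
  exists C T0 : R, forall t, T0 <= t -> 0 <= t ->
    (t%:E * ereal_sup [set (Rm_norm (g t) x)%:E | x in [set: P]] <= C%:E)%E.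

Definition noncollapsed (kappa : R) : Prop :=
  forall t : R, 0 <= t -> forall (x : P) (rho : R), 0 < rho ->
    (forall y, metric_ball (g t) x rho y -> Rm_norm (g t) y <= rho ^- 2) ->
    ((kappa * rho ^+ d)%:E <= volume (g t) (metric_ball (g t) x rho))%E.

End Asymptotics.

(* Main.v *)
(* Since Y -> 0, the ratios a/b_i tend to 0, so eventually d b_i/d tau lies in
   [1, 2 p_i]: the b_i grow linearly and a/tau -> 0.

   The rescaled metric g/tau is s (x) s + h with s = sqrt(a/tau) sigma and
   h = sum_i (b_i/tau) g_i. In the coframe consisting of s and the coordinate
   forms of the base, its connection matrices are built from the Christoffel
   symbols of h and from the constant endomorphism Z obtained by raising an index
   of d s / 2. As b_i/tau stays in a compact subset of ]0, +oo[, a/tau <= 1 and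
   the M_i are compact, the curvature of g/tau is bounded, whence |Rm| <= K/tau
   for g.

   Thus |Rm| <= rho^-2 on balls of radius rho = sqrt(tau/K). Their volume is at
   most that of P, a constant multiple of sqrt(a prod_i b_i^(2 n_i)), which is
   o(rho^dim P) because a/tau -> 0. *)

From HB Require Import structures.
From mathcomp Require Import all_boot all_order all_algebra.
From mathcomp Require Import all_classical all_reals all_analysis.
From mathcomp Require Import ring lra.
Require Import Defs.

Set Implicit Arguments.
Unset Strict Implicit.
Unset Printing Implicit Defensive.

Import Order.TTheory GRing.Theory Num.Theory numFieldNormedType.Exports.

Local Open Scope classical_set_scope.
Local Open Scope ring_scope.

(** * Differentiable functions of several real variables *)

Section NearDifferentiable.
Context {R : numFieldType} {V W : normedModType R}.

(** Curvature is measured in the preferred charts of P, which are unrelated to the fibration, so no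
    adapted coordinates are used. Near each point an invertible matrix function T, with columns s
    and the differentials of base coordinates, carries the coordinate connection to the frame
    connection by a gauge transformation, and norms are compared between the two frames. Z is
    constant because d sigma is a combination of Kahler forms: in a holomorphic chart such a form is
    [J0] times the metric, so raising an index leaves a multiple of [J0] on each factor and no
    derivative of Z ever occurs. Compactness of P is derived from that of the base, the periodicity
    of the action and the openness of the projection; openness is proved by minimising a squared
    distance. Volume is an outer measure, so one finite cover by charts bounds it for all times, the
    determinant of the metric depending on a and the b_i only through a scalar factor. Nonemptiness
    of P, without which noncollapsing would hold vacuously, comes from the non-torsion classes on
    the factors. *)

Lemma near_eq_differentiable (f g : V -> W) (x : V) :
  {near x, f =1 g} -> differentiable f x -> differentiable g x.
Proof.
move=> fg df; have fgx : f x = g x by exact: nbhs_singleton fg.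
have dfc : continuous ('d f x) by apply: diff_continuous.
have key : g \o shift x = cst (g x) + 'd f x +o_ 0 id.
  apply/eqaddoP => _/posnumP[eps]; near=> h.
  have -> : (g \o shift x - (cst (g x) + 'd f x)) h
          = (f \o shift x - (cst (f x) + 'd f x)) h.
    rewrite !fctE /= fgx; congr (_ - _); apply/esym.
    near: h; have [r /= r0 rfg] := (nbhs_ballP _ _).1 fg.
    apply/nbhs_ballP; exists r => //= h; rewrite -ball_normE /= sub0r normrN.
    move=> hr; apply: rfg; rewrite -ball_normE /= distrC addrK //.
  near: h; have /diff_locally/eqaddoP/(_ eps%:num) := df; exact.
apply/diff_locallyP; rewrite (_ : 'd g x = 'd f x :> (V -> W)) //.
exact: diff_unique.
Unshelve. all: by end_near. Qed.

End NearDifferentiable.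

Section PartialRules.
Context {R : realType} {d : nat}.
Implicit Types (f g : 'rV[R]_d -> R) (x : 'rV[R]_d).

Lemma near_eq_partial i f g x :
  {near x, f =1 g} -> partial i f x = partial i g x.
Proof. exact: near_eq_derive. Qed.

Lemma partial_near i f g x :
  {near x, f =1 g} -> {near x, partial i f =1 partial i g}.
Proof.
move=> /near_join fg; apply: filterS fg => y; exact: near_eq_partial.
Qed.

Lemma partial_cst i (k : R) x : partial i (fun=> k) x = 0.
Proof. exact: derive_cst. Qed.

Lemma partialD i f g x : differentiable f x -> differentiable g x ->
  partial i (fun y => f y + g y) x = partial i f x + partial i g x.
Proof. by move=> df dg; rewrite /partial -deriveD//; exact: diff_derivable. Qed.

Lemma partialN i f x : differentiable f x ->
  partial i (fun y => - f y) x = - partial i f x.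
Proof. by move=> df; rewrite /partial -deriveN//; exact: diff_derivable. Qed.

Lemma partialB i f g x : differentiable f x -> differentiable g x ->
  partial i (fun y => f y - g y) x = partial i f x - partial i g x.
Proof. by move=> df dg; rewrite /partial -deriveB//; exact: diff_derivable. Qed.

Lemma partialM i f g x : differentiable f x -> differentiable g x ->
  partial i (fun y => f y * g y) x = partial i f x * g x + f x * partial i g x.
Proof.
move=> df dg; rewrite /partial.
have -> : (fun y => f y * g y) = f * g by [].
rewrite deriveM; [|exact: diff_derivable..].
by rewrite addrC /GRing.scale /= mulrC.
Qed.

Lemma partialV i f x : differentiable f x -> f x != 0 ->
  partial i (fun y => (f y)^-1) x = - (f x)^-1 ^+ 2 * partial i f x.
Proof.
move=> df f0; rewrite /partial deriveV //; last exact: diff_derivable.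
by rewrite -exprVn.
Qed.

Lemma differentiable_bigsum (I : Type) (r : seq I) (P : pred I)
    (F : I -> 'rV[R]_d -> R) x :
  (forall k, P k -> differentiable (F k) x) ->
  differentiable (fun y => \sum_(k <- r | P k) F k y) x.
Proof.
move=> dF; elim: r => [|k r ih].
  have -> : (fun y => \sum_(k <- [::] | P k) F k y) = cst 0.
    by apply/funext => y; rewrite big_nil.
  exact: differentiable_cst.
have -> : (fun y => \sum_(j <- k :: r | P j) F j y) = (fun y =>
   if P k then F k y + \sum_(j <- r | P j) F j y else \sum_(j <- r | P j) F j y).
  by apply/funext => y; rewrite big_cons.
by case Pk : (P k); first exact: differentiableD (dF _ Pk) ih.
Qed.

Lemma partial_sum i (I : Type) (r : seq I) (P : pred I)
    (F : I -> 'rV[R]_d -> R) x :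
  (forall k, P k -> differentiable (F k) x) ->
  partial i (fun y => \sum_(k <- r | P k) F k y) x =
  \sum_(k <- r | P k) partial i (F k) x.
Proof.
move=> dF; elim: r => [|k r ih].
  rewrite big_nil -[RHS](partial_cst i 0 x); apply: near_eq_partial.
  by near=> y; rewrite big_nil.
rewrite big_cons.
have -> : (fun y => \sum_(j <- k :: r | P j) F j y) = (fun y => 
   if P k then F k y + \sum_(j <- r | P j) F j y else \sum_(j <- r | P j) F j y).
  by apply/funext => y; rewrite big_cons.
case Pk : (P k); rewrite ?partialD ?ih //; first exact: dF.
exact: differentiable_bigsum.
Unshelve. all: by end_near. Qed.

End PartialRules.

Section ChainRule.
Context {R : realType} {d e : nat}.
Implicit Types (phi : 'rV[R]_d -> 'rV[R]_e) (x : 'rV[R]_d).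

Lemma differentiable_row phi x :
  (forall k, differentiable (fun y => phi y 0 k) x) -> differentiable phi x.
Proof.
move=> dphi.
have -> : phi = \sum_k (fun y => phi y 0 k *: delta_mx 0 k).
  by apply/funext => y; rewrite fct_sumE -row_sum_delta.
by apply: differentiable_sum => k; apply: differentiableZl.
Qed.

Lemma derive_coord phi x v k : differentiable phi x ->
  ('D_v phi x) 0 k = 'D_v (fun y => phi y 0 k) x.
Proof.
by move=> dphi; rewrite derive_mx ?mxE //; exact: diff_derivable.
Qed.

Lemma jacobianE phi x : (forall k, differentiable (fun y => phi y 0 k) x) ->
  jacobian phi x = \matrix_(i, k) partial i (fun y => phi y 0 k) x.
Proof.
move=> dphi; apply/matrixP => i k; rewrite !mxE.
have dp := differentiable_row dphi.
by rewrite -deriveE // derive_coord.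
Qed.

Lemma near_eq_jacobian phi psi x :
  {near x, phi =1 psi} -> (forall k, differentiable (fun y => phi y 0 k) x) ->
  jacobian phi x = jacobian psi x.
Proof.
move=> pp dphi; have dpsi k : differentiable (fun y => psi y 0 k) x.
  apply: near_eq_differentiable (dphi k); apply: filterS pp => y; rewrite /= => -> //.
rewrite !jacobianE //; apply/matrixP => i k; rewrite !mxE.
by apply: near_eq_partial; apply: filterS pp => y /= ->.
Qed.

Lemma derive_chain (f : 'rV[R]_e -> R) phi x v :
  differentiable f (phi x) -> (forall k, differentiable (fun y => phi y 0 k) x) ->
  'D_v (fun y => f (phi y)) x
  = \sum_k 'D_v (fun y => phi y 0 k) x * partial k f (phi x).
Proof.
move=> df dphi; have dp := differentiable_row dphi.
rewrite deriveE; last exact: (@differentiable_comp _ _ _ _ phi f).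
rewrite (@diff_comp _ _ _ _ phi f) //=.
rewrite -(deriveE v dp) [X in 'd f _ X]row_sum_delta linear_sum; apply: eq_bigr => k _.
by rewrite linearZ /= -deriveE // derive_coord.
Qed.

Lemma partial_chain i (f : 'rV[R]_e -> R) phi x :
  differentiable f (phi x) -> (forall k, differentiable (fun y => phi y 0 k) x) ->
  partial i (fun y => f (phi y)) x
  = \sum_k partial i (fun y => phi y 0 k) x * partial k f (phi x).
Proof. exact: derive_chain. Qed.

Lemma differentiable_chain (f : 'rV[R]_e -> R) phi x :
  differentiable f (phi x) -> (forall k, differentiable (fun y => phi y 0 k) x) ->
  differentiable (fun y => f (phi y)) x.
Proof.
by move=> df dphi; apply: (@differentiable_comp _ _ _ _ phi f) => //; exact: differentiable_row.
Qed.

End ChainRule.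

Lemma jacobian_chain {R : realType} {d e c : nat} (phi : 'rV[R]_d -> 'rV[R]_e)
    (psi : 'rV[R]_e -> 'rV[R]_c) x :
  (forall k, differentiable (fun y => phi y 0 k) x) ->
  (forall k, differentiable (fun y => psi y 0 k) (phi x)) ->
  jacobian (psi \o phi) x = jacobian phi x *m jacobian psi (phi x).
Proof.
move=> dphi dpsi; rewrite !jacobianE //.
  apply/matrixP => i k; rewrite !mxE /= (partial_chain i (dpsi k) dphi).
  by apply: eq_bigr => j _; rewrite !mxE.
move=> k; exact: (differentiable_chain (dpsi k) dphi).
Qed.

Lemma near_all_fin {T : topologicalType} (I : finType) (P : I -> T -> Prop) (x : T) :
  (forall i, \forall y \near x, P i y) -> \forall y \near x, forall i, P i y.
Proof. exact: filter_forall. Qed.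

(* k times differentiable near x: the derivatives of order k need not be
   continuous, and [Ck_rec 0] is vacuous. *)
Fixpoint Ck_rec {R : realType} {d : nat} (k : nat) (f : 'rV[R]_d -> R)
    (x : 'rV[R]_d) : Prop :=
  if k is k'.+1 then
    (\forall y \near x, differentiable f y) /\ forall i, Ck_rec k' (partial i f) x
  else True.

(** Locked so that numerals such as [Ck 2] do not unfold into nested conjunctions; [Ck0] and [CkSP]
    are the only access to the recursion. *)
HB.lock Definition Ck {R : realType} {d : nat} (k : nat) (f : 'rV[R]_d -> R)
    (x : 'rV[R]_d) : Prop := Ck_rec k f x.

Section Ck.
Context {R : realType} {d : nat}.
Implicit Types (f g : 'rV[R]_d -> R) (x : 'rV[R]_d).

Lemma Ck0 f x : Ck 0 f x.
Proof. by rewrite unlock. Qed.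

Lemma CkSP k f x : Ck k.+1 f x <->
  (\forall y \near x, differentiable f y) /\ forall i, Ck k (partial i f) x.
Proof. by rewrite unlock. Qed.

Lemma Ck_near k f g x : {near x, f =1 g} -> Ck k f x -> Ck k g x.
Proof.
elim: k f g => [|k ih] f g fg; first by move=> _; exact: Ck0.
move=> /CkSP[df pf]; apply/CkSP; split.
  move/near_join : fg => fg; near=> y; apply: (@near_eq_differentiable _ _ _ f).
    by near: y.
  by near: y.
by move=> i; apply: ih (pf i); exact: partial_near.
Unshelve. all: by end_near. Qed.

Lemma CkS k f x : Ck k.+1 f x -> Ck k f x.
Proof.
elim: k f => [|k ih] f; first by move=> _; exact: Ck0.
move=> /CkSP[df pf]; apply/CkSP; split => // i; exact/ih/pf.
Qed.

Lemma Ck_partial k f x i : Ck k.+1 f x -> Ck k (partial i f) x.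
Proof. by move=> /CkSP[_]; exact. Qed.

Lemma Ck_differentiable k f x : Ck k.+1 f x -> differentiable f x.
Proof. by move=> /CkSP[/nbhs_singleton]. Qed.

Lemma Ck_differentiable_near k f x :
  Ck k.+1 f x -> \forall y \near x, differentiable f y.
Proof. by move=> /CkSP[]. Qed.

Lemma Ck_near_Ck k f x : Ck k f x -> \forall y \near x, Ck k f y.
Proof.
elim: k f => [|k ih] f; first by move=> _; near=> y; exact: Ck0.
move=> /CkSP[/near_join df pf]; have : \forall y \near x, forall i, Ck k (partial i f) y.
  by apply: near_all_fin => i; exact/ih/pf.
by move=> h; near=> y; apply/CkSP; split; [near: y|near: y].
Unshelve. all: by end_near. Qed.

Lemma Ck_cst k (c : R) x : Ck k (fun=> c) x.
Proof.
elim: k c => [|k ih] c; first exact: Ck0.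
apply/CkSP; split; first by near=> y; exact: differentiable_cst.
move=> i; apply: Ck_near (ih 0); near=> y; by rewrite partial_cst.
Unshelve. all: by end_near. Qed.

Lemma CkD k f g x : Ck k f x -> Ck k g x -> Ck k (fun y => f y + g y) x.
Proof.
elim: k f g => [|k ih] f g; first by move=> _ _; exact: Ck0.
move=> /CkSP[df pf] /CkSP[dg pg]; apply/CkSP; split.
  by near=> y; apply: differentiableD; near: y.
move=> i; apply: Ck_near (ih _ _ (pf i) (pg i)).
by near=> y; rewrite partialD //; near: y.
Unshelve. all: by end_near. Qed.

Lemma CkN k f x : Ck k f x -> Ck k (fun y => - f y) x.
Proof.
elim: k f => [|k ih] f; first by move=> _; exact: Ck0.
move=> /CkSP[df pf]; apply/CkSP; split.
  by near=> y; apply: differentiableN; near: y.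
move=> i; apply: Ck_near (ih _ (pf i)).
by near=> y; rewrite partialN //; near: y.
Unshelve. all: by end_near. Qed.

Lemma CkB k f g x : Ck k f x -> Ck k g x -> Ck k (fun y => f y - g y) x.
Proof. by move=> cf cg; apply: CkD => //; exact: CkN. Qed.

Lemma CkM k f g x : Ck k f x -> Ck k g x -> Ck k (fun y => f y * g y) x.
Proof.
elim: k f g => [|k ih] f g; first by move=> _ _; exact: Ck0.
move=> cf cg; move: (cf) (cg) => /CkSP[df pf] /CkSP[dg pg]; apply/CkSP; split.
  by near=> y; apply: differentiableM; near: y.
move=> i; have := CkD (ih _ _ (pf i) (CkS cg)) (ih _ _ (CkS cf) (pg i)).
by apply: Ck_near; near=> y; rewrite partialM //; near: y.
Unshelve. all: by end_near. Qed.

Lemma near_neq0 f x : differentiable f x -> f x != 0 ->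
  \forall y \near x, f y != 0.
Proof.
move=> df fx0; have cf : {for x, continuous f} by exact: differentiable_continuous.
have : \forall z \near f x, z != 0.
  by apply: open_nbhs_nbhs; split => //; exact: open_neq.
exact: cf.
Qed.

Lemma CkV k f x : f x != 0 -> Ck k f x -> Ck k (fun y => (f y)^-1) x.
Proof.
elim: k => [|k ih] fx0; first by move=> _; exact: Ck0.
move=> cf; move: (cf) => /CkSP[df pf].
have f0 : \forall y \near x, f y != 0.
  by apply: near_neq0 => //; exact: Ck_differentiable cf.
apply/CkSP; split; first by near=> y; apply: differentiableV; near: y.
move=> i; have cV := ih fx0 (CkS cf).
have := CkM (CkN (CkM cV cV)) (pf i).
by apply: Ck_near; near=> y; rewrite partialV ?expr2 ?mulNr //; near: y.
Unshelve. all: by end_near. Qed.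

Lemma Ck_sum k (I : Type) (r : seq I) (P : pred I) (F : I -> 'rV[R]_d -> R) x :
  (forall j, P j -> Ck k (F j) x) -> Ck k (fun y => \sum_(j <- r | P j) F j y) x.
Proof.
move=> cF; elim: r => [|j r ih].
  by apply: Ck_near (Ck_cst k 0 x); near=> y; rewrite big_nil.
case Pj : (P j); last by apply: Ck_near ih; near=> y; rewrite big_cons Pj.
by apply: Ck_near (CkD (cF _ Pj) ih); near=> y; rewrite big_cons Pj.
Unshelve. all: by end_near. Qed.

Lemma Ck_prod k (I : Type) (r : seq I) (P : pred I) (F : I -> 'rV[R]_d -> R) x :
  (forall j, P j -> Ck k (F j) x) -> Ck k (fun y => \prod_(j <- r | P j) F j y) x.
Proof.
move=> cF; elim: r => [|j r ih].
  by apply: Ck_near (Ck_cst k 1 x); near=> y; rewrite big_nil.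
case Pj : (P j); last by apply: Ck_near ih; near=> y; rewrite big_cons Pj.
by apply: Ck_near (CkM (cF _ Pj) ih); near=> y; rewrite big_cons Pj.
Unshelve. all: by end_near. Qed.

Lemma smooth_Ck (U : set 'rV[R]_d) f x : (\forall y \near x, U y) -> smooth U f ->
  forall k, Ck k f x.
Proof.
move=> nU + k; elim: k f => [|k ih] f sf; first exact: Ck0.
apply/CkSP; split; first by apply: filterS nU => y Uy; exact: (sf [::]).
move=> i; apply: ih => s y Uy; have := sf (rcons s i) y Uy.
by rewrite foldr_rcons.
Qed.

End Ck.

Lemma Ck_comp {R : realType} {d e : nat} k (f : 'rV[R]_e -> R)
    (phi : 'rV[R]_d -> 'rV[R]_e) x :
  Ck k f (phi x) -> (forall j, Ck k (fun y => phi y 0 j) x) ->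
  Ck k (fun y => f (phi y)) x.
Proof.
elim: k f => [|k ih] f; first by move=> _ _; exact: Ck0.
move=> /CkSP[df pf] cphi.
have dphi : \forall y \near x, forall j, differentiable (fun y => phi y 0 j) y.
  by apply: near_all_fin => j; exact: Ck_differentiable_near (cphi j).
have cont : {for x, continuous phi}.
  apply: differentiable_continuous; apply: differentiable_row.
  exact: nbhs_singleton dphi.
have dfphi : \forall y \near x, differentiable f (phi y) by exact: (cont _ df).
apply/CkSP; split; first by near=> y; apply: differentiable_chain; near: y.
move=> i; have : Ck k (fun y =>
    \sum_j partial i (fun y => phi y 0 j) y * partial j f (phi y)) x.
  apply: Ck_sum => j _; apply: CkM; first exact: Ck_partial (cphi j).
  apply: ih => // l; exact/CkS/cphi.
by apply: Ck_near; near=> y; rewrite partial_chain //; near: y.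
Unshelve. all: by end_near. Qed.

(** S / T lies within e / 2 of both A and B. Used with S a second difference and T = t^2, to
    identify the two mixed partial derivatives. *)
Lemma limit_gap {R : realType} (S T A B e : R) : 0 < T ->
  `|S - T * A| <= e / 2 * T -> `|S - T * B| <= e / 2 * T -> `|B - A| <= e.
Proof.
move=> T0 h1 h2; rewrite -(ler_pM2r T0) -[X in _ * X <= _]gtr0_norm // -normrM.
have -> : (B - A) * T = (S - T * A) - (S - T * B) by ring.
apply: le_trans (ler_normB _ _) _; lra.
Qed.

(** * Symmetry of second partial derivatives *)

Section Schwarz.
Context {R : realType} {d : nat}.
Implicit Types (f : 'rV[R]_d -> R) (x : 'rV[R]_d).

Lemma differentiable_eps (W : normedModType R) (f : 'rV[R]_d -> W) x (e : R) :
  0 < e -> differentiable f x ->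
  exists2 r, 0 < r & forall h, `|h| < r -> `|f (h + x) - f x - 'd f x h| <= e * `|h|.
Proof.
move=> e0 df; have /eqaddoP/(_ e e0)/nbhs_ballP[r /= r0 hr] := diff_locally df.
exists r => // h hlt; have := hr h; rewrite -ball_normE /= sub0r normrN.
by move=> /(_ hlt); rewrite !fctE /= opprD addrA.
Qed.

Lemma norm_delta_mx (i : 'I_d) : `|delta_mx 0 i : 'rV[R]_d| <= 1.
Proof.
rewrite /Num.norm /= mx_normrE; apply: bigmax_le => //= -[j k] _ /=.
by rewrite mxE ord1 /=; case: (_ == _); rewrite ?normr1 ?normr0.
Qed.

Let dlt i : 'rV[R]_d := delta_mx 0 i.

Lemma is_derive_line f i (y : 'rV[R]_d) (s : R) : differentiable f (s *: delta_mx 0 i + y) ->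
  is_derive s 1 (fun s => f (s *: delta_mx 0 i + y)) (partial i f (s *: delta_mx 0 i + y)).
Proof.
move=> dfy; have dl : differentiable (fun s : R => s *: dlt i + y) s.
  by apply: differentiableD => //; exact: differentiableZl.
have dc : differentiable (fun s : R => f (s *: dlt i + y)) s.
  exact: (@differentiable_comp _ _ _ _ (fun s : R => s *: dlt i + y) f).
apply: DeriveDef; first exact: diff_derivable.
rewrite deriveE // (@diff_comp _ _ _ _ (fun s : R => s *: dlt i + y) f) //=.
rewrite /partial deriveE //; congr ('d f _ _).
rewrite -deriveE // deriveD //; last first.
  by apply: diff_derivable; exact: differentiableZl.
rewrite derive_cst addr0 deriveE; last exact: differentiableZl.
by rewrite diffZl //= diff_val scale1r.
Qed.

Let second_difference f x i j t :=
  f (t *: dlt i + t *: dlt j + x) - f (t *: dlt i + x)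
  - (f (t *: dlt j + x) - f x).

(** The second difference is q t - q 0 for the function q below, so the mean value theorem turns it
    into t times a difference of two values of [partial i f]. Expanding both values to first order
    at x, the contributions along e_i cancel and t times the derivative along e_j remains. *)
Lemma second_difference_partial f x i j (e : R) : 0 < e ->
  (\forall y \near x, differentiable f y) -> differentiable (partial i f) x ->
  \forall t \near 0^'+,
   `|second_difference f x i j t - t ^+ 2 * partial j (partial i f) x|
     <= e * t ^+ 2.
Proof.
move=> e0 /nbhs_ballP[r /= r0 df] dp.
(* The two expansion errors will be at most (e / 4) (2 t) and (e / 4) t, which together stay below e
   t. *)
have e40 : 0 < e / 4 by rewrite divr_gt0.
have [r' r'0 hr'] := differentiable_eps e40 dp.
near=> t; have t0 : 0 < t by [].
have tr : t + t < r.
  have : t < r / 2 by near: t; apply: nbhs_right_lt; rewrite divr_gt0.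
  lra.
have tr' : t + t < r'.
  have : t < r' / 2 by near: t; apply: nbhs_right_lt; rewrite divr_gt0.
  lra.
have small s : 0 <= s <= t -> `|s *: dlt i| <= t.
  move=> /andP[s0 st]; rewrite normrZ ger0_norm // (le_trans _ st) //.
  by rewrite ler_piMr // norm_delta_mx.
have smallj : `|t *: dlt j| <= t.
  by rewrite normrZ ger0_norm ?(ltW t0) // ler_piMr ?(ltW t0) // norm_delta_mx.
have small2 s : 0 <= s <= t -> `|s *: dlt i + t *: dlt j| <= t + t.
  by move=> st; rewrite (le_trans (ler_normD _ _)) // lerD // small.
pose q s := f (s *: dlt i + (t *: dlt j + x)) - f (s *: dlt i + x).
pose dq s := partial i f (s *: dlt i + (t *: dlt j + x))
              - partial i f (s *: dlt i + x).
have dline y s := @is_derive_line f i y s.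
have dfball s : 0 <= s <= t ->
    differentiable f (s *: dlt i + (t *: dlt j + x)) /\ 
    differentiable f (s *: dlt i + x).
  move=> st; split; apply: df; rewrite -ball_normE /=.
    rewrite addrA opprD addrCA subrr addr0 normrN.
    exact: le_lt_trans (small2 _ st) tr.
  rewrite opprD addrCA subrr addr0 normrN.
  by apply: le_lt_trans (small _ st) _; rewrite (le_lt_trans _ tr) // lerDl ltW.
have qd s : 0 <= s <= t -> is_derive s 1 q (dq s).
  move=> /dfball[d1 d2]; apply: is_deriveB; exact: dline.
have [s] : exists2 s, s \in `]0, t[%R & q t - q 0 = dq s * (t - 0).
  apply: MVT => // [s|].
    by rewrite in_itv /= => /andP[s0 st]; apply: qd; rewrite !ltW.
  apply: derivable_within_continuous => s; rewrite in_itv /= => st.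
  by have [] := qd s st.
rewrite in_itv /= => /andP[s0 st] qE.
have s0t : 0 <= s <= t by rewrite !ltW.
have -> : second_difference f x i j t = dq s * t.
  rewrite subr0 in qE; rewrite -qE /q /second_difference !scale0r !add0r addrA.
  by [].
have b1 := hr' _ (le_lt_trans (small2 _ s0t) tr').
have tlt : t < r' by rewrite (le_lt_trans _ tr') // lerDl ltW.
have b2 := hr' _ (le_lt_trans (small _ s0t) tlt).
have -> : partial j (partial i f) x = 'd (partial i f) x (dlt j).
  by rewrite {1}/partial deriveE.
set D := 'd (partial i f) x in b1 b2 *.
rewrite raddfD /= in b1; have E : D (t *: dlt j) = t * D (dlt j) by rewrite linearZ.
rewrite E -[_ + _ + x]addrA in b1.
have {}b1 := le_trans b1 (ler_wpM2l (ltW e40) (small2 _ s0t)).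
have {}b2 := le_trans b2 (ler_wpM2l (ltW e40) (small _ s0t)).
rewrite expr2 mulrC -mulrA -mulrBr normrM (gtr0_norm t0).
rewrite [leRHS]mulrCA ler_pM2l // /dq.
move: b1 b2; rewrite !ler_norml; set A := partial i f _; set B := partial i f _.
set A' := partial i f _; set C := D _; set C' := D _.
move: A B A' C C' => A B A' C C' /andP[b1 b1'] /andP[b2 b2'].
have et0 : 0 < e * t by rewrite mulr_gt0.
by apply/andP; split; lra.
Unshelve. all: by end_near. Qed.

(** Young's form of the theorem, which asks for no continuity of second derivatives; this suits
    [Ck], whose top derivatives may be discontinuous. The second difference is symmetric in i and j
    and approximates both mixed derivatives times t^2. *)
Lemma partialC f x i j : (\forall y \near x, differentiable f y) ->
  differentiable (partial i f) x -> differentiable (partial j f) x ->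
  partial i (partial j f) x = partial j (partial i f) x.
Proof.
move=> df di dj; apply/eqP; rewrite -subr_eq0 -normr_le0; apply/ler_addgt0Pl => e e0.
rewrite addr0.
have e20 : 0 < e / 2 by rewrite divr_gt0.
have h1 := second_difference_partial j e20 df di.
have h2 := second_difference_partial i e20 df dj.
suff : exists2 t : R, 0 < t &
   `|second_difference f x i j t - t ^+ 2 * partial j (partial i f) x|
     <= e / 2 * t ^+ 2 /\
   `|second_difference f x j i t - t ^+ 2 * partial i (partial j f) x|
     <= e / 2 * t ^+ 2.
  move=> [t t0 []]; have -> : second_difference f x j i t = second_difference f x i j t.
    rewrite /second_difference [t *: dlt j + t *: _]addrC.
    by move: (f _) (f _) (f _) (f _) => u v w z; rewrite !opprB addrACA [RHS]addrACA [- v - w]addrC.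
  have t20 : 0 < t ^+ 2 by rewrite exprn_gt0.
  exact: limit_gap.
have [t [[ht1 ht2] t0]] := filter_ex (filterI (filterI h1 h2) (nbhs_right_gt 0)).
exact: (ex_intro2 _ _ t t0 (conj ht1 ht2)).
Qed.

Lemma Ck_partialC f x i j : Ck 2 f x ->
  partial i (partial j f) x = partial j (partial i f) x.
Proof.
move=> /CkSP[df pf]; apply: partialC df _ _; exact: Ck_differentiable (pf _).
Qed.

End Schwarz.

#[local] Opaque partial.

HB.lock Definition mpartial {R : realType} {d : nat} (i : 'I_d) {p q : nat}
    (A : 'rV[R]_d -> 'M[R]_(p, q)) (x : 'rV[R]_d) : 'M[R]_(p, q) :=
  \matrix_(j, k) partial i (fun y => A y j k) x.

(** * Calculus of matrix-valued functions *)

Section MatrixCalculus.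
Context {R : realType} {d : nat}.
Implicit Types (x : 'rV[R]_d).

Lemma mpartialE i p q (A : 'rV[R]_d -> 'M[R]_(p, q)) x j k :
  mpartial i A x j k = partial i (fun y => A y j k) x.
Proof. by rewrite unlock mxE. Qed.

Definition mCk (n : nat) p q (A : 'rV[R]_d -> 'M[R]_(p, q)) x : Prop :=
  forall j k, Ck n (fun y => A y j k) x.

Lemma mpartial_near i p q (A B : 'rV[R]_d -> 'M[R]_(p, q)) x :
  {near x, A =1 B} -> mpartial i A x = mpartial i B x.
Proof.
move=> AB; apply/matrixP => j k; rewrite ?(mpartialE, mxE); apply: near_eq_partial.
by apply: filterS AB => y /= ->.
Qed.

Lemma mCk_near n p q (A B : 'rV[R]_d -> 'M[R]_(p, q)) x :
  {near x, A =1 B} -> mCk n A x -> mCk n B x.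
Proof.
move=> AB cA j k; apply: Ck_near (cA j k).
by apply: filterS AB => y /= ->.
Qed.

Lemma mCkS n p q (A : 'rV[R]_d -> 'M[R]_(p, q)) x : mCk n.+1 A x -> mCk n A x.
Proof. by move=> cA j k; exact/CkS/cA. Qed.

Lemma mCk_le n n' p q (A : 'rV[R]_d -> 'M[R]_(p, q)) x : (n' <= n)%N ->
  mCk n A x -> mCk n' A x.
Proof.
move=> /subnK <-; elim: (n - n')%N => // k ih cA; exact/ih/mCkS.
Qed.

Lemma mCk_near_mCk n p q (A : 'rV[R]_d -> 'M[R]_(p, q)) x :
  mCk n A x -> \forall y \near x, mCk n A y.
Proof.
move=> cA; apply: near_all_fin => j; apply: near_all_fin => k.
exact/Ck_near_Ck/cA.
Qed.

Lemma mCk_mpartial n i p q (A : 'rV[R]_d -> 'M[R]_(p, q)) x :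
  mCk n.+1 A x -> mCk n (mpartial i A) x.
Proof.
move=> cA j k; apply: Ck_near (Ck_partial i (cA j k)).
by near=> y; rewrite ?(mpartialE, mxE).
Unshelve. all: by end_near. Qed.

Lemma mpartial_cst i p q (A : 'M[R]_(p, q)) x : mpartial i (fun=> A) x = 0.
Proof. by apply/matrixP => j k; rewrite ?(mpartialE, mxE) partial_cst. Qed.

Lemma mCk_cst n p q (A : 'M[R]_(p, q)) x : mCk n (fun=> A) x.
Proof. by move=> j k; exact: Ck_cst. Qed.

Lemma mpartialD i p q (A B : 'rV[R]_d -> 'M[R]_(p, q)) x :
  mCk 1 A x -> mCk 1 B x ->
  mpartial i (fun y => A y + B y) x = mpartial i A x + mpartial i B x.
Proof.
move=> cA cB; apply/matrixP => j k; rewrite ?(mpartialE, mxE).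
rewrite -partialD; try exact: Ck_differentiable (cA j k); try exact: Ck_differentiable (cB j k).
by apply: near_eq_partial; near=> y; rewrite mxE.
Unshelve. all: by end_near. Qed.

Lemma mCkD n p q (A B : 'rV[R]_d -> 'M[R]_(p, q)) x :
  mCk n A x -> mCk n B x -> mCk n (fun y => A y + B y) x.
Proof.
move=> cA cB j k; apply: Ck_near (CkD (cA j k) (cB j k)).
by near=> y; rewrite ?(mpartialE, mxE).
Unshelve. all: by end_near. Qed.

Lemma mCkN n p q (A : 'rV[R]_d -> 'M[R]_(p, q)) x :
  mCk n A x -> mCk n (fun y => - A y) x.
Proof.
move=> cA j k; apply: Ck_near (CkN (cA j k)).
by near=> y; rewrite ?(mpartialE, mxE).
Unshelve. all: by end_near. Qed.

Lemma mCkB n p q (A B : 'rV[R]_d -> 'M[R]_(p, q)) x :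
  mCk n A x -> mCk n B x -> mCk n (fun y => A y - B y) x.
Proof. by move=> cA cB; apply: mCkD => //; exact: mCkN. Qed.

Lemma mpartialM i p q r (A : 'rV[R]_d -> 'M[R]_(p, q))
    (B : 'rV[R]_d -> 'M[R]_(q, r)) x : mCk 1 A x -> mCk 1 B x ->
  mpartial i (fun y => A y *m B y) x = mpartial i A x *m B x + A x *m mpartial i B x.
Proof.
move=> cA cB; apply/matrixP => j k; rewrite ?(mpartialE, mxE) -big_split /=.
have dA l := Ck_differentiable (cA j l); have dB l := Ck_differentiable (cB l k).
have -> : (fun y => (A y *m B y) j k) = (fun y => \sum_l A y j l * B y l k).
  by apply/funext => y; rewrite mxE.
rewrite partial_sum; last by move=> l _; exact: differentiableM.
by apply: eq_bigr => l _; rewrite partialM // !mpartialE.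
Qed.

Lemma mCkM n p q r (A : 'rV[R]_d -> 'M[R]_(p, q))
    (B : 'rV[R]_d -> 'M[R]_(q, r)) x :
  mCk n A x -> mCk n B x -> mCk n (fun y => A y *m B y) x.
Proof.
move=> cA cB j k.
have : Ck n (fun y => \sum_l A y j l * B y l k) x.
  by apply: Ck_sum => l _; exact: CkM.
by apply: Ck_near; near=> y; rewrite mxE.
Unshelve. all: by end_near. Qed.

Lemma mpartial_tr i p q (A : 'rV[R]_d -> 'M[R]_(p, q)) x :
  mpartial i (fun y => (A y)^T) x = (mpartial i A x)^T.
Proof.
apply/matrixP => j k; rewrite ?(mpartialE, mxE); apply: near_eq_partial.
by near=> y; rewrite ?(mpartialE, mxE).
Unshelve. all: by end_near. Qed.

Lemma mCk_tr n p q (A : 'rV[R]_d -> 'M[R]_(p, q)) x :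
  mCk n A x -> mCk n (fun y => (A y)^T) x.
Proof.
move=> cA j k; apply: Ck_near (cA k j).
by near=> y; rewrite ?(mpartialE, mxE).
Unshelve. all: by end_near. Qed.

Lemma mpartialZ i p q (f : 'rV[R]_d -> R) (A : 'rV[R]_d -> 'M[R]_(p, q)) x :
  Ck 1 f x -> mCk 1 A x ->
  mpartial i (fun y => f y *: A y) x = partial i f x *: A x + f x *: mpartial i A x.
Proof.
move=> cf cA; apply/matrixP => j k; rewrite ?(mpartialE, mxE).
rewrite -partialM; try exact: Ck_differentiable (cA j k); try exact: Ck_differentiable cf.
by apply: near_eq_partial; near=> y; rewrite mxE.
Unshelve. all: by end_near. Qed.

Lemma mCkZ n p q (f : 'rV[R]_d -> R) (A : 'rV[R]_d -> 'M[R]_(p, q)) x :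
  Ck n f x -> mCk n A x -> mCk n (fun y => f y *: A y) x.
Proof.
move=> cf cA j k; apply: Ck_near (CkM cf (cA j k)).
by near=> y; rewrite ?(mpartialE, mxE).
Unshelve. all: by end_near. Qed.

Lemma mCk_sum n p q (I : Type) (r : seq I) (P : pred I)
    (F : I -> 'rV[R]_d -> 'M[R]_(p, q)) x :
  (forall j, P j -> mCk n (F j) x) -> mCk n (fun y => \sum_(j <- r | P j) F j y) x.
Proof.
move=> cF j k.
have : Ck n (fun y => \sum_(l <- r | P l) F l y j k) x.
  by apply: Ck_sum => l Pl; exact: cF.
by apply: Ck_near; near=> y; rewrite summxE.
Unshelve. all: by end_near. Qed.

Lemma mpartial_sum i p q (I : Type) (r : seq I) (P : pred I)
    (F : I -> 'rV[R]_d -> 'M[R]_(p, q)) x :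
  (forall j, P j -> mCk 1 (F j) x) ->
  mpartial i (fun y => \sum_(j <- r | P j) F j y) x
  = \sum_(j <- r | P j) mpartial i (F j) x.
Proof.
move=> cF; apply/matrixP => j k; rewrite mpartialE summxE.
under [RHS]eq_bigr do rewrite mpartialE.
rewrite -partial_sum; last by move=> l Pl; exact: Ck_differentiable (cF l Pl j k).
by apply: near_eq_partial; near=> y; rewrite summxE.
Unshelve. all: by end_near. Qed.

Lemma mpartialC i j p q (A : 'rV[R]_d -> 'M[R]_(p, q)) x : mCk 2 A x ->
  mpartial i (mpartial j A) x = mpartial j (mpartial i A) x.
Proof.
move=> cA; apply/matrixP => k l; rewrite mpartialE [RHS]mpartialE.
transitivity (partial i (partial j (fun y => A y k l)) x).
  by apply: near_eq_partial; near=> y; rewrite mpartialE.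
rewrite (Ck_partialC _ _ (cA k l)).
by apply: near_eq_partial; near=> y; rewrite mpartialE.
Unshelve. all: by end_near. Qed.

Lemma Ck_det n p (A : 'rV[R]_d -> 'M[R]_p) x : mCk n A x ->
  Ck n (fun y => \det (A y)) x.
Proof.
move=> cA; apply: Ck_sum => s _; apply: CkM; first exact: Ck_cst.
by apply: Ck_prod => l _; exact: cA.
Qed.

(** Near x the inverse is the adjugate over the determinant. The order 0 is split off because the
    determinant must be differentiable at x to stay nonzero nearby. *)
Lemma mCk_inv n p (A : 'rV[R]_d -> 'M[R]_p) x : A x \in unitmx -> mCk n A x ->
  mCk n (fun y => invmx (A y)) x.
Proof.
move=> uA cA; case: n cA => [|n] cA; first by move=> j k; exact: Ck0.
have cdet := Ck_det cA.
have dnz : \det (A x) != 0 by rewrite -unitfE -unitmxE.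
have : mCk n.+1 (fun y => (\det (A y))^-1 *: \adj (A y)) x.
  apply: mCkZ; first exact: CkV.
  move=> j k; have : Ck n.+1 (fun y => cofactor (A y) k j) x.
    apply: CkM; first exact: Ck_cst.
    apply: Ck_det => a b; apply: Ck_near (cA (lift k a) (lift j b)).
    by near=> y; rewrite ?(mpartialE, mxE).
  by apply: Ck_near; near=> y; rewrite mxE.
apply: mCk_near; have := near_neq0 (Ck_differentiable cdet) dnz.
apply: filterS => y dy /=; rewrite /invmx unitmxE unitfE dy //.
Unshelve. all: by end_near. Qed.

Lemma mpartial_inv i p (A : 'rV[R]_d -> 'M[R]_p) x : A x \in unitmx -> mCk 1 A x ->
  mpartial i (fun y => invmx (A y)) x = - (invmx (A x) *m mpartial i A x *m invmx (A x)).
Proof.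
move=> uA cA; have cI := mCk_inv uA cA.
have dnz : \det (A x) != 0 by rewrite -unitfE -unitmxE.
have h : mpartial i (fun y => A y *m invmx (A y)) x = 0.
  rewrite -(mpartial_cst i (1%:M : 'M[R]_p) x); apply: mpartial_near.
  have := near_neq0 (Ck_differentiable (Ck_det cA)) dnz.
  by apply: filterS => y dy /=; rewrite mulmxV // unitmxE unitfE.
rewrite mpartialM // in h.
have {}h : invmx (A x) *m (A x *m mpartial i (fun y => invmx (A y)) x) =
   - (invmx (A x) *m (mpartial i A x *m invmx (A x))).
  by rewrite -mulmxN; congr (_ *m _); apply/eqP; rewrite -addr_eq0 addrC; apply/eqP.
by move: h; rewrite mulmxA mulVmx // mul1mx => ->; rewrite mulmxA.
Qed.

Lemma near_unitmx p (A : 'rV[R]_d -> 'M[R]_p) x : A x \in unitmx -> mCk 1 A x ->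
  \forall y \near x, A y \in unitmx.
Proof.
move=> uA cA; have dnz : \det (A x) != 0 by rewrite -unitfE -unitmxE.
have := near_neq0 (Ck_differentiable (Ck_det cA)) dnz.
by apply: filterS => y dy; rewrite unitmxE unitfE.
Qed.

End MatrixCalculus.

Lemma mCk_comp {R : realType} {d e : nat} n p q (A : 'rV[R]_e -> 'M[R]_(p, q))
    (phi : 'rV[R]_d -> 'rV[R]_e) x :
  mCk n A (phi x) -> mCk n phi x -> mCk n (fun y => A (phi y)) x.
Proof.
by move=> cA cphi j k; apply: (Ck_comp (f := fun z => A z j k)) => // l; exact: cphi.
Qed.

Lemma mpartial_chain {R : realType} {d e : nat} i p q (A : 'rV[R]_e -> 'M[R]_(p, q))
    (phi : 'rV[R]_d -> 'rV[R]_e) x :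
  mCk 1 A (phi x) -> mCk 1 phi x ->
  mpartial i (fun y => A (phi y)) x =
  \sum_k partial i (fun y => phi y 0 k) x *: mpartial k A (phi x).
Proof.
move=> cA cphi; apply/matrixP => j k; rewrite mpartialE summxE.
rewrite (@partial_chain _ _ _ i (fun z => A z j k) phi).
- by apply: eq_bigr => l _; rewrite !(mxE, mpartialE).
- exact: Ck_differentiable (cA j k).
- by move=> l; exact: Ck_differentiable (cphi 0 l).
Qed.

(** * The Levi-Civita connection in matrix form *)

Section LeviCivita.
Context {R : realType} {d : nat}.
Implicit Types (G : 'rV[R]_d -> 'M[R]_d) (x : 'rV[R]_d).

(* The row vector of components of nabla_i e_k is row k of [conn G i]. *)
Definition conn G i x : 'M[R]_d := \matrix_(k, l) christoffel G l i k x.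

(* Endomorphisms act on rows from the right, hence the reversed commutator. *)
Definition Rmx G i j x : 'M[R]_d :=
  mpartial i (conn G j) x - mpartial j (conn G i) x
  + (conn G j x *m conn G i x - conn G i x *m conn G j x).

Lemma curvatureE G l i j k x : curvature G l i j k x = Rmx G i j x k l.
Proof.
rewrite /curvature /Rmx !mxE; congr (_ - _ + _).
- by rewrite mpartialE; apply: near_eq_partial; near=> y; rewrite mxE.
- by rewrite mpartialE; apply: near_eq_partial; near=> y; rewrite mxE.
- rewrite -sumrB; apply: eq_bigr => a _; rewrite !mxE.
  by rewrite [X in X - _]mulrC [X in _ - X]mulrC.
Unshelve. all: by end_near. Qed.

Lemma christoffelE G k i j x : christoffel G k i j x =
  2^-1 * \sum_l invmx (G x) k l *
    (mpartial i G x j l + mpartial j G x i l - mpartial l G x i j).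
Proof.
rewrite /christoffel; congr (_ * _); apply: eq_bigr => l _.
by rewrite !mpartialE.
Qed.

(** Christoffel symbols of the first kind, as a linear function of the first derivatives of the
    metric; the derivatives are an argument so that the same expression can be differentiated and
    bounded. *)
Definition lowered_conn (dG : 'I_d -> 'M[R]_d) i : 'M[R]_d :=
  \matrix_(k, l) (2^-1 * (dG i k l + dG k i l - dG l i k)).

Lemma conn_lowered G i x : (G x)^T = G x ->
  conn G i x = lowered_conn (fun j => mpartial j G x) i *m invmx (G x).
Proof.
move=> sG; have sI : (invmx (G x))^T = invmx (G x) by rewrite trmx_inv sG.
apply/matrixP => k l; rewrite !mxE christoffelE mulr_sumr; apply: eq_bigr => m _.
by rewrite !mxE -[in LHS]sI mxE mulrCA mulrA [RHS]mulrC mulrA mulrC mulrA.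
Qed.

(** Uniqueness of the Levi-Civita connection at a single point: the Koszul combination of three
    compatibility equations, simplified by the vanishing torsion, leaves the lowered form of A. *)
Lemma conn_unique G x (A : 'I_d -> 'M[R]_d) : G x \in unitmx -> (G x)^T = G x ->
  (forall i, mpartial i G x = A i *m G x + G x *m (A i)^T) ->
  (forall i k, row k (A i) = row i (A k)) ->
  forall i, conn G i x = A i.
Proof.
move=> uG sG compat tors i; rewrite conn_lowered //.
rewrite -[RHS](mulmxK uG); congr (_ *m _); apply/matrixP => k l; rewrite mxE.
(* This is the inner product of nabla_i e_k with e_m. *)
pose C i k m := (A i *m G x) k m.
have dE a b c : mpartial a G x b c = C a b c + C a c b.
  by rewrite compat mxE /C; congr (_ + _); rewrite -[in LHS]sG -trmx_mul mxE.
have CC a b c : C a b c = C b a c.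
  rewrite /C; transitivity ((row b (A a) *m G x) 0 c).
    by rewrite -row_mul [RHS]mxE.
  by rewrite tors -row_mul [LHS]mxE.
rewrite !dE -/(C _ _ _) (CC l i k) (CC k l i) (CC k i l).
by field.
Qed.

End LeviCivita.

Section LeviCivitaProperties.
Context {R : realType} {d : nat}.
Implicit Types (G : 'rV[R]_d -> 'M[R]_d) (x : 'rV[R]_d).

Lemma mpartial_sym G i x : {near x, forall y, (G y)^T = G y} ->
  (mpartial i G x)^T = mpartial i G x.
Proof. by move=> sG; rewrite -mpartial_tr; exact: mpartial_near. Qed.

Lemma conn_compat G i x : G x \in unitmx -> {near x, forall y, (G y)^T = G y} ->
  mpartial i G x = conn G i x *m G x + G x *m (conn G i x)^T.
Proof.
move=> uG sG; have sGx : (G x)^T = G x by exact: nbhs_singleton sG.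
have cG : conn G i x *m G x = lowered_conn (fun j => mpartial j G x) i.
  by rewrite conn_lowered // mulmxKV.
rewrite -[X in X *m (conn _ _ _)^T]sGx -trmx_mul cG.
apply/matrixP => k l; rewrite !mxE.
have sd a b c : mpartial a G x b c = mpartial a G x c b.
  by rewrite -[in LHS](mpartial_sym a sG) mxE.
by rewrite (sd i l k); field.
Qed.

Lemma conn_torsion G i k x : {near x, forall y, (G y)^T = G y} ->
  row k (conn G i x) = row i (conn G k x).
Proof.
move=> sG; have sd a b c : mpartial a G x b c = mpartial a G x c b.
  by rewrite -[in LHS](mpartial_sym a sG) mxE.
apply/rowP => l; rewrite !mxE !christoffelE; congr (_ * _); apply: eq_bigr => m _.
by rewrite (sd m i k) [X in X - _]addrC.
Qed.

Lemma mCk_conn n G i x : G x \in unitmx -> mCk n.+1 G x -> mCk n (conn G i) x.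
Proof.
move=> uG cG k l.
have cI := mCk_inv uG (mCkS cG).
have : Ck n (fun y => 2^-1 * \sum_m invmx (G y) l m *
    (mpartial i G y k m + mpartial k G y i m - mpartial m G y i k)) x.
  apply: CkM; first exact: Ck_cst.
  apply: Ck_sum => m _; apply: CkM; first exact: cI.
  apply: CkB; last exact: (mCk_mpartial m cG).
  by apply: CkD; [exact: (mCk_mpartial i cG)|exact: (mCk_mpartial k cG)].
by apply: Ck_near; near=> y; rewrite mxE christoffelE.
Unshelve. all: by end_near. Qed.

End LeviCivitaProperties.

(** Same formula as [Rmx], for a connection that need not come from a metric in coordinates and
    whose matrices may have any size. *)
Definition curv {R : realType} {d p : nat} (A : 'I_d -> 'rV[R]_d -> 'M[R]_p)
    (i j : 'I_d) (x : 'rV[R]_d) : 'M[R]_p :=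
  mpartial i (A j) x - mpartial j (A i) x + (A j x *m A i x - A i x *m A j x).

(** Curvature is tensorial under a change of frame. Differentiating the gauge relation expresses dA
    T through dB and second derivatives of T; antisymmetrising, the latter cancel by symmetry and
    the terms in dT are absorbed by the commutators. *)
Lemma gauge_curvature {R : realType} {d p q : nat}
    (A : 'I_d -> 'rV[R]_d -> 'M[R]_p) (B : 'I_d -> 'rV[R]_d -> 'M[R]_q)
    (T : 'rV[R]_d -> 'M[R]_(p, q)) x :
  (forall i, mCk 1 (A i) x) -> (forall i, mCk 1 (B i) x) -> mCk 2 T x ->
  (forall j, {near x, forall y, A j y *m T y = T y *m B j y + mpartial j T y}) ->
  forall i j, curv A i j x *m T x = T x *m curv B i j x.
Proof.
move=> cA cB cT gauge i j.
have dg a c : mpartial a (A c) x *m T x + A c x *m mpartial a T x =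
   mpartial a T x *m B c x + T x *m mpartial a (B c) x + mpartial a (mpartial c T) x.
  rewrite -mpartialM //; last exact: mCkS.
  rewrite (mpartial_near a (gauge c)) mpartialD.
  - by rewrite mpartialM //; exact: mCkS.
  - by apply: mCkM => //; exact: mCkS.
  - exact: mCk_mpartial.
have g c : A c x *m T x = T x *m B c x + mpartial c T x.
  exact: nbhs_singleton (gauge c).
have AA a c : A a x *m A c x *m T x = T x *m (B a x *m B c x) +
    mpartial a T x *m B c x + A a x *m mpartial c T x.
  by rewrite -mulmxA g mulmxDr mulmxA g mulmxDl mulmxA.
have d1 : mpartial i (A j) x *m T x = mpartial i T x *m B j x
    + T x *m mpartial i (B j) x + mpartial i (mpartial j T) x - A j x *m mpartial i T x.
  by rewrite -dg addrK.
have d2 : mpartial j (A i) x *m T x = mpartial j T x *m B i x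
    + T x *m mpartial j (B i) x + mpartial j (mpartial i T) x - A i x *m mpartial j T x.
  by rewrite -dg addrK.
rewrite /curv !(mulmxDl, mulmxDr, mulNmx, mulmxN) !AA d1 d2 (mpartialC i j cT).
move: (mpartial j (mpartial i T) x) (A j x *m mpartial i T x)
  (A i x *m mpartial j T x) (mpartial i T x *m B j x) (mpartial j T x *m B i x)
  (T x *m mpartial i (B j) x) (T x *m mpartial j (B i) x) (T x *m (B j x *m B i x))
  (T x *m (B i x *m B j x)) => a b c e f k l m o.
apply/matrixP => u v; rewrite !mxE; ring.
Qed.

Lemma split_lsh m n (i : 'I_m) : fintype.split (lshift n i) = inl i.
Proof. exact: (unsplitK (inl i)). Qed.

Lemma split_rsh m n (i : 'I_n) : fintype.split (rshift m i) = inr i.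
Proof. exact: (unsplitK (inr i)). Qed.

(** * Riemannian submersions with one-dimensional fibres *)

Section Frame.
Context {R : realType} {N : nat}.
Variables (h : 'rV[R]_N -> 'M[R]_N) (Z : 'M[R]_N).
Implicit Types (z : 'rV[R]_N).

(* The frame consists of the vertical vector e_0 and lifts of the coordinate
   vectors of the base; e_0 annihilates functions pulled back from the base. *)
Definition frame_metric z : 'M[R]_(1 + N) := block_mx 1 0 0 (h z).

Definition frame_partial p q (g : 'I_(1 + N)) (A : 'rV[R]_N -> 'M[R]_(p, q)) z :=
  if fintype.split g is inr mu then mpartial mu A z else 0.

Definition frame_torsion z : 'M[R]_(1 + N) :=
  block_mx 0 0 0 (2 *: (Z *m h z)).

(* Koszul's formula for an orthonormal vertical vector e_0 whose dual form s
   satisfies d s (u, v) = 2 (Z h)(u, v) on horizontal vectors. *)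
Definition frame_conn (g : 'I_(1 + N)) z : 'M[R]_(1 + N) :=
  if fintype.split g is inr mu then
    block_mx 0 (row mu Z) (- (row mu (Z *m h z))^T) (conn h mu z)
  else block_mx 0 0 0 Z.

(* The last term is - nabla_[e_g, e_g'], as [e_g, e_g'] = - frame_torsion g g' e_0. *)
Definition frame_curv (g g' : 'I_(1 + N)) z : 'M[R]_(1 + N) :=
  frame_partial g (frame_conn g') z - frame_partial g' (frame_conn g) z
  + (frame_conn g' z *m frame_conn g z - frame_conn g z *m frame_conn g' z)
  + frame_torsion z g g' *: frame_conn 0 z.

(** Metric compatibility. In the vertical direction it says that Z is skew-adjoint for h, which is
    the antisymmetry of Z h; in a horizontal direction the mixed blocks cancel in pairs and the
    lower block is compatibility of the base connection. *)
Lemma frame_compat g z : h z \in unitmx -> {near z, forall y, (h y)^T = h y} ->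
  (Z *m h z)^T = - (Z *m h z) ->
  frame_partial g frame_metric z =
  frame_conn g z *m frame_metric z + frame_metric z *m (frame_conn g z)^T.
Proof.
move=> uh sh asym; have shz : (h z)^T = h z by exact: nbhs_singleton sh.
have hZ : h z *m Z^T = - (Z *m h z) by rewrite -[X in X *m _]shz -trmx_mul.
rewrite /frame_partial /frame_conn /frame_metric; case: (fintype.split g) => [_|mu].
  rewrite tr_block_mx !mulmx_block !(mulmx0, mul0mx, addr0, add0r, trmx0).
  rewrite add_block_mx hZ subrr !addr0; apply/esym/matrixP => i j.
  by rewrite -[i]splitK -[j]splitK; case: (fintype.split i); case: (fintype.split j) => a b;
    rewrite /= ?(block_mxEul, block_mxEur, block_mxEdl, block_mxEdr) !mxE.
have -> : mpartial mu (fun z => block_mx 1 0 0 (h z)) z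
       = block_mx 0 0 0 (mpartial mu h z) :> 'M[R]_(1 + N).
  apply/matrixP => i j; rewrite mpartialE -[i]splitK -[j]splitK.
  case: (fintype.split i) => a; case: (fintype.split j) => b /=;
    rewrite ?(block_mxEul, block_mxEur, block_mxEdl, block_mxEdr).
  + rewrite mxE -(partial_cst mu ((1 : 'M[R]_1) a b) z); apply: near_eq_partial.
    by near=> y; rewrite block_mxEul.
  + rewrite mxE -(partial_cst mu 0 z); apply: near_eq_partial.
    by near=> y; rewrite block_mxEur mxE.
  + rewrite mxE -(partial_cst mu 0 z); apply: near_eq_partial.
    by near=> y; rewrite block_mxEdl mxE.
  + rewrite mpartialE; apply: near_eq_partial.
    by near=> y; rewrite block_mxEdr.
rewrite tr_block_mx !mulmx_block !(mulmx0, mul0mx, addr0, add0r, trmx0, mul1mx).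
rewrite add_block_mx addr0 [(- _)^T]linearN /= trmxK -row_mul subrr.
have -> : - (row mu (Z *m h z))^T *m 1 + h z *m (row mu Z)^T = 0.
  have -> : h z *m (row mu Z)^T = (row mu (Z *m h z))^T by rewrite row_mul trmx_mul shz.
  by rewrite mulmx1 addNr.
by rewrite (conn_compat mu uh sh).
Unshelve. all: by end_near. Qed.

(** Vanishing torsion: both sides are components of the bracket [e_g, e_g'], which is vertical. The
    only bracket that does not vanish is that of two horizontal vectors. *)
Lemma frame_torsionP z (g g' k : 'I_(1 + N)) : {near z, forall y, (h y)^T = h y} ->
  (Z *m h z)^T = - (Z *m h z) ->
  frame_conn g z g' k - frame_conn g' z g k = - (frame_torsion z g g' * (k == 0)%:R).
Proof.
move=> sh asym; rewrite /frame_conn /frame_torsion.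
rewrite -[g]splitK -[g']splitK -[k]splitK.
have k0 (a : 'I_1) : (lshift N a == 0 :> 'I_(1 + N)) by rewrite ord1.
have k1 (a : 'I_N) : (rshift 1 a == 0 :> 'I_(1 + N)) = false by [].
case: (fintype.split g) => a; case: (fintype.split g') => b; case: (fintype.split k) => c /=;
  rewrite ?(split_lsh, split_rsh) ?(k0, k1)
    ?(block_mxEul, block_mxEur, block_mxEdl, block_mxEdr) ?(mulr1, mulr0, oppr0).
- by rewrite !mxE subrr oppr0.
- by rewrite !mxE subrr.
- by rewrite !mxE subrr oppr0.
- by rewrite !mxE subrr.
- by rewrite !mxE subrr oppr0.
- by rewrite !mxE subrr.
- have {}asym : (Z *m h z) b a = - (Z *m h z) a b.
    by have /matrixP/(_ a b) := asym; rewrite mxE [X in _ = X -> _]mxE.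
  rewrite [X in X - _]mxE [X in _ - X]mxE ![(row _ _)^T _ _]mxE ![row _ _ _ _]mxE.
  rewrite [in RHS]mxE asym; move: ((Z *m h z) a b) => u; ring.
- have /rowP/(_ c) := conn_torsion a b sh.
  by rewrite !mxE => ->; rewrite subrr.
Unshelve. all: by end_near. Qed.

End Frame.

Lemma mpartial_scale {R : realType} {d p q : nat} i (k : R)
    (A : 'rV[R]_d -> 'M[R]_(p, q)) x : mCk 1 A x ->
  mpartial i (fun y => k *: A y) x = k *: mpartial i A x.
Proof.
move=> cA; rewrite (@mpartialZ _ _ i p q (fun=> k) A) //; last exact: Ck_cst.
by rewrite partial_cst scale0r add0r.
Qed.

Section Submersion.
Context {R : realType} {N : nat}.
Variables (G T : 'rV[R]_(1 + N) -> 'M[R]_(1 + N)) (phi : 'rV[R]_(1 + N) -> 'rV[R]_N)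
  (h : 'rV[R]_N -> 'M[R]_N) (Z : 'M[R]_N).
Implicit Types (x : 'rV[R]_(1 + N)).

(* Column 0 of T x is the connection form s, the other columns are the
   differentials of the components of the submersion phi. *)
Record submersion_frame x : Prop := SubmersionFrame {
  sf_metric : {near x, forall y,
    G y = T y *m frame_metric h (phi y) *m (T y)^T};
  sf_frame_Ck : mCk 3 T x;
  sf_unit : T x \in unitmx;
  sf_map_Ck : mCk 3 phi x;
  sf_jacobian : forall i mu, {near x, forall y,
    T y i (rshift 1 mu) = partial i (fun y => phi y 0 mu) y};
  sf_connection : forall i j, {near x, forall y,
    mpartial i T y j 0 - mpartial j T y i 0
    = (T y *m frame_torsion h Z (phi y) *m (T y)^T) i j};
  sf_base_Ck : mCk 3 h (phi x);
  sf_base_unit : h (phi x) \in unitmx;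
  sf_base_sym : {near phi x, forall z, (h z)^T = h z};
  sf_base_antisym : {near phi x, forall z, (Z *m h z)^T = - (Z *m h z)} }.

(** Curvature differentiates the formula for the connection, which must therefore hold in a
    neighbourhood and not only at x. *)
Lemma submersion_frame_near x : submersion_frame x ->
  \forall y \near x, submersion_frame y.
Proof.
move=> [mt cT uT cphi jc cn ch uh sh ah].
have cont : {for x, continuous phi}.
  apply: differentiable_continuous; apply: differentiable_row => k.
  exact: Ck_differentiable (cphi 0 k).
have n1 := near_join mt.
have n2 := mCk_near_mCk cT.
have n3 := near_unitmx uT (mCk_le (isT : (1 <= 3)%N) cT).
have n4 := mCk_near_mCk cphi.
have n5 : \forall y \near x, forall i mu, {near y, forall y,
    T y i (rshift 1 mu) = partial i (fun y => phi y 0 mu) y}.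
  by apply: near_all_fin => i; apply: near_all_fin => mu; exact/near_join/jc.
have n6 : \forall y \near x, forall i j, {near y, forall y,
    mpartial i T y j 0 - mpartial j T y i 0
    = (T y *m frame_torsion h Z (phi y) *m (T y)^T) i j}.
  by apply: near_all_fin => i; apply: near_all_fin => j; exact/near_join/cn.
have n7 : \forall y \near x, mCk 3 h (phi y) := cont _ (mCk_near_mCk ch).
have n8 : \forall y \near x, h (phi y) \in unitmx
  := cont _ (near_unitmx uh (mCk_le (isT : (1 <= 3)%N) ch)).
have n9 : \forall y \near x, {near phi y, forall z, (h z)^T = h z}
  := cont _ (near_join sh).
have n10 : \forall y \near x, {near phi y, forall z, (Z *m h z)^T = - (Z *m h z)}
  := cont _ (near_join ah).
by near=> y; split; near: y.
Unshelve. all: by end_near. Qed.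

(** As T x i g is the g-th coframe element evaluated on the i-th coordinate vector, this is the
    frame connection in that coordinate direction. *)
Definition pulled_conn i x : 'M[R]_(1 + N) :=
  \sum_g T x i g *: frame_conn h Z g (phi x).

(** The chain rule through phi, whose differential fills all columns of T but column 0; the summand
    of column 0 vanishes because e_0 annihilates functions of the base. *)
Lemma frame_chain i p q (A : 'rV[R]_N -> 'M[R]_(p, q)) x : submersion_frame x ->
  mCk 1 A (phi x) -> mpartial i (fun y => A (phi y)) x =
  \sum_g T x i g *: frame_partial g A (phi x).
Proof.
move=> sf cA; rewrite mpartial_chain //; last exact: mCk_le (sf_map_Ck sf).
rewrite big_split_ord /= big_ord1 {1}/frame_partial split_lsh scaler0 add0r.
apply: eq_bigr => mu _; rewrite /frame_partial split_rsh; congr (_ *: _).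
by have /nbhs_singleton -> := sf_jacobian sf i mu.
Qed.

Lemma mCk_frame_metric k z : mCk k h z -> mCk k (frame_metric h) z.
Proof.
move=> ch i j; rewrite -[i]splitK -[j]splitK.
case: (fintype.split i) => a; case: (fintype.split j) => b /=.
- apply: Ck_near (Ck_cst k ((1 : 'M[R]_1) a b) z).
  by near=> y; rewrite block_mxEul.
- apply: Ck_near (Ck_cst k 0 z).
  by near=> y; rewrite block_mxEur mxE.
- apply: Ck_near (Ck_cst k 0 z).
  by near=> y; rewrite block_mxEdl mxE.
- apply: Ck_near (ch a b).
  by near=> y; rewrite block_mxEdr.
Unshelve. all: by end_near. Qed.

Lemma mCk_frame_conn k g z : h z \in unitmx -> mCk k.+1 h z ->
  mCk k (frame_conn h Z g) z.
Proof.
move=> uh ch i j; rewrite /frame_conn; case: (fintype.split g) => [_|mu].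
  exact: mCk_cst.
have cZh : mCk k (fun z => Z *m h z) z by apply: mCkM; [exact: mCk_cst|exact: mCkS].
rewrite -[i]splitK -[j]splitK.
case: (fintype.split i) => a; case: (fintype.split j) => b /=.
- apply: Ck_near (Ck_cst k 0 z).
  by near=> y; rewrite block_mxEul mxE.
- apply: Ck_near (Ck_cst k (Z mu b) z).
  by near=> y; rewrite block_mxEur mxE.
- apply: Ck_near (CkN (cZh mu a)).
  by near=> y; rewrite block_mxEdl [RHS]mxE [in RHS]mxE [in RHS]mxE.
- apply: Ck_near (mCk_conn mu uh ch a b).
  by near=> y; rewrite block_mxEdr.
Unshelve. all: by end_near. Qed.

(** The gauge transform A of the frame connection is metric compatible by [frame_compat] and torsion
    free by [frame_torsionP], so [conn_unique] identifies it with the coordinate connection. *)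
Lemma submersion_conn i x : submersion_frame x ->
  conn G i x *m T x = T x *m pulled_conn i x + mpartial i T x.
Proof.
move=> sf; have [mt cT uT cphi jc cn ch uh sh ah] := sf.
set z := phi x in ch uh sh ah *.
have shz : (h z)^T = h z by exact: nbhs_singleton sh.
have ahz : (Z *m h z)^T = - (Z *m h z) by exact: nbhs_singleton ah.
have GE : G x = T x *m frame_metric h z *m (T x)^T by exact: nbhs_singleton mt.
set D := frame_metric h z in GE *.
have sD : D^T = D.
  by rewrite /D /frame_metric tr_block_mx !trmx0 trmx1 shz.
have uD : D \in unitmx.
  by rewrite unitmxE /D /frame_metric det_ublock det1 mul1r -unitmxE.
have sG : (G x)^T = G x by rewrite GE !trmx_mul trmxK sD mulmxA.
have uG : G x \in unitmx by rewrite GE !unitmx_mul unitmx_tr uT uD.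
pose A k := (T x *m pulled_conn k x + mpartial k T x) *m invmx (T x).
have AT k : A k *m T x = T x *m pulled_conn k x + mpartial k T x.
  by rewrite /A mulmxKV.
suff : forall k, conn G k x = A k by move=> ->; exact: AT.
apply: conn_unique => // [k|k l].
- rewrite (mpartial_near k mt).
  have c1T : mCk 1 T x by exact: mCk_le cT.
  have cD : mCk 1 (fun y => frame_metric h (phi y)) x.
    apply: mCk_comp; last exact: mCk_le cphi.
    by apply: mCk_frame_metric; exact: mCk_le ch.
  rewrite mpartialM; [|exact: mCkM|exact: mCk_tr].
  rewrite mpartialM // mpartial_tr frame_chain //; last first.
    by apply: mCk_frame_metric; exact: mCk_le ch.
  have -> : \sum_g T x k g *: frame_partial g (frame_metric h) (phi x)
      = pulled_conn k x *m D + D *m (pulled_conn k x)^T.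
    rewrite /pulled_conn linear_sum mulmx_suml mulmx_sumr -big_split /=.
    apply: eq_bigr => g _; rewrite (frame_compat g uh sh ahz) linearZ /=.
    by rewrite -scalemxAl -scalemxAr -scalerDr.
  have e1 : A k *m G x = (T x *m pulled_conn k x + mpartial k T x) *m D *m (T x)^T.
    by rewrite GE !mulmxA AT.
  have -> : G x *m (A k)^T = (A k *m G x)^T by rewrite [RHS]trmx_mul sG.
  rewrite e1 -/z -/D !trmx_mul trmxK sD [(_ + _)^T]linearD /= !trmx_mul.
  rewrite !(mulmxDl, mulmxDr) !mulmxA.
  move: (mpartial k T x *m D *m (T x)^T) => a; move: (T x *m pulled_conn k x *m D *m (T x)^T) => b.
  move: (T x *m D *m (pulled_conn k x)^T *m (T x)^T) => c.
  move: (T x *m D *m (mpartial k T x)^T) => e.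
  apply/matrixP => u v; rewrite !mxE; ring.
- suff : row l (A k) *m T x = row k (A l) *m T x.
    by move=> /(congr1 (mulmx^~ (invmx (T x)))); rewrite !mulmxK.
  rewrite -!row_mul !AT; apply/rowP => c; rewrite ![row _ _ _ _]mxE.
  rewrite [LHS]mxE [RHS]mxE.
  have e a b : (T x *m pulled_conn a x) b c =
     \sum_g \sum_g' T x a g * T x b g' * frame_conn h Z g z g' c.
    rewrite mxE exchange_big /=; apply: eq_bigr => g' _.
    rewrite summxE mulr_sumr; apply: eq_bigr => g _; rewrite mxE.
    by rewrite mulrCA mulrA.
  (* Exterior derivative of the coframe: column 0 is given by the structure equation, the other
     columns are differentials and hence closed. *)
  have tor : mpartial k T x l c - mpartial l T x k c =
      \sum_g \sum_g' T x k g * T x l g' * (frame_torsion h Z z g g' * (c == 0)%:R).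
    transitivity ((T x *m frame_torsion h Z z *m (T x)^T) k l * (c == 0)%:R).
      have [->|c0] := eqVneq c 0.
        by rewrite mulr1; have /nbhs_singleton := cn k l.
      rewrite mulr0; apply/eqP; rewrite subr_eq0; apply/eqP.
      have [mu cE] : exists mu, c = rshift 1 mu.
        move: c0; rewrite -[c]splitK; case: (fintype.split c) => a /=.
          by rewrite ord1; case/eqP; apply/val_inj.
        by exists a.
      rewrite cE !mpartialE (near_eq_partial k (jc l mu)) (near_eq_partial l (jc k mu)).
      by apply: Ck_partialC; exact: CkS (cphi 0 mu).
    rewrite mxE mulr_suml exchange_big /=; apply: eq_bigr => g' _.
    rewrite !mxE !mulr_suml; apply: eq_bigr => g _.
    by rewrite [RHS]mulrA; congr (_ * _); rewrite mulrAC.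
  have e2 : (T x *m pulled_conn k x) l c - (T x *m pulled_conn l x) k c
      = - (mpartial k T x l c - mpartial l T x k c).
    rewrite tor !e [X in _ - X]exchange_big -sumrB -sumrN /=; apply: eq_bigr => g _.
    rewrite -sumrB -sumrN; apply: eq_bigr => g' _.
    by rewrite [T x l g' * _]mulrC -mulrBr (frame_torsionP _ _ _ sh ahz) mulrN.
  apply/eqP; rewrite -subr_eq0 opprD addrACA e2 addrC; exact/eqP/addrN.
Qed.

(** By [gauge_curvature] it is enough to compute the curvature of [pulled_conn]. Derivatives of the
    frame matrices give the pulled back curvature, and derivatives of T give the bracket term of
    [frame_curv]. *)
Lemma submersion_curv i j x : submersion_frame x ->
  Rmx G i j x *m T x = T x *m
    \sum_g \sum_g' (T x i g * T x j g') *: frame_curv h Z g g' (phi x).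
Proof.
move=> sf; have sfn := submersion_frame_near sf.
have [mt cT uT cphi jc cn ch uh sh ah] := sf.
set z := phi x in ch uh sh ah *.
have cfc g : mCk 1 (frame_conn h Z g) z.
  by apply: mCk_frame_conn => //; exact: mCk_le ch.
have cB k : mCk 1 (pulled_conn k) x.
  apply: mCk_sum => g _; apply: mCkZ; first exact: (mCk_le (isT : (1 <= 3)%N) cT).
  by apply: mCk_comp => //; exact: mCk_le cphi.
have cG : mCk 2 G x.
  apply: (@mCk_near _ _ _ _ _ (fun y => T y *m frame_metric h (phi y) *m (T y)^T)).
    by apply: filterS mt => y ->.
  apply: mCkM; last by apply: mCk_tr; exact: mCk_le cT.
  apply: mCkM; first exact: mCk_le cT.
  apply: mCk_comp; last exact: mCk_le cphi.
  by apply: mCk_frame_metric; exact: mCk_le ch.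
have uG : G x \in unitmx.
  rewrite (nbhs_singleton mt) !unitmx_mul unitmx_tr uT.
  by rewrite unitmxE /frame_metric det_ublock det1 mul1r -unitmxE uh.
rewrite -[Rmx G i j x]/(curv (conn G) i j x).
rewrite (@gauge_curvature _ _ _ _ (conn G) pulled_conn T x) //; first last.
- by move=> k; apply: filterS sfn => y; exact: submersion_conn.
- exact: mCk_le cT.
- by move=> k; exact: mCk_conn.
congr (_ *m _); rewrite /curv.
have cTe k g : Ck 1 (fun y => T y k g) x by exact: (mCk_le (isT : (1 <= 3)%N) cT).
have cfp g : mCk 1 (fun y => frame_conn h Z g (phi y)) x.
  by apply: mCk_comp => //; exact: mCk_le cphi.
have dB k l : mpartial k (pulled_conn l) x =
    \sum_g partial k (fun y => T y l g) x *: frame_conn h Z g z +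
    \sum_g \sum_g' (T x k g * T x l g') *: frame_partial g (frame_conn h Z g') z.
  rewrite mpartial_sum; last by move=> g _; exact: mCkZ.
  rewrite [X in _ = _ + X]exchange_big -big_split; apply: eq_bigr => g _ /=.
  rewrite mpartialZ //; congr (_ + _); rewrite frame_chain // scaler_sumr.
  by apply: eq_bigr => g' _; rewrite scalerA mulrC.
have BB k l : pulled_conn k x *m pulled_conn l x =
    \sum_g \sum_g' (T x l g * T x k g') *: (frame_conn h Z g' z *m frame_conn h Z g z).
  rewrite mulmx_suml exchange_big; apply: eq_bigr => g _ /=.
  rewrite mulmx_sumr; apply: eq_bigr => g' _.
  by rewrite -scalemxAl -scalemxAr scalerA mulrC.
(* Only the column of the connection form is not closed, so only the vertical matrix [frame_conn 0]
   survives. *)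
have tor : \sum_g partial i (fun y => T y j g) x *: frame_conn h Z g z -
    \sum_g partial j (fun y => T y i g) x *: frame_conn h Z g z
    = \sum_g \sum_g' (T x i g * T x j g' * frame_torsion h Z z g g') *: frame_conn h Z 0 z.
  rewrite -sumrB big_split_ord /= big_ord1 [X in _ + X]big1 ?addr0; last first.
    move=> mu _; rewrite -scalerBl (near_eq_partial i (jc j mu)).
    rewrite (near_eq_partial j (jc i mu)) (Ck_partialC _ _ (CkS (cphi 0 mu))).
    by rewrite subrr scale0r.
  have -> : lshift N 0 = 0 :> 'I_(1 + N) by apply/val_inj.
  rewrite -scalerBl -!mpartialE (nbhs_singleton (cn i j)) -/z.
  have -> : (T x *m frame_torsion h Z z *m (T x)^T) i j =
     \sum_g \sum_g' T x i g * T x j g' * frame_torsion h Z z g g'.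
    rewrite mxE exchange_big /=; apply: eq_bigr => g' _.
    rewrite !mxE mulr_suml; apply: eq_bigr => g _.
    by rewrite mulrAC.
  by rewrite scaler_suml; apply: eq_bigr => g _; rewrite scaler_suml.
rewrite !dB !BB opprD [X in X + _ = _]addrACA tor.
rewrite [\sum_g \sum_g' (T x j g * _) *: frame_partial _ _ _]exchange_big /=.
rewrite [\sum_g \sum_g' (T x j g * _) *: (_ *m _)]exchange_big /=.
rewrite -!sumrB -!big_split /=; apply: eq_bigr => g _.
rewrite -!sumrB -!big_split /=; apply: eq_bigr => g' _.
rewrite [T x j g' * _]mulrC -!scalerBr -scalerA -!scalerDr; congr (_ *: _).
by rewrite /frame_curv -addrA addrC.
Qed.

End Submersion.

#[local] Opaque christoffel conn.

(** * The norm of the curvature tensor *)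

Section NormFormula.
Context {R : realType}.

(** Squared norm of a curvature tensor whose endomorphisms are C i j in a frame with Gram matrix D;
    the trace contracts the endomorphism indices and the outer sums the two form indices. *)
Definition rmnorm2 {d} (D : 'M[R]_d) (C : 'I_d -> 'I_d -> 'M[R]_d) : R :=
  \sum_i \sum_i' invmx D i i' * \sum_j \sum_j' invmx D j j' *
    \tr ((invmx D)^T *m (C i j *m D *m (C i' j')^T)).

Lemma eq_rmnorm2 {d} (D : 'M[R]_d) (C C' : 'I_d -> 'I_d -> 'M[R]_d) :
  (forall i j, C i j = C' i j) -> rmnorm2 D C = rmnorm2 D C'.
Proof.
by move=> CC; congr (rmnorm2 D _); apply/funext => i; apply/funext => j.
Qed.

Lemma exchange_big3 (I J K : finType) (F : I -> J -> K -> R) :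
  \sum_i \sum_j \sum_k F i j k = \sum_k \sum_i \sum_j F i j k.
Proof.
under eq_bigr do rewrite exchange_big /=.
by rewrite exchange_big.
Qed.

Lemma mxtrace_contract {d} (A B C D : 'M[R]_d) :
  \tr (A^T *m (B *m C *m D^T)) =
  \sum_l \sum_l' \sum_k \sum_k' A k k' * B k l * C l l' * D k' l'.
Proof.
have -> : \tr (A^T *m (B *m C *m D^T)) = \sum_k \sum_k' A k k' *
    \sum_l \sum_l' B k l * C l l' * D k' l'.
  rewrite /mxtrace; under eq_bigr do rewrite mxE.
  rewrite exchange_big /=; apply: eq_bigr => k _; apply: eq_bigr => k' _.
  rewrite mxE; congr (_ * _); rewrite mxE exchange_big /=; apply: eq_bigr => l' _.
  by rewrite !mxE mulr_suml.
transitivity (\sum_k \sum_k' \sum_l \sum_l' A k k' * B k l * C l l' * D k' l').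
  apply: eq_bigr => k _; apply: eq_bigr => k' _; rewrite mulr_sumr.
  apply: eq_bigr => l _; rewrite mulr_sumr; apply: eq_bigr => l' _.
  by rewrite !mulrA.
rewrite exchange_big3; apply: eq_bigr => l _.
by rewrite exchange_big3.
Qed.

Lemma mxtrace_bilinear {d} (a b : R) (A B D E : 'M[R]_d) :
  \tr (A *m ((a *: B) *m D *m (b *: E)^T)) = a * b * \tr (A *m (B *m D *m E^T)).
Proof.
rewrite [(b *: E)^T]linearZ /= -!scalemxAl -!scalemxAr -?scalemxAl -?scalemxAr.
by rewrite !mxtraceZ mulrA.
Qed.

Lemma curvature_normE {d} (G : 'rV[R]_d -> 'M[R]_d) x :
  curvature_norm G x = Num.sqrt (rmnorm2 (G x) (fun i j => Rmx G i j x)).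
Proof.
rewrite /curvature_norm /rmnorm2; congr (Num.sqrt _).
rewrite exchange_big3; apply: eq_bigr => i _.
rewrite exchange_big3; apply: eq_bigr => i' _.
rewrite mulr_sumr exchange_big3; apply: eq_bigr => j _.
rewrite mulr_sumr exchange_big3; apply: eq_bigr => j' _.
rewrite mxtrace_contract !mulr_sumr; apply: eq_bigr => l _.
rewrite !mulr_sumr; apply: eq_bigr => l' _.
rewrite !mulr_sumr; apply: eq_bigr => k _.
rewrite !mulr_sumr; apply: eq_bigr => k' _.
rewrite !curvatureE.
rewrite -!mulrA mulrCA; congr (_ * _); rewrite mulrCA; congr (_ * _).
by rewrite mulrCA; congr (_ * _); rewrite mulrCA.
Qed.

Section ChangeOfFrame.
Context {d : nat}.
Variables (T D : 'M[R]_d).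
Hypotheses (uT : T \in unitmx) (uD : D \in unitmx).
Let G := T *m D *m T^T.

Lemma invmx_frame : T^T *m invmx G *m T = invmx D.
Proof.
have uG : G \in unitmx by rewrite !unitmx_mul unitmx_tr uT uD.
apply: (@row_full_inj _ _ _ _ D); first by rewrite row_full_unit.
rewrite mulmxV //; apply: (can_inj (mulKmx uT)).
rewrite mulmx1; apply: (can_inj (mulmxK (_ : T^T \in unitmx))); first by rewrite unitmx_tr.
by rewrite !mulmxA -/G mulmxV // mul1mx.
Qed.

(** Independence of the frame for one contraction of two covariant indices; the norm uses it once
    for each of its two pairs of form indices. *)
Lemma contract_frame (w : 'I_d -> 'I_d -> R) :
  \sum_i \sum_i' invmx G i i' * (\sum_g \sum_e T i g * T i' e * w g e) =
  \sum_g \sum_e invmx D g e * w g e.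
Proof.
transitivity (\sum_i \sum_i' \sum_g \sum_e invmx G i i' * (T i g * T i' e * w g e)).
  apply: eq_bigr => i _; apply: eq_bigr => i' _; rewrite mulr_sumr.
  by apply: eq_bigr => g _; rewrite mulr_sumr.
rewrite exchange_big3; apply: eq_bigr => g _; rewrite exchange_big3.
apply: eq_bigr => e _; rewrite -invmx_frame mxE mulr_suml exchange_big.
apply: eq_bigr => i' _; rewrite mxE !mulr_suml; apply: eq_bigr => i _.
by rewrite mxE; ring.
Qed.

(** The endomorphism part is invariant because the trace is invariant under conjugation, the form
    part by [contract_frame]. *)
Lemma rmnorm2_frame (Q C : 'I_d -> 'I_d -> 'M[R]_d) :
  (forall i j, Q i j *m T = T *m \sum_g \sum_g' (T i g * T j g') *: C g g') ->
  rmnorm2 G Q = rmnorm2 D C.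
Proof.
move=> QC; have uG : G \in unitmx by rewrite !unitmx_mul unitmx_tr uT uD.
pose S i j := \sum_g \sum_g' (T i g * T j g') *: C g g'.
pose f g e g' e' := \tr ((invmx D)^T *m (C g g' *m D *m (C e e')^T)).
have trE i j i' j' : \tr ((invmx G)^T *m (Q i j *m G *m (Q i' j')^T))
    = \tr ((invmx D)^T *m (S i j *m D *m (S i' j')^T)).
  have -> : Q i j *m G *m (Q i' j')^T = T *m (S i j *m D *m (S i' j')^T) *m T^T.
    have -> : Q i j *m G *m (Q i' j')^T = (Q i j *m T) *m D *m (Q i' j' *m T)^T.
      by rewrite trmx_mul !mulmxA.
    by rewrite !QC -/(S _ _) trmx_mul !mulmxA.
  set X := S i j *m D *m _.
  transitivity (\tr ((T^T *m (invmx G)^T) *m (T *m X))).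
    by rewrite [LHS]mxtrace_mulC [RHS]mxtrace_mulC !mulmxA.
  by rewrite -invmx_frame !trmx_mul trmxK !mulmxA.
have fE i j i' j' : \tr ((invmx D)^T *m (S i j *m D *m (S i' j')^T)) =
    \sum_g \sum_e T i g * T i' e * (\sum_g' \sum_e' T j g' * T j' e' * f g e g' e').
  rewrite /S !mulmx_suml mulmx_sumr raddf_sum; apply: eq_bigr => g _ /=.
  rewrite [(\sum__ _)^T]raddf_sum mulmx_sumr mulmx_sumr raddf_sum; apply: eq_bigr => e _ /=.
  rewrite mulmx_suml [(\sum__ _)^T]raddf_sum mulmx_suml mulmx_sumr raddf_sum mulr_sumr.
  apply: eq_bigr => g' _ /=; rewrite mulmx_sumr mulmx_sumr raddf_sum mulr_sumr.
  apply: eq_bigr => e' _ /=; rewrite mxtrace_bilinear.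
  by rewrite /f; move: (\tr _) => t; ring.
rewrite /rmnorm2.
transitivity (\sum_i \sum_i' invmx G i i' * (\sum_g \sum_e T i g * T i' e *
    \sum_g' \sum_e' invmx D g' e' * f g e g' e')).
  apply: eq_bigr => i _; apply: eq_bigr => i' _; congr (_ * _).
  transitivity (\sum_j \sum_j' \sum_g \sum_e invmx G j j' * (T i g * T i' e *
      \sum_g' \sum_e' T j g' * T j' e' * f g e g' e')).
    apply: eq_bigr => j _; apply: eq_bigr => j' _; rewrite trE fE mulr_sumr.
    by apply: eq_bigr => g _; rewrite mulr_sumr.
  rewrite exchange_big3; apply: eq_bigr => g _; rewrite exchange_big3.
  apply: eq_bigr => e _; rewrite -contract_frame mulr_sumr.
  apply: eq_bigr => j _; rewrite mulr_sumr; apply: eq_bigr => j' _.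
  by rewrite mulrCA.
exact: contract_frame.
Qed.

End ChangeOfFrame.

(** Inside the trace the metric and its inverse rescale oppositely; the two inverse metrics outside
    give the square. *)
Lemma rmnorm2Z {d} (k : R) (D : 'M[R]_d) (C : 'I_d -> 'I_d -> 'M[R]_d) : k != 0 ->
  D \in unitmx -> rmnorm2 (k *: D) C = k^-1 ^+ 2 * rmnorm2 D C.
Proof.
move=> k0 uD; have uk : k *: D \in unitmx by rewrite unitmxZ ?unitfE.
have iE : invmx (k *: D) = k^-1 *: invmx D by rewrite invmxZ.
rewrite /rmnorm2 mulr_sumr iE; apply: eq_bigr => i _; rewrite mulr_sumr.
apply: eq_bigr => i' _; rewrite mxE !mulr_sumr; apply: eq_bigr => j _.
rewrite !mulr_sumr; apply: eq_bigr => j' _; rewrite mxE linearZ /=.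
rewrite -!scalemxAr -!scalemxAl -scalemxAr scalerA mulVf // scale1r.
by move: (\tr _) => t; ring.
Qed.

(** The Levi-Civita connection, hence the tensor R^l_{ijk}, does not change when the metric is
    multiplied by a constant, so only the norm rescales. *)
Lemma curvature_normZ {d} (k : R) (G : 'rV[R]_d -> 'M[R]_d) x : 0 < k ->
  G x \in unitmx -> mCk 1 G x -> {near x, forall y, (G y)^T = G y} ->
  curvature_norm (fun y => k *: G y) x = k^-1 * curvature_norm G x.
Proof.
move=> k0 uG cG sG; have kn0 : k != 0 by rewrite gt_eqF.
have connE i : {near x, forall y, conn (fun y => k *: G y) i y = conn G i y}.
  have n1 := near_unitmx uG cG; have n2 := mCk_near_mCk cG.
  near=> y; have uy : G y \in unitmx by near: y.
  have cy : mCk 1 G y by near: y.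
  have sy : (G y)^T = G y by near: y.
  rewrite !conn_lowered ?linearZ /= ?sy // invmxZ; last by rewrite unitmxZ ?unitfE.
  rewrite -scalemxAr scalemxAl; congr (_ *m _); apply/matrixP => a b; rewrite !mxE.
  rewrite !mpartial_scale // !mxE; field.
  exact: kn0.
have RE i j : Rmx (fun y => k *: G y) i j x = Rmx G i j x.
  have e l : conn (fun y => k *: G y) l x = conn G l x by exact: nbhs_singleton (connE l).
  have e1 l l' : mpartial l (conn (fun y => k *: G y) l') x = mpartial l (conn G l') x.
    exact: mpartial_near (connE l').
  by rewrite /Rmx !e !e1.
rewrite !curvature_normE.
rewrite (eq_rmnorm2 _ RE) rmnorm2Z // sqrtrM ?sqr_ge0 // sqrtr_sqr ger0_norm // invr_ge0.
exact: ltW.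
Unshelve. all: by end_near. Qed.

End NormFormula.

(** * Families bounded uniformly in a parameter *)

Section UniformBounds.
Context {R : realType} {I : Type} (P : I -> Prop).

(** The parameter will be a pair of a time and a point of the bundle, with P bounding the time from
    below. Such bounds pass through sums, products and traces, so no explicit curvature constant has
    to be computed. *)
Definition ubr (f : I -> R) := exists c, forall i, P i -> `|f i| <= c.

Definition ubm {p q} (A : I -> 'M[R]_(p, q)) :=
  exists c, forall i, P i -> forall j k, `|A i j k| <= c.

Lemma ubr_le (f g : I -> R) : (forall i, P i -> `|f i| <= `|g i|) -> ubr g -> ubr f.
Proof. by move=> fg [c gc]; exists c => i Pi; rewrite (le_trans (fg _ Pi)) ?gc. Qed.

Lemma eq_ubr (f g : I -> R) : (forall i, P i -> f i = g i) -> ubr g -> ubr f.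
Proof. by move=> fg; apply: ubr_le => i /fg ->. Qed.

Lemma ubr_cst (c : R) : ubr (fun=> c).
Proof. by exists `|c|. Qed.

Lemma ubrD f g : ubr f -> ubr g -> ubr (fun i => f i + g i).
Proof.
move=> [a fa] [b gb]; exists (a + b) => i Pi.
by rewrite (le_trans (ler_normD _ _)) // lerD ?fa ?gb.
Qed.

Lemma ubrN f : ubr f -> ubr (fun i => - f i).
Proof. by move=> [a fa]; exists a => i Pi; rewrite normrN fa. Qed.

Lemma ubrB f g : ubr f -> ubr g -> ubr (fun i => f i - g i).
Proof. by move=> uf ug; apply: ubrD => //; exact: ubrN. Qed.

Lemma ubrM f g : ubr f -> ubr g -> ubr (fun i => f i * g i).
Proof.
move=> [a fa] [b gb]; exists (a * b) => i Pi.
by rewrite normrM ler_pM ?fa ?gb.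
Qed.

Lemma ubr_sum (J : Type) (r : seq J) (Q : pred J) (F : J -> I -> R) :
  (forall j, Q j -> ubr (F j)) -> ubr (fun i => \sum_(j <- r | Q j) F j i).
Proof.
move=> uF; elim: r => [|j r ih].
  by apply: eq_ubr (ubr_cst 0) => i _; rewrite big_nil.
case Qj : (Q j); last by apply: eq_ubr ih => i _; rewrite big_cons Qj.
by apply: eq_ubr (ubrD (uF _ Qj) ih) => i _; rewrite big_cons Qj.
Qed.

Lemma ubmP p q (A : I -> 'M[R]_(p, q)) :
  (forall j k, ubr (fun i => A i j k)) <-> ubm A.
Proof.
split=> [uA|[c Ac] j k]; last by exists c => i Pi; exact: Ac.
pose c j k := projT1 (cid (uA j k)).
have cP j k i : P i -> `|A i j k| <= c j k := projT2 (cid (uA j k)) i.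
exists (\sum_j \sum_k `|c j k|) => i Pi j k.
rewrite (le_trans (cP _ _ _ Pi)) // (le_trans (ler_norm _)) //.
rewrite (bigD1 j) //= (bigD1 k) //= -addrA lerDl addr_ge0 // ?sumr_ge0 // => j' _.
by rewrite sumr_ge0.
Qed.

Lemma ubm_entry p q (A : I -> 'M[R]_(p, q)) j k : ubm A -> ubr (fun i => A i j k).
Proof. by move=> /ubmP. Qed.

Lemma eq_ubm p q (A B : I -> 'M[R]_(p, q)) :
  (forall i, P i -> A i = B i) -> ubm B -> ubm A.
Proof. by move=> AB [c Bc]; exists c => i Pi; rewrite AB //; exact: Bc. Qed.

Lemma ubm_cst p q (A : 'M[R]_(p, q)) : ubm (fun=> A).
Proof. by apply/ubmP => j k; exact: ubr_cst. Qed.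

Lemma ubmD p q (A B : I -> 'M[R]_(p, q)) : ubm A -> ubm B -> ubm (fun i => A i + B i).
Proof.
move=> /ubmP uA /ubmP uB; apply/ubmP => j k.
by apply: eq_ubr (ubrD (uA j k) (uB j k)) => i _; rewrite mxE.
Qed.

Lemma ubmN p q (A : I -> 'M[R]_(p, q)) : ubm A -> ubm (fun i => - A i).
Proof.
move=> /ubmP uA; apply/ubmP => j k.
by apply: eq_ubr (ubrN (uA j k)) => i _; rewrite mxE.
Qed.

Lemma ubmB p q (A B : I -> 'M[R]_(p, q)) : ubm A -> ubm B -> ubm (fun i => A i - B i).
Proof. by move=> uA uB; apply: ubmD => //; exact: ubmN. Qed.

Lemma ubm_tr p q (A : I -> 'M[R]_(p, q)) : ubm A -> ubm (fun i => (A i)^T).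
Proof.
move=> /ubmP uA; apply/ubmP => j k.
by apply: eq_ubr (uA k j) => i _; rewrite mxE.
Qed.

Lemma ubm_row p q k (A : I -> 'M[R]_(p, q)) : ubm A -> ubm (fun i => row k (A i)).
Proof.
move=> /ubmP uA; apply/ubmP => j l.
by apply: eq_ubr (uA k l) => i _; rewrite mxE.
Qed.

Lemma ubmM p q r (A : I -> 'M[R]_(p, q)) (B : I -> 'M[R]_(q, r)) :
  ubm A -> ubm B -> ubm (fun i => A i *m B i).
Proof.
move=> /ubmP uA /ubmP uB; apply/ubmP => j k.
apply: eq_ubr (ubr_sum _ _) => [i _|l _]; first by rewrite mxE.
by apply: ubrM.
Qed.

Lemma ubmZ p q (f : I -> R) (A : I -> 'M[R]_(p, q)) :
  ubr f -> ubm A -> ubm (fun i => f i *: A i).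
Proof.
move=> uf /ubmP uA; apply/ubmP => j k.
by apply: eq_ubr (ubrM uf (uA j k)) => i _; rewrite mxE.
Qed.

Lemma ubm_sum p q (J : Type) (r : seq J) (Q : pred J) (F : J -> I -> 'M[R]_(p, q)) :
  (forall j, Q j -> ubm (F j)) -> ubm (fun i => \sum_(j <- r | Q j) F j i).
Proof.
move=> uF; apply/ubmP => j k.
apply: eq_ubr (ubr_sum _ _) => [i _|l Ql]; first by rewrite summxE.
by have /ubmP := uF _ Ql; apply.
Qed.

Lemma ubm_block p1 p2 q1 q2 (A : I -> 'M[R]_(p1, q1)) (B : I -> 'M[R]_(p1, q2))
    (C : I -> 'M[R]_(p2, q1)) (D : I -> 'M[R]_(p2, q2)) :
  ubm A -> ubm B -> ubm C -> ubm D ->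
  ubm (fun i => block_mx (A i) (B i) (C i) (D i)).
Proof.
move=> /ubmP uA /ubmP uB /ubmP uC /ubmP uD; apply/ubmP => j k.
rewrite -[j]splitK -[k]splitK.
case: (fintype.split j) => a; case: (fintype.split k) => b /=.
- by apply: eq_ubr (uA a b) => i _; rewrite block_mxEul.
- by apply: eq_ubr (uB a b) => i _; rewrite block_mxEur.
- by apply: eq_ubr (uC a b) => i _; rewrite block_mxEdl.
- by apply: eq_ubr (uD a b) => i _; rewrite block_mxEdr.
Qed.

Lemma ubr_trace p (A : I -> 'M[R]_p) : ubm A -> ubr (fun i => \tr (A i)).
Proof. by move=> /ubmP uA; apply: ubr_sum. Qed.

Section FrameBounds.
Variables (N : nat) (h : I -> 'rV[R]_N -> 'M[R]_N) (Z : I -> 'M[R]_N) (z : I -> 'rV[R]_N).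
Hypotheses (ch : forall i, P i -> mCk 3 (h i) (z i))
  (uh : forall i, P i -> h i (z i) \in unitmx)
  (sh : forall i, P i -> {near z i, forall y, (h i y)^T = h i y}).
Hypotheses (bh : ubm (fun i => h i (z i))) (bhI : ubm (fun i => invmx (h i (z i))))
  (bdh : forall k, ubm (fun i => mpartial k (h i) (z i)))
  (bddh : forall k l, ubm (fun i => mpartial k (mpartial l (h i)) (z i)))
  (bZ : ubm Z).

Let c1h i : P i -> mCk 1 (h i) (z i).
Proof. by move=> Pi; exact: mCk_le (ch Pi). Qed.

Lemma ubm_lowered (dG : I -> 'I_N -> 'M[R]_N) k : (forall l, ubm (fun i => dG i l)) ->
  ubm (fun i => lowered_conn (dG i) k).
Proof.
move=> ud; have {}ud l a b : ubr (fun i => dG i l a b) by exact: ubm_entry (ud l).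
apply/ubmP => a b; apply: eq_ubr => [i _|]; first by rewrite mxE.
by apply: ubrM; [exact: ubr_cst|apply: ubrB => //; exact: ubrD].
Qed.

Lemma ubm_conn k : ubm (fun i => conn (h i) k (z i)).
Proof.
apply: eq_ubm => [i Pi|]; first by rewrite conn_lowered //; exact: nbhs_singleton (sh Pi).
by apply: ubmM => //; exact: ubm_lowered.
Qed.

(** The product rule and the derivative of an inverse matrix reduce this to h, its inverse and its
    derivatives of order at most two. *)
Lemma ubm_mpartial_conn l k : ubm (fun i => mpartial l (conn (h i) k) (z i)).
Proof.
have cI i (Pi : P i) : mCk 1 (fun y => invmx (h i y)) (z i) by exact: mCk_inv (uh Pi) (c1h Pi).
have cd i (Pi : P i) a : mCk 1 (mpartial a (h i)) (z i).
  by apply: mCk_mpartial; exact: mCk_le (ch Pi).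
have clow i (Pi : P i) : mCk 1 (fun y => lowered_conn (fun j => mpartial j (h i) y) k) (z i).
  move=> a b; have : Ck 1 (fun y => 2^-1 * (mpartial k (h i) y a b
      + mpartial a (h i) y k b - mpartial b (h i) y k a)) (z i).
    apply: CkM; first exact: Ck_cst.
    by apply: CkB; [apply: CkD|]; exact: cd.
  by apply: Ck_near; near=> y; rewrite mxE.
apply: (@eq_ubm _ _ _ (fun i =>
   lowered_conn (fun j => mpartial l (mpartial j (h i)) (z i)) k *m invmx (h i (z i))
   - lowered_conn (fun j => mpartial j (h i) (z i)) k *m
      (invmx (h i (z i)) *m mpartial l (h i) (z i) *m invmx (h i (z i))))).
  move=> i Pi; have e : {near z i, forall y, conn (h i) k y =
      lowered_conn (fun j => mpartial j (h i) y) k *m invmx (h i y)}.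
    by apply: filterS (sh Pi) => y sy; rewrite conn_lowered.
  rewrite (mpartial_near l e) mpartialM; [|exact: clow|exact: cI].
  rewrite mpartial_inv; [|exact: uh|exact: c1h].
  rewrite mulmxN; congr (_ *m _ - _); apply/matrixP => a b.
  rewrite mpartialE [RHS]mxE.
  have -> : (fun y => lowered_conn (fun j => mpartial j (h i) y) k a b) =
    (fun y => 2^-1 * (mpartial k (h i) y a b
      + mpartial a (h i) y k b - mpartial b (h i) y k a)).
    by apply/funext => y; rewrite mxE.
  have dd c e' f : differentiable (fun y => mpartial c (h i) y e' f) (z i).
    exact: Ck_differentiable (cd i Pi c e' f).
  rewrite partialM; [|exact: differentiable_cst|]; last first.
    by apply: differentiableB => //; exact: differentiableD.
  rewrite partial_cst mul0r add0r; congr (_ * _).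
  rewrite partialB //; last exact: differentiableD.
  by rewrite partialD // -!mpartialE.
apply: ubmB; apply: ubmM => //; first exact: ubm_lowered.
  exact: ubm_lowered.
by apply: ubmM => //; exact: ubmM.
Unshelve. all: by end_near. Qed.

Lemma ubm_frame_conn g : ubm (fun i => frame_conn (h i) (Z i) g (z i)).
Proof.
rewrite /frame_conn; case: (fintype.split g) => [_|mu]; apply: ubm_block;
  do ?[exact: ubm_cst|exact: bZ|exact: ubm_row|exact: ubm_conn].
by apply/ubmN/ubm_tr/ubm_row/ubmM.
Qed.

Lemma ubm_frame_partial g g' :
  ubm (fun i => frame_partial g (frame_conn (h i) (Z i) g') (z i)).
Proof.
rewrite /frame_partial; case: (fintype.split g) => [_|nu]; first exact: ubm_cst.
rewrite /frame_conn; case: (fintype.split g') => [_|mu].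
  by apply: eq_ubm (ubm_cst 0) => i _; rewrite mpartial_cst.
apply/ubmP => a b; rewrite -[a]splitK -[b]splitK.
case: (fintype.split a) => {}a; case: (fintype.split b) => {}b /=.
- apply: eq_ubr (ubr_cst 0) => i _; rewrite mpartialE -(partial_cst nu 0 (z i)).
  by apply: near_eq_partial; near=> y; rewrite block_mxEul mxE.
- apply: eq_ubr (ubr_cst 0) => i _; rewrite mpartialE -(partial_cst nu (Z i mu b) (z i)).
  by apply: near_eq_partial; near=> y; rewrite block_mxEur mxE.
- have /ubmP/(_ mu a) u : ubm (fun i => Z i *m mpartial nu (h i) (z i)) by exact: ubmM.
  apply: eq_ubr (ubrN u) => i Pi.
  have -> : Z i *m mpartial nu (h i) (z i) = mpartial nu (fun y => Z i *m h i y) (z i).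
    rewrite (@mpartialM _ _ _ _ _ _ (fun=> Z i)); [|exact: mCk_cst|exact: c1h].
    by rewrite mpartial_cst mul0mx add0r.
  rewrite !mpartialE -partialN.
    by apply: near_eq_partial; near=> y; rewrite block_mxEdl 2!mxE [row _ _ _ _]mxE.
  have cZh : mCk 1 (fun y => Z i *m h i y) (z i).
    by apply: mCkM; [exact: mCk_cst|exact: c1h].
  exact: Ck_differentiable (cZh mu a).
- have /ubmP/(_ a b) := ubm_mpartial_conn nu mu.
  apply: eq_ubr => i _; rewrite !mpartialE.
  by apply: near_eq_partial; near=> y; rewrite block_mxEdr.
Unshelve. all: by end_near. Qed.

Lemma ubm_frame_curv g g' : ubm (fun i => frame_curv (h i) (Z i) g g' (z i)).
Proof.
apply: ubmD; [apply: ubmD; [apply: ubmB; exact: ubm_frame_partial|]|].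
  by apply: ubmB; apply: ubmM; exact: ubm_frame_conn.
apply: ubmZ; last exact: ubm_frame_conn.
apply: ubm_entry; apply: ubm_block; try exact: ubm_cst.
by apply: ubmZ; [exact: ubr_cst|exact: ubmM].
Qed.

(** The squared norm is a polynomial in the entries of Z, h, the inverse of h and the first two
    derivatives of h, all of them bounded by hypothesis. *)
Lemma ubr_frame_rmnorm2 : ubr (fun i =>
  rmnorm2 (frame_metric (h i) (z i)) (fun g g' => frame_curv (h i) (Z i) g g' (z i))).
Proof.
have bI : ubm (fun i => invmx (frame_metric (h i) (z i))).
  apply: (@eq_ubm _ _ _ (fun i => block_mx 1 0 0 (invmx (h i (z i))))); last first.
    by apply: ubm_block => //; exact: ubm_cst.
  move=> i Pi; have uD : frame_metric (h i) (z i) \in unitmx.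
    by rewrite unitmxE det_ublock det1 mul1r -unitmxE uh.
  apply: (@row_full_inj _ _ _ _ (frame_metric (h i) (z i))); first by rewrite row_full_unit.
  rewrite mulmxV // mulmx_block !(mulmx0, mul0mx, addr0, add0r) mulmxV ?uh // mulmx1.
  by rewrite -scalar_mx_block.
have bD : ubm (fun i => frame_metric (h i) (z i)).
  by apply: ubm_block => //; exact: ubm_cst.
have bIe g g' : ubr (fun i => invmx (frame_metric (h i) (z i)) g g') by exact: ubm_entry bI.
rewrite /rmnorm2; apply: ubr_sum => g _; apply: ubr_sum => e _; apply: ubrM => //.
apply: ubr_sum => g' _; apply: ubr_sum => e' _; apply: ubrM => //.
apply: ubr_trace; apply: ubmM; first exact: ubm_tr.
by apply: ubmM; [apply: ubmM => //|apply: ubm_tr]; exact: ubm_frame_curv.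
Qed.

End FrameBounds.

End UniformBounds.

(** * Product metrics *)

Section BlockDiagonal.
Context {R : realType} {m : nat} {e : 'I_m -> nat}.
Local Notation N := (\sum_(i < m) e i)%N.

(** Right multiplication by [sel i] extracts the i-th block of a row, and by its transpose inserts
    it; this replaces block matrices with blocks of dependent sizes. *)
Definition sel i : 'M[R]_(N, e i) := \matrix_(j, k) (j == tagnat.Rank i k)%:R.

Lemma sum_Rank (F : 'I_N -> R) :
  \sum_i \sum_(k < e i) F (tagnat.Rank i k) = \sum_s F s.
Proof.
rewrite [RHS](reindex tagnat.rank) /=; last exact: tagnat.rank_bij_on.
by rewrite sig_big_dep /=; apply: eq_bigr => -[].
Qed.

Lemma sum_pred1_mul (I : finType) (a b : I) :
  \sum_s ((s == a)%:R * (s == b)%:R) = (a == b)%:R :> R.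
Proof.
rewrite (bigD1 a) //= eqxx mul1r big1 ?addr0 // => s /negPf ->.
by rewrite mul0r.
Qed.

Lemma sel_tr_mul i : (sel i)^T *m sel i = 1%:M.
Proof.
apply/matrixP => k k'; rewrite !mxE.
under eq_bigr do rewrite !mxE.
by rewrite sum_pred1_mul -val_eqE /= tagnat.eq_Rank eqxx.
Qed.

Lemma sel_tr_mul0 i j : i != j -> (sel i)^T *m sel j = 0.
Proof.
move=> ij; apply/matrixP => k k'; rewrite !mxE.
under eq_bigr do rewrite !mxE.
by rewrite sum_pred1_mul -val_eqE /= tagnat.eq_Rank (negPf ij).
Qed.

Lemma sum_sel_mul_tr : \sum_i sel i *m (sel i)^T = 1%:M.
Proof.
apply/matrixP => j j'; rewrite summxE mxE.
transitivity (\sum_i \sum_(k < e i) ((tagnat.Rank i k == j)%:R *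
   (tagnat.Rank i k == j')%:R : R)).
  apply: eq_bigr => i _; rewrite mxE; apply: eq_bigr => k _.
  by rewrite !mxE ![_ == tagnat.Rank _ _]eq_sym.
by rewrite (sum_Rank (fun s => (s == j)%:R * (s == j')%:R)) sum_pred1_mul.
Qed.

Definition bdiag (A : forall i, 'M[R]_(e i)) : 'M[R]_N :=
  \sum_i sel i *m A i *m (sel i)^T.

Lemma eq_bdiag A B : (forall i, A i = B i) -> bdiag A = bdiag B.
Proof. by move=> AB; apply: eq_bigr => i _; rewrite AB. Qed.

Lemma bdiag1 : bdiag (fun=> 1%:M) = 1%:M.
Proof. by rewrite -sum_sel_mul_tr; apply: eq_bigr => i _; rewrite mulmx1. Qed.

Lemma bdiagM A B : bdiag A *m bdiag B = bdiag (fun i => A i *m B i).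
Proof.
rewrite /bdiag mulmx_suml; apply: eq_bigr => i _.
rewrite mulmx_sumr [LHS](bigD1 i) //= [X in _ + X]big1 ?addr0 => [|j ji].
  by rewrite !mulmxA -[_ *m _ *m sel i]mulmxA sel_tr_mul mulmx1.
rewrite !mulmxA -[_ *m _ *m sel j]mulmxA sel_tr_mul0 1?eq_sym //.
by rewrite mulmx0 !mul0mx.
Qed.

Lemma bdiag_tr A : (bdiag A)^T = bdiag (fun i => (A i)^T).
Proof.
rewrite /bdiag raddf_sum; apply: eq_bigr => i _ /=.
by rewrite !trmx_mul trmxK mulmxA.
Qed.

Lemma bdiagN A : - bdiag A = bdiag (fun i => - A i).
Proof.
by rewrite /bdiag -sumrN; apply: eq_bigr => i _; rewrite mulmxN mulNmx.
Qed.

Lemma bdiagZ k A : k *: bdiag A = bdiag (fun i => k *: A i).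
Proof.
by rewrite /bdiag scaler_sumr; apply: eq_bigr => i _; rewrite -scalemxAr -scalemxAl.
Qed.

Lemma bdiag_inv A : (forall i, A i \in unitmx) ->
  bdiag A \in unitmx /\ invmx (bdiag A) = bdiag (fun i => invmx (A i)).
Proof.
move=> uA; have AB : bdiag A *m bdiag (fun i => invmx (A i)) = 1%:M.
  by rewrite bdiagM -bdiag1; apply: eq_bdiag => i; rewrite mulmxV.
have [uB _] := mulmx1_unit AB; split => //.
by rewrite -[RHS]mul1mx -(mulVmx uB) -mulmxA AB mulmx1.
Qed.

Lemma ubm_bdiag (I : Type) (P : I -> Prop) (A : forall i, I -> 'M[R]_(e i)) :
  (forall i, ubm P (A i)) -> ubm P (fun t => bdiag (fun i => A i t)).
Proof.
move=> uA; apply: ubm_sum => i _; apply: ubmM; last exact: ubm_cst.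
by apply: ubmM => //; exact: ubm_cst.
Qed.

Section Calculus.
Context {d : nat}.
Implicit Type (z : 'rV[R]_d).

Lemma mCk_bdiag n (A : forall i, 'rV[R]_d -> 'M[R]_(e i)) z :
  (forall i, mCk n (A i) z) -> mCk n (fun y => bdiag (fun i => A i y)) z.
Proof.
move=> cA; apply: mCk_sum => i _; apply: mCkM; last exact: mCk_cst.
by apply: mCkM; [exact: mCk_cst|exact: cA].
Qed.

Lemma mpartial_bdiag mu (A : forall i, 'rV[R]_d -> 'M[R]_(e i)) z :
  (forall i, mCk 1 (A i) z) ->
  mpartial mu (fun y => bdiag (fun i => A i y)) z = bdiag (fun i => mpartial mu (A i) z).
Proof.
move=> cA; rewrite mpartial_sum => [|i _]; last first.
  apply: mCkM; last exact: mCk_cst.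
  by apply: mCkM; [exact: mCk_cst|exact: cA].
apply: eq_bigr => i _.
have cS : mCk 1 (fun y => sel i *m A i y) z.
  by apply: mCkM; [exact: mCk_cst|exact: cA].
rewrite (@mpartialM _ _ _ _ _ _ (fun y => sel i *m A i y) (fun=> (sel i)^T)) //; last exact: mCk_cst.
rewrite (@mpartialM _ _ _ _ _ _ (fun=> sel i) (A i)); [|exact: mCk_cst|exact: cA].
by rewrite !mpartial_cst mulmx0 mul0mx addr0 add0r.
Qed.

End Calculus.

Lemma partial_coord {d} mu k (y : 'rV[R]_d) :
  partial mu (fun y : 'rV[R]_d => y 0 k) y = (mu == k)%:R.
Proof.
have did : differentiable (id : 'rV[R]_d -> 'rV[R]_d) y by exact: ex_diff.
transitivity ('D_(delta_mx 0 mu) (fun y : 'rV[R]_d => y 0 k) y) => //.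
rewrite -(derive_coord (delta_mx 0 mu) k did) derive_id mxE eqxx /=.
by rewrite eq_sym.
Qed.

Lemma mCk_id {d} n (z : 'rV[R]_d) : mCk n (fun y : 'rV[R]_d => y) z.
Proof.
move=> i k; rewrite ord1.
case: n => [|n]; first exact: Ck0.
apply/CkSP; split; first by near=> y; exact: differentiable_coord.
move=> mu; apply: Ck_near (Ck_cst n (mu == k)%:R z).
by near=> y; rewrite partial_coord.
Unshelve. all: by end_near. Qed.

Lemma mCk_linear {d d'} n (L : 'M[R]_(d, d')) z : mCk n (fun y : 'rV[R]_d => y *m L) z.
Proof. by apply: mCkM; [exact: mCk_id|exact: mCk_cst]. Qed.

Lemma partial_linear {d d'} mu k (L : 'M[R]_(d, d')) z :
  partial mu (fun y : 'rV[R]_d => (y *m L) 0 k) z = L mu k.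
Proof.
have -> : (fun y : 'rV[R]_d => (y *m L) 0 k) = (fun y => \sum_l y 0 l * L l k).
  by apply/funext => y; rewrite mxE.
rewrite partial_sum; last first.
  move=> l _; apply: differentiableM; first exact: differentiable_coord.
  exact: differentiable_cst.
rewrite (bigD1 mu) //= big1 ?addr0 => [|l lmu]; rewrite partialM; 
  do ?[exact: differentiable_coord|exact: differentiable_cst].
  by rewrite partial_coord partial_cst mulr0 addr0 eqxx mul1r.
by rewrite partial_coord partial_cst mulr0 addr0 eq_sym (negPf lmu) mul0r.
Qed.

Section BaseMetric.
Variables (gg : forall i, 'rV[R]_(e i) -> 'M[R]_(e i)).
Implicit Types (z : 'rV[R]_N) (beta : 'I_m -> R).

Definition base_metric beta z : 'M[R]_N :=
  bdiag (fun i => beta i *: @gg i (z *m sel i)).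

Lemma mCk_base_metric n beta z : (forall i, mCk n (@gg i) (z *m sel i)) ->
  mCk n (base_metric beta) z.
Proof.
move=> cg; apply: mCk_bdiag => i; apply: mCkZ; first exact: Ck_cst.
by apply: mCk_comp => //; exact: mCk_linear.
Qed.

Lemma mpartial_base_metric mu beta z : (forall i, mCk 1 (@gg i) (z *m sel i)) ->
  mpartial mu (base_metric beta) z =
  bdiag (fun i => beta i *: \sum_k sel i mu k *: mpartial k (@gg i) (z *m sel i)).
Proof.
move=> cg; have cgi i : mCk 1 (fun z => @gg i (z *m sel i)) z.
  by apply: mCk_comp => //; exact: mCk_linear.
rewrite mpartial_bdiag => [|i]; last by apply: mCkZ => //; exact: Ck_cst.
apply: eq_bdiag => i; rewrite mpartial_scale //; congr (_ *: _).
rewrite mpartial_chain //; last exact: mCk_linear.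
by apply: eq_bigr => k _; rewrite partial_linear.
Qed.

End BaseMetric.

(** A first derivative of [base_metric] is again a [base_metric], for the differentiated blocks gg',
    so the first-order formula applies twice. *)
Lemma mpartial2_base_metric (gg : forall i, 'rV[R]_(e i) -> 'M[R]_(e i))
    nu mu beta (z : 'rV[R]_N) : (forall i, mCk 2 (gg i) (z *m sel i)) ->
  mpartial nu (mpartial mu (base_metric gg beta)) z =
  bdiag (fun i => beta i *: \sum_l sel i nu l *:
     \sum_k sel i mu k *: mpartial l (mpartial k (gg i)) (z *m sel i)).
Proof.
move=> cg; pose gg' i y := \sum_k sel i mu k *: mpartial k (gg i) y.
have cgn : \forall y \near z, forall i, mCk 1 (gg i) (y *m sel i).
  apply: near_all_fin => i; have := mCk_near_mCk (mCkS (cg i)).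
  have : {for z, continuous (fun y : 'rV[R]_N => y *m sel i)}.
    apply: differentiable_continuous; apply: differentiable_row => k.
    exact: Ck_differentiable (mCk_linear 1 (sel i) z 0 k).
  by move=> c h; exact: c _ h.
have -> : mpartial nu (mpartial mu (base_metric gg beta)) z =
          mpartial nu (base_metric gg' beta) z.
  apply: mpartial_near; apply: filterS cgn => y cy.
  by rewrite mpartial_base_metric.
have cdk i k : mCk 1 (mpartial k (gg i)) (z *m sel i) by exact: mCk_mpartial.
rewrite mpartial_base_metric => [|i].
  apply: eq_bdiag => i; congr (_ *: _); apply: eq_bigr => l _; congr (_ *: _).
  rewrite mpartial_sum => [|k _]; last by apply: mCkZ => //; exact: Ck_cst.
  by apply: eq_bigr => k _; rewrite mpartial_scale.
by apply: mCk_sum => k _; apply: mCkZ => //; exact: Ck_cst.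
Qed.

End BlockDiagonal.

(** * Tensors in charts *)

Section Charts.
Context {R : realType} {d : nat} {M : manifold R d}.
Implicit Types (c : chart R d M) (p : M) (x : 'rV[R]_d).

Lemma chart_dom_open c : atlas c -> open (chart_dom c).
Proof. by case/atlas_chart. Qed.

Lemma chart_img_open c : atlas c -> open (chart_img c).
Proof. by case/atlas_chart. Qed.

Lemma chart_mapK c p : atlas c -> chart_dom c p -> chart_inv c (chart_map c p) = p.
Proof. by case/atlas_chart => _ _ + _ _; exact. Qed.

Lemma chart_invK c x : atlas c -> chart_img c x -> chart_map c (chart_inv c x) = x.
Proof. by move=> ac [p cp <-]; rewrite chart_mapK. Qed.

Lemma chart_inv_dom c x : atlas c -> chart_img c x -> chart_dom c (chart_inv c x).
Proof. by move=> ac [p cp <-]; rewrite chart_mapK. Qed.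

Lemma chart_map_img c p : chart_dom c p -> chart_img c (chart_map c p).
Proof. by exists p. Qed.

Lemma chart_map_continuous c p : atlas c -> chart_dom c p ->
  {for p, continuous (chart_map c)}.
Proof. by case/atlas_chart => _ _ _ + _; exact. Qed.

Lemma chart_inv_continuous c x : atlas c -> chart_img c x ->
  {for x, continuous (chart_inv c)}.
Proof. by case/atlas_chart => _ _ _ _; exact. Qed.

Lemma coordK p : chart_inv (chart_at p) (Defs.coord p) = p.
Proof. exact: chart_mapK (chart_at_atlas p) (chart_at_dom p). Qed.

Lemma coord_img p : chart_img (chart_at p) (Defs.coord p).
Proof. exact/chart_map_img/chart_at_dom. Qed.

Definition smooth_at e (f : 'rV[R]_e -> M) z :=
  {for z, continuous f} /\
  forall c, atlas c -> chart_dom c (f z) -> forall n,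
    mCk n (fun y => chart_map c (f y)) z.

Lemma smooth_at_dom e (f : 'rV[R]_e -> M) z c : smooth_at f z -> atlas c ->
  chart_dom c (f z) -> \forall y \near z, chart_dom c (f y).
Proof.
move=> [cf _] ac cz.
have : \forall q \near f z, chart_dom c q.
  by apply: open_nbhs_nbhs; split => //; exact: chart_dom_open.
exact: cf.
Qed.

Lemma smooth_to_at e (U : set 'rV[R]_e) (f : 'rV[R]_e -> M) z :
  (\forall y \near z, U y) -> smooth_to U f -> smooth_at f z.
Proof.
move=> nU [cf sf]; have cz : {for z, continuous f} by apply: cf; exact: nbhs_singleton nU.
split => // c ac cfz n j k; rewrite ord1.
apply: smooth_Ck (sf c ac k) n; near=> y; split; first by near: y.
near: y; have : \forall q \near f z, chart_dom c q.
  by apply: open_nbhs_nbhs; split => //; exact: chart_dom_open.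
exact: cz.
Unshelve. all: by end_near. Qed.

Lemma near_chart_img c x : atlas c -> chart_img c x -> \forall y \near x, chart_img c y.
Proof.
by move=> ac cx; apply: open_nbhs_nbhs; split => //; exact: chart_img_open.
Qed.

Lemma smooth_at_chart_inv c x : atlas c -> chart_img c x -> smooth_at (chart_inv c) x.
Proof.
move=> ac cx; have cont := chart_inv_continuous ac cx; split=> // c' ac' c'x n j k.
rewrite ord1; apply: smooth_Ck (atlas_smooth ac ac' k) n.
have n1 := near_chart_img ac cx.
have : \forall q \near chart_inv c x, chart_dom c' q.
  by apply: open_nbhs_nbhs; split => //; exact: chart_dom_open.
move=> /cont n2; near=> y.
have cy : chart_img c y by near: y.
exists (chart_inv c y); last exact: chart_invK.
split; first exact: chart_inv_dom.
by near: y.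
Unshelve. all: by end_near. Qed.

Lemma jacobian_mpartial e e' (phi : 'rV[R]_e -> 'rV[R]_e') z : mCk 1 phi z ->
  jacobian phi z = \matrix_(i, k) partial i (fun y => phi y 0 k) z.
Proof. by move=> cphi; apply: jacobianE => k; exact: Ck_differentiable (cphi 0 k). Qed.

(** [diffmx] refers to the preferred chart at the image point, which may jump from point to point;
    this trades it for a fixed chart c. *)
Lemma diffmx_chart e (f : 'rV[R]_e -> M) z c : smooth_at f z -> atlas c ->
  chart_dom c (f z) ->
  diffmx f z = jacobian (fun y => chart_map c (f y)) z *m
               diffmx (chart_inv c) (chart_map c (f z)).
Proof.
move=> sf ac cz; rewrite /diffmx chart_mapK //.
have c0z := chart_at_dom (f z); have ac0 := chart_at_atlas (f z).
set c0 := chart_at (f z) in c0z ac0 *.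
have si : smooth_at (chart_inv c) (chart_map c (f z)).
  by apply: smooth_at_chart_inv => //; exact: chart_map_img.
rewrite -(jacobian_chain (psi := chart_map c0 \o chart_inv c)).
- apply: near_eq_jacobian; last first.
    by move=> k; exact: Ck_differentiable (sf.2 _ ac0 c0z 1%N 0 k).
  apply: filterS (smooth_at_dom sf ac cz) => y cy /=.
  by rewrite chart_mapK.
- by move=> k; exact: Ck_differentiable (sf.2 _ ac cz 1%N 0 k).
- move=> k; have := si.2 _ ac0 _ 1%N 0 k; rewrite chart_mapK // => /(_ c0z).
  exact: Ck_differentiable.
Qed.

Lemma pull2_chart (B : M -> 'M[R]_d) e (f : 'rV[R]_e -> M) z c : smooth_at f z ->
  atlas c -> chart_dom c (f z) ->
  pull2 B f z = jacobian (fun y => chart_map c (f y)) z *m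
    comp2 B c (chart_map c (f z)) *m (jacobian (fun y => chart_map c (f y)) z)^T.
Proof.
move=> sf ac cz; rewrite /comp2 /pull2 (diffmx_chart sf ac cz) chart_mapK //.
by rewrite trmx_mul !mulmxA.
Qed.

Lemma jacobian_id (f : 'rV[R]_d -> 'rV[R]_d) x : {near x, f =1 id} -> jacobian f x = 1%:M.
Proof.
move=> fid; have did k : differentiable (fun y : 'rV[R]_d => id y 0 k) x.
  exact: differentiable_coord.
rewrite -(near_eq_jacobian (phi := id)) //; last by apply: filterS fid => y ->.
by rewrite jacobianE //; apply/matrixP => i k; rewrite !mxE partial_coord.
Qed.

Lemma diffmx_chart_inv_unit c x : atlas c -> chart_img c x ->
  diffmx (chart_inv c) x \in unitmx.
Proof.
move=> ac cx; have ac0 := chart_at_atlas (chart_inv c x).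
have c0x := chart_at_dom (chart_inv c x).
have cd := chart_inv_dom ac cx.
rewrite /diffmx; set c0 := chart_at _ in ac0 c0x *.
have s1 := smooth_at_chart_inv ac cx.
have cy : chart_img c0 (chart_map c0 (chart_inv c x)) by exact: chart_map_img.
have s2 := smooth_at_chart_inv ac0 cy.
have e : jacobian (chart_map c0 \o chart_inv c) x *m
    jacobian (chart_map c \o chart_inv c0) (chart_map c0 (chart_inv c x)) = 1%:M.
  rewrite -(jacobian_chain (phi := chart_map c0 \o chart_inv c)).
  - apply: jacobian_id; near=> y => /=.
    have yc0 : chart_dom c0 (chart_inv c y).
      by near: y; exact: smooth_at_dom.
    rewrite chart_mapK // chart_invK //.
    by near: y; exact: near_chart_img.
  - by move=> k; exact: Ck_differentiable (s1.2 _ ac0 c0x 1%N 0 k).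
  - move=> k; have := s2.2 _ ac _ 1%N 0 k; rewrite chart_mapK // => /(_ cd).
    exact: Ck_differentiable.
have [h _] := mulmx1_unit e; exact: h.
Unshelve. all: by end_near. Qed.

Lemma diffmx_coord p : diffmx (chart_inv (chart_at p)) (Defs.coord p) = 1%:M.
Proof.
rewrite /diffmx coordK; apply: jacobian_id.
have := near_chart_img (chart_at_atlas p) (coord_img p).
by apply: filterS => y cy /=; rewrite chart_invK //; exact: chart_at_atlas.
Qed.

Section Metric.
Variable g : M -> 'M[R]_d.
Hypothesis rg : riemannian_metric g.

Lemma metric_unit p : g p \in unitmx.
Proof.
have [_ _ pos] := rg; rewrite -row_free_unit -kermx_eq0; apply/eqP/row_matrixP => i.
rewrite row0; apply/eqP; apply: contraT => /(pos p).
have -> : row i (kermx (g p)) *m g p = 0.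
  by apply/sub_kermxP; exact: row_sub.
by rewrite mul0mx mxE ltxx.
Qed.

Lemma comp2_metric_unit c x : atlas c -> chart_img c x -> comp2 g c x \in unitmx.
Proof.
move=> ac cx; have uD := diffmx_chart_inv_unit ac cx.
by rewrite /comp2 /pull2 !unitmx_mul unitmx_tr uD metric_unit.
Qed.

Lemma comp2_metric_sym c x : (comp2 g c x)^T = comp2 g c x.
Proof.
by have [_ sg _] := rg; rewrite /comp2 /pull2 !trmx_mul trmxK sg mulmxA.
Qed.

Lemma mCk_comp2 n c x : atlas c -> chart_img c x -> mCk n (comp2 g c) x.
Proof.
move=> ac cx i j; have [sg _ _] := rg.
by apply: smooth_Ck (sg c ac i j) n; exact: near_chart_img.
Qed.

End Metric.

Lemma comp2D (B B' : M -> 'M[R]_d) c x :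
  comp2 (fun p => B p + B' p) c x = comp2 B c x + comp2 B' c x.
Proof. by rewrite /comp2 /pull2 mulmxDr mulmxDl. Qed.

Lemma comp2Z k (B : M -> 'M[R]_d) c x :
  comp2 (fun p => k *: B p) c x = k *: comp2 B c x.
Proof. by rewrite /comp2 /pull2 -scalemxAr -scalemxAl. Qed.

Lemma comp2_sum (I : Type) (r : seq I) (B : I -> M -> 'M[R]_d) c x :
  comp2 (fun p => \sum_(i <- r) B i p) c x = \sum_(i <- r) comp2 (B i) c x.
Proof. by rewrite /comp2 /pull2 mulmx_sumr mulmx_suml. Qed.

Lemma comp2_covector (s : M -> 'cV[R]_d) c x :
  comp2 (fun p => s p *m (s p)^T) c x = comp1 s c x *m (comp1 s c x)^T.
Proof. by rewrite /comp2 /pull2 /comp1 /pull1 trmx_mul !mulmxA. Qed.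

End Charts.

Section Pullback.
Context {R : realType} {d e : nat} {M : manifold R d} {N : manifold R e}.
Variable f : M -> N.
Hypothesis sf : smooth_map f.

Lemma smooth_map_at c x : atlas c -> chart_img c x ->
  smooth_at (fun y => f (chart_inv c y)) x.
Proof.
by move=> ac cx; apply: smooth_to_at (sf ac); exact: near_chart_img.
Qed.

Lemma tangent_diffmx c x : atlas c -> chart_img c x ->
  diffmx (chart_inv c) x *m tangent f (chart_inv c x) =
  diffmx (fun y => f (chart_inv c y)) x.
Proof.
move=> ac cx; set p := chart_inv c x.
have s1 := smooth_at_chart_inv ac cx.
have s2 := smooth_map_at ac cx.
have s3 := smooth_map_at (chart_at_atlas p) (coord_img p).
rewrite /tangent /diffmx /= coordK -/p.
rewrite -(jacobian_chain (phi := chart_map (chart_at p) \o chart_inv c)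
  (psi := chart_map (chart_at (f p)) \o (f \o chart_inv (chart_at p)))).
- apply: near_eq_jacobian; last first.
    move=> k; apply: Ck_differentiable.
    have := s2.2 (chart_at (f p)) (chart_at_atlas _) (chart_at_dom _) 1%N 0 k.
    apply: Ck_near; near=> y => /=; rewrite chart_mapK //; first exact: chart_at_atlas.
    by near: y; apply: smooth_at_dom => //; [exact: chart_at_atlas|exact: chart_at_dom].
  near=> y => /=; rewrite chart_mapK //; first exact: chart_at_atlas.
  by near: y; apply: smooth_at_dom => //; [exact: chart_at_atlas|exact: chart_at_dom].
- move=> k; exact: Ck_differentiable (s1.2 _ (chart_at_atlas p) (chart_at_dom p) 1%N 0 k).
- move=> k; have := s3.2 (chart_at (f p)) (chart_at_atlas _).
  rewrite coordK => /(_ (chart_at_dom _) 1%N 0 k); exact: Ck_differentiable.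
Unshelve. all: by end_near. Qed.

Lemma comp2_pullback2 (B : N -> 'M[R]_e) c x c' : atlas c -> chart_img c x ->
  atlas c' -> chart_dom c' (f (chart_inv c x)) ->
  let J := jacobian (fun y => chart_map c' (f (chart_inv c y))) x in
  comp2 (pullback2 f B) c x =
  J *m comp2 B c' (chart_map c' (f (chart_inv c x))) *m J^T.
Proof.
move=> ac cx ac' c'x J; have s2 := smooth_map_at ac cx.
rewrite -(pull2_chart B s2 ac' c'x) /comp2 /pull2 /pullback2 -tangent_diffmx //.
by rewrite trmx_mul !mulmxA.
Qed.

End Pullback.

Section Kahler.
Context {R : realType} {n : nat} {M : manifold R (n + n)}.
Variable g : M -> 'M[R]_(n + n).
Hypotheses (rg : riemannian_metric g) (hol : holomorphic_atlas M)
  (herm : forall x, J0 *m g x *m J0^T = g x).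

Lemma J0_sq : J0 *m J0 = - 1%:M :> 'M[R]_(n + n).
Proof.
rewrite /J0 mulmx_block !(mulmx0, mul0mx, addr0, add0r) mulmx1 mul1mx.
by rewrite [in RHS]scalar_mx_block opp_block_mx !oppr0.
Qed.

(** The Cauchy-Riemann equations for the transition from c to the preferred chart. As a result the
    Kahler form is [J0] times the metric in the components of every chart. *)
Lemma diffmx_holomorphic (c : chart R (n + n) M) x : atlas c -> chart_img c x ->
  J0 *m diffmx (chart_inv c) x = diffmx (chart_inv c) x *m J0.
Proof.
move=> ac cx; apply: hol => //; first exact: chart_at_atlas.
exists (chart_inv c x); last exact: chart_invK.
by split; [exact: chart_inv_dom|exact: chart_at_dom].
Qed.

Lemma comp2_kahler_form (c : chart R (n + n) M) x : atlas c -> chart_img c x ->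
  comp2 (kahler_form g) c x = J0 *m comp2 g c x.
Proof.
move=> ac cx; rewrite /comp2 /pull2 /kahler_form !mulmxA.
by rewrite -diffmx_holomorphic.
Qed.

(** Invariance of the metric under [J0], which passes to components, multiplied on the left by [J0],
    whose square is -1. *)
Lemma kahler_form_antisym (c : chart R (n + n) M) x : atlas c -> chart_img c x ->
  (J0 *m comp2 g c x)^T = - (J0 *m comp2 g c x).
Proof.
move=> ac cx; have sg := comp2_metric_sym rg c x.
have hh : J0 *m comp2 g c x *m J0^T = comp2 g c x.
  rewrite /comp2 /pull2 !mulmxA diffmx_holomorphic // -!mulmxA -trmx_mul.
  rewrite diffmx_holomorphic // trmx_mul !mulmxA; congr (_ *m _).
  by rewrite -!mulmxA; congr (_ *m _); rewrite mulmxA herm.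
rewrite trmx_mul sg; have := congr1 (mulmx J0) hh.
by rewrite !mulmxA J0_sq !mulNmx mul1mx => <-; rewrite opprK.
Qed.

End Kahler.

Section SubmersionFacts.
Context {R : realType} {N : nat}.
Variables (G T : 'rV[R]_(1 + N) -> 'M[R]_(1 + N)) (phi : 'rV[R]_(1 + N) -> 'rV[R]_N)
  (h : 'rV[R]_N -> 'M[R]_N) (Z : 'M[R]_N) (x : 'rV[R]_(1 + N)).
Hypothesis sf : submersion_frame G T phi h Z x.

Lemma frame_metric_unit z : h z \in unitmx -> frame_metric h z \in unitmx.
Proof. by move=> uh; rewrite unitmxE det_ublock det1 mul1r -unitmxE. Qed.

Lemma submersion_metric_unit : G x \in unitmx.
Proof.
rewrite (nbhs_singleton (sf_metric sf)) !unitmx_mul unitmx_tr (sf_unit sf) andbT /=.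
by apply: frame_metric_unit; exact: sf_base_unit sf.
Qed.

Lemma submersion_metric_Ck : mCk 2 G x.
Proof.
have cT : mCk 2 T x := mCk_le (isT : (2 <= 3)%N) (sf_frame_Ck sf).
apply: (@mCk_near _ _ _ _ _ (fun y => T y *m frame_metric h (phi y) *m (T y)^T)).
  by apply: filterS (sf_metric sf) => y ->.
apply: mCkM; last exact: mCk_tr.
apply: mCkM => //; apply: mCk_comp; last exact: mCk_le (sf_map_Ck sf).
by apply: mCk_frame_metric; exact: mCk_le (sf_base_Ck sf).
Qed.

Lemma submersion_metric_sym : {near x, forall y, (G y)^T = G y}.
Proof.
have sfn := submersion_frame_near sf.
apply: filterS sfn => y sfy; rewrite (nbhs_singleton (sf_metric sfy)).
rewrite !trmx_mul trmxK !mulmxA; congr (_ *m _ *m _).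
by rewrite /frame_metric tr_block_mx !trmx0 trmx1 (nbhs_singleton (sf_base_sym sfy)).
Qed.

Lemma submersion_curvature_norm : curvature_norm G x =
  Num.sqrt (rmnorm2 (frame_metric h (phi x))
    (fun g g' => frame_curv h Z g g' (phi x))).
Proof.
rewrite curvature_normE; congr (Num.sqrt _).
have -> : G x = T x *m frame_metric h (phi x) *m (T x)^T.
  exact: nbhs_singleton (sf_metric sf).
apply: (rmnorm2_frame (sf_unit sf) (frame_metric_unit (sf_base_unit sf))) => i j.
exact: submersion_curv.
Qed.

End SubmersionFacts.

(** * Curvature of the bundle metrics *)

Section BundleChart.
Context {R : realType} {m : nat} {n : 'I_m -> nat}.
Local Notation e := (fun i => (n i + n i)%N).
Local Notation N := (\sum_(i < m) (n i + n i))%N.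
Context {M : forall i, manifold R (n i + n i)} {P : manifold R (1 + N)}.
Variables (g : forall i, M i -> 'M[R]_(n i + n i)) (act : R -> P -> P)
  (proj : forall i, P -> M i) (sigma : P -> 'cV[R]_(1 + N)) (q : 'I_m -> int).
Hypotheses (rg : forall i, riemannian_metric (@g i))
  (hol : forall i, holomorphic_atlas (M i))
  (herm : forall i x, J0 *m @g i x *m J0^T = @g i x)
  (bdl : principal_circle_bundle act proj)
  (cnx : principal_connection act sigma)
  (dsigma : exterior_derivative_is sigma
    (curvature_form proj q (fun i => kahler_form (@g i)))).
Variables (p : P) (cc : forall i, chart R (n i + n i) (M i)).
Hypotheses (acc : forall i, atlas (cc i)) (ccp : forall i, chart_dom (cc i) (proj i p)).

Let c := chart_at p.
Let x0 : 'rV[R]_(1 + N) := Defs.coord p.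

Definition base_map i (y : 'rV[R]_(1 + N)) : 'rV[R]_(n i + n i) :=
  chart_map (cc i) (proj i (chart_inv c y)).

Definition total_map (y : 'rV[R]_(1 + N)) : 'rV[R]_N :=
  \sum_i base_map i y *m (@sel R m e i)^T.

Definition base_jac i (y : 'rV[R]_(1 + N)) : 'M[R]_(1 + N, n i + n i) :=
  \matrix_(a, k) partial a (fun y => base_map i y 0 k) y.

Definition total_jac (y : 'rV[R]_(1 + N)) : 'M[R]_(1 + N, N) :=
  \sum_i base_jac i y *m (@sel R m e i)^T.

(** The matrix T of [submersion_frame]. The factor eps is sqrt (a / tau), which makes the first
    column a unit covector of the rescaled metric. *)
Definition bundle_frame (eps : R) (y : 'rV[R]_(1 + N)) : 'M[R]_(1 + N) :=
  row_mx (eps *: comp1 sigma c y) (total_jac y).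

Let ac : atlas c. Proof. exact: chart_at_atlas. Qed.
Let cx0 : chart_img c x0. Proof. exact: coord_img. Qed.
Let inv_x0 : chart_inv c x0 = p. Proof. exact: coordK. Qed.
Let sproj i : smooth_map (proj i). Proof. by case: bdl. Qed.

Lemma mCk_base_map k i : mCk k (base_map i) x0.
Proof.
have [_ /(_ (cc i) (acc i))] := smooth_map_at (sproj i) ac cx0.
by rewrite inv_x0 => /(_ (ccp i)); exact.
Qed.

Lemma base_map_dom : \forall y \near x0, forall i,
  chart_dom (cc i) (proj i (chart_inv c y)).
Proof.
apply: near_all_fin => i; apply: (smooth_at_dom (smooth_map_at (sproj i) ac cx0)) => //.
by rewrite inv_x0.
Qed.

Lemma total_map_sel i y : total_map y *m sel i = base_map i y.
Proof.
rewrite mulmx_suml [LHS](bigD1 i) //= [X in _ + X]big1 ?addr0 => [|j ji].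
  by rewrite -mulmxA sel_tr_mul mulmx1.
by rewrite -mulmxA sel_tr_mul0 // mulmx0.
Qed.

Lemma total_jac_sel i y : total_jac y *m sel i = base_jac i y.
Proof.
rewrite mulmx_suml [LHS](bigD1 i) //= [X in _ + X]big1 ?addr0 => [|j ji].
  by rewrite -mulmxA sel_tr_mul mulmx1.
by rewrite -mulmxA sel_tr_mul0 // mulmx0.
Qed.

Lemma total_jac_bdiag (A : forall i, 'M[R]_(n i + n i)) y :
  total_jac y *m bdiag A *m (total_jac y)^T =
  \sum_i base_jac i y *m A i *m (base_jac i y)^T.
Proof.
rewrite /bdiag mulmx_sumr mulmx_suml; apply: eq_bigr => i _.
by rewrite -total_jac_sel trmx_mul !mulmxA.
Qed.

Lemma mCk_base_jac k i : mCk k (base_jac i) x0.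
Proof.
move=> a l; apply: Ck_near (Ck_partial a (mCk_base_map k.+1 0 l)).
by near=> y; rewrite mxE.
Unshelve. all: by end_near. Qed.

Lemma mCk_total_jac k : mCk k total_jac x0.
Proof.
apply: mCk_sum => i _; apply: mCkM; [exact: mCk_base_jac|exact: mCk_cst].
Qed.

Lemma mCk_total_map k : mCk k total_map x0.
Proof.
apply: mCk_sum => i _; apply: mCkM; [exact: mCk_base_map|exact: mCk_cst].
Qed.

Lemma mCk_connection k : mCk k (comp1 sigma c) x0.
Proof.
move=> a b; rewrite ord1; have [s1 _ _] := cnx.
by apply: smooth_Ck (s1 c ac a) k; exact: near_chart_img.
Qed.

Lemma mCk_bundle_frame k eps : mCk k (bundle_frame eps) x0.
Proof.
move=> a b; rewrite -[b]splitK; case: (fintype.split b) => l /=.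
  apply: Ck_near (CkM (Ck_cst k eps x0) (mCk_connection k a l)).
  by near=> y; rewrite /bundle_frame [RHS]row_mxEl [RHS]mxE.
apply: Ck_near (mCk_total_jac k a l).
by near=> y; rewrite /bundle_frame [RHS]row_mxEr.
Unshelve. all: by end_near. Qed.

Lemma total_jacE a mu : {near x0, forall y,
  total_jac y a mu = partial a (fun y => total_map y 0 mu) y}.
Proof.
have nb : \forall y \near x0, forall i, mCk 1 (base_map i) y.
  by apply: near_all_fin => i; exact/mCk_near_mCk/mCk_base_map.
apply: filterS nb => y cb; rewrite -mpartialE mpartial_sum; last first.
  by move=> i _; apply: mCkM; [exact: cb|exact: mCk_cst].
rewrite !summxE; apply: eq_bigr => i _.
rewrite (@mpartialM _ _ _ _ _ _ (base_map i) (fun=> (sel i)^T));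
  [|exact: cb|exact: mCk_cst].
rewrite mpartial_cst mulmx0 addr0 !mxE; apply: eq_bigr => k _.
by rewrite mpartialE !mxE.
Qed.

Lemma comp2_bundle_metric a b : {near x0, forall y,
  comp2 (bundle_metric proj sigma g a b) c y =
  a *: (comp1 sigma c y *m (comp1 sigma c y)^T) +
  \sum_i b i *: (base_jac i y *m comp2 (@g i) (cc i) (base_map i y) *m (base_jac i y)^T)}.
Proof.
have nb : \forall y \near x0, forall i, mCk 1 (base_map i) y.
  by apply: near_all_fin => i; exact/mCk_near_mCk/mCk_base_map.
near=> y.
have cy : chart_img c y by near: y; exact: near_chart_img.
have dy : forall i, chart_dom (cc i) (proj i (chart_inv c y)).
  by near: y; exact: base_map_dom.
have by_ : forall i, mCk 1 (base_map i) y by near: y.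
rewrite /bundle_metric (comp2D (fun p => a *: _)) (comp2Z a (fun p => sigma p *m _)).
rewrite comp2_covector comp2_sum; congr (_ + _); apply: eq_bigr => i _.
rewrite (comp2Z (b i) (pullback2 (proj i) (@g i))); congr (_ *: _).
rewrite (comp2_pullback2 (sproj i) (@g i) ac cy (acc i) (dy i)).
by rewrite jacobian_mpartial.
Unshelve. all: by end_near. Qed.

Lemma comp2_curvature_form : {near x0, forall y,
  comp2 (curvature_form proj q (fun i => kahler_form (@g i))) c y =
  \sum_i (q i)%:~R *: (base_jac i y *m
    (J0 *m comp2 (@g i) (cc i) (base_map i y)) *m (base_jac i y)^T)}.
Proof.
have nb : \forall y \near x0, forall i, mCk 1 (base_map i) y.
  by apply: near_all_fin => i; exact/mCk_near_mCk/mCk_base_map.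
near=> y.
have cy : chart_img c y by near: y; exact: near_chart_img.
have dy : forall i, chart_dom (cc i) (proj i (chart_inv c y)).
  by near: y; exact: base_map_dom.
have by_ : forall i, mCk 1 (base_map i) y by near: y.
rewrite /curvature_form comp2_sum; apply: eq_bigr => i _.
rewrite (comp2Z _ (pullback2 (proj i) (kahler_form (@g i)))); congr (_ *: _).
rewrite (comp2_pullback2 (sproj i) (kahler_form (@g i)) ac cy (acc i) (dy i)).
rewrite jacobian_mpartial // comp2_kahler_form //.
exact: chart_map_img.
Unshelve. all: by end_near. Qed.

(** The projection is constant along orbits. Since smoothness of the action is given jointly in time
    and chart coordinates, the field is written as a directional derivative of the map Psi below and
    the chain rule is applied there. *)
Lemma fundamental_field_base_jac i : fundamental_field act p *m base_jac i x0 = 0.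
Proof.
have [[act0 actD sact] _ _ [_ orb] _] := bdl.
pose Psi (z : 'rV[R]_(1 + (1 + N))) : P := act (lsubmx z 0 0) (chart_inv c (rsubmx z)).
pose z0 : 'rV[R]_(1 + (1 + N)) := row_mx 0 x0.
pose e0 : 'rV[R]_(1 + (1 + N)) := row_mx 1%:M 0.
have Psi0 : Psi z0 = p by rewrite /Psi row_mxKl row_mxKr mxE act0 inv_x0.
have crs : {for z0, continuous (fun z : 'rV[R]_(1 + (1 + N)) => rsubmx z)}.
  by apply: differentiable_continuous; exact: differentiable_rsubmx.
have nU : \forall z \near z0, chart_img c (rsubmx z).
  apply: (crs); rewrite row_mxKr; exact: near_chart_img.
have sPsi : smooth_at Psi z0 by exact: smooth_to_at nU (sact c ac).
have cPsi : mCk 1 (fun z => chart_map c (Psi z)) z0.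
  by apply: (sPsi.2 c ac); rewrite Psi0; exact: chart_at_dom.
have dPsi k : differentiable (fun z => chart_map c (Psi z) 0 k) z0.
  exact: Ck_differentiable (cPsi 0 k).
have line h : lsubmx (h *: e0 + z0) 0 0 = h /\ rsubmx (h *: e0 + z0) = x0.
  rewrite /e0 /z0 scale_row_mx add_row_mx row_mxKl row_mxKr scaler0 add0r addr0.
  by rewrite !mxE mulr1.
have KE : fundamental_field act p = 'D_e0 (fun z => chart_map c (Psi z)) z0.
  rewrite /fundamental_field /derive1 /derive.
  apply: (congr1 (fun f : R -> 'rV[R]_(1 + N) => lim (f @ 0^'))).
  apply/funext => h /=; have PsiL : Psi (h *: e0 + z0) = act h p.
    by rewrite /Psi; have [-> ->] := line h; rewrite inv_x0.
  by rewrite PsiL Psi0 addr0 act0.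
apply/rowP => k; rewrite !mxE.
transitivity ('D_e0 (fun z => base_map i (chart_map c (Psi z)) 0 k) z0).
  rewrite (@derive_chain _ _ _ (fun v => base_map i v 0 k) (fun z => chart_map c (Psi z)) z0 e0 _ dPsi).
    apply: eq_bigr => l _; rewrite KE derive_coord; last exact: differentiable_row.
    by rewrite mxE Psi0.
  by rewrite Psi0; exact: Ck_differentiable (mCk_base_map 1 0 k).
transitivity ('D_e0 (fun z => base_map i (rsubmx z) 0 k) z0).
  apply: near_eq_derive; near=> z.
  have cz : chart_dom c (Psi z).
    by near: z; apply: smooth_at_dom => //; rewrite Psi0; exact: chart_at_dom.
  rewrite /base_map chart_mapK //; congr (chart_map _ _ 0 k).
  by apply/esym; have [_] := orb (chart_inv c (rsubmx z)) (Psi z); apply; exists (lsubmx z 0 0).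
rewrite /derive; apply: cvg_lim => //.
have -> : (fun h : R => h^-1 *: (((fun z => base_map i (rsubmx z) 0 k) \o shift z0) (h *: e0)
    - base_map i (rsubmx z0) 0 k)) = cst 0.
  apply/funext => h /=; have [_ ->] := line h.
  by rewrite row_mxKr subrr scaler0.
exact: cvg_cst.
Unshelve. all: by end_near. Qed.

Lemma comp1_coord : comp1 sigma c x0 = sigma p.
Proof. by rewrite /comp1 /pull1 diffmx_coord mul1mx inv_x0. Qed.

(** Every row vector is attained: the submersion property supplies a tangent vector with the
    prescribed base components, and a multiple of the fundamental field, which the base does not
    see, corrects the value of the connection form. *)
Lemma bundle_frame_unit eps : eps != 0 -> bundle_frame eps x0 \in unitmx.
Proof.
move=> eps0; have [_ _ _ _ sub] := bdl; have [_ fund _] := cnx.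
have surj (t : R) (v : 'rV[R]_N) : exists w, w *m bundle_frame eps x0 = row_mx t%:M v.
  have uD i : diffmx (chart_inv (cc i)) (base_map i x0) \in unitmx.
    apply: diffmx_chart_inv_unit => //; apply: chart_map_img.
    by rewrite inv_x0.
  have [w wv] := sub p (fun i => v *m sel i *m diffmx (chart_inv (cc i)) (base_map i x0)).
  have wJ i : w *m base_jac i x0 = v *m sel i.
    have := wv i; have := tangent_diffmx (sproj i) ac cx0.
    rewrite diffmx_coord mul1mx inv_x0 => ->.
    rewrite (diffmx_chart (smooth_map_at (sproj i) ac cx0) (acc i)) ?inv_x0 //.
    rewrite jacobian_mpartial; last exact: mCk_base_map.
    rewrite mulmxA -[chart_map (cc i) (proj i p)]/(chart_map (cc i) (proj i p)).
    have -> : chart_map (cc i) (proj i p) = base_map i x0 by rewrite /base_map inv_x0.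
    by move/(congr1 (mulmx^~ (invmx (diffmx (chart_inv (cc i)) (base_map i x0)))));
      rewrite !mulmxK.
  pose K := fundamental_field act p.
  (* As sigma K = 1, this makes eps sigma equal to t. *)
  exists (w + (t / eps - (w *m sigma p) 0 0) *: K).
  rewrite /bundle_frame mul_mx_row; congr row_mx.
    rewrite comp1_coord -scalemxAr mulmxDl -scalemxAl fund.
    apply/rowP => j; rewrite !ord1 !mxE eqxx mulr1 addrC subrK.
    by rewrite mulrC mulfVK.
  rewrite mulmxDl -scalemxAl.
  have JE u : u *m total_jac x0 = \sum_i u *m base_jac i x0 *m (sel i)^T.
    by rewrite mulmx_sumr; apply: eq_bigr => i _; rewrite mulmxA.
  rewrite !JE [X in _ *: X]big1 => [|i _]; last by rewrite fundamental_field_base_jac mul0mx.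
  rewrite scaler0 addr0 -[RHS]mulmx1 -(@sum_sel_mul_tr R m e) mulmx_sumr.
  by apply: eq_bigr => i _; rewrite wJ mulmxA.
have rows (i : 'I_(1 + N)) : exists w : 'rV[R]_(1 + N), w *m bundle_frame eps x0 = row i 1%:M.
  have [w wE] := surj (lsubmx (row i 1%:M) 0 0) (rsubmx (row i 1%:M)).
  by exists w; rewrite wE -mx11_scalar hsubmxK.
pose B : 'M[R]_(1 + N) := \matrix_(i < 1 + N) projT1 (cid (rows i)).
have BT : B *m bundle_frame eps x0 = 1%:M.
  by apply/row_matrixP => i; rewrite row_mul rowK; exact: projT2 (cid (rows i)).
have [_ u] := mulmx1_unit BT; exact: u.
Qed.

Section Scaled.
Variables (eps : R) (beta : 'I_m -> R) (b : 'I_m -> R) (a tau : R).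
Hypotheses (tau0 : 0 < tau) (eps0 : eps != 0) (epsE : eps ^+ 2 = tau^-1 * a)
  (betaE : forall i, beta i = tau^-1 * b i) (beta0 : forall i, beta i != 0).

Let gg i := comp2 (@g i) (cc i).
Arguments gg : clear implicits.

(** The form eps q_i omega_i / 2 with an index raised by the metric beta_i g_i; the matrix of g_i
    cancels and nothing depends on the point. *)
Definition base_twist : 'M[R]_N :=
  bdiag (fun i => (eps * (q i)%:~R / (2 * beta i)) *: (J0 : 'M[R]_(n i + n i))).

Lemma base_twist_metric z : base_twist *m base_metric gg beta z =
  bdiag (fun i => (eps * (q i)%:~R / 2) *: (J0 *m gg i (z *m sel i))).
Proof.
rewrite bdiagM; apply: eq_bdiag => i; rewrite -scalemxAl -scalemxAr scalerA.
congr (_ *: _); field; exact: beta0.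
Qed.

Lemma near_base_img : \forall z \near total_map x0, forall i, chart_img (cc i) (z *m sel i).
Proof.
apply: near_all_fin => i.
have cont : {for total_map x0, continuous (fun y : 'rV[R]_N => y *m sel i)}.
  apply: differentiable_continuous; apply: differentiable_row => k.
  exact: Ck_differentiable (mCk_linear 1 (sel i) (total_map x0) 0 k).
have : \forall y \near total_map x0 *m sel i, chart_img (cc i) y.
  rewrite total_map_sel; apply: near_chart_img => //.
  by apply: chart_map_img; rewrite inv_x0.
by move=> h; exact: cont _ h.
Qed.

Lemma bundle_submersion_frame :
  submersion_frame (fun y => tau^-1 *: comp2 (bundle_metric proj sigma g a b) c y)
    (bundle_frame eps) total_map (base_metric gg beta) base_twist x0.
Proof.
have img := nbhs_singleton near_base_img.
have fr (A : 'M[R]_1) (B : 'M[R]_N) y :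
    bundle_frame eps y *m block_mx A 0 0 B *m (bundle_frame eps y)^T =
    (eps *: comp1 sigma c y) *m A *m (eps *: comp1 sigma c y)^T +
    total_jac y *m B *m (total_jac y)^T.
  rewrite /bundle_frame mul_row_block !mulmx0 addr0 add0r tr_row_mx.
  by rewrite mul_row_col.
split.
- apply: filterS (comp2_bundle_metric a b) => y ->.
  rewrite /frame_metric fr /base_metric total_jac_bdiag scalerDr; congr (_ + _).
    rewrite mulmx1 [(eps *: _)^T]linearZ /= -scalemxAl -scalemxAr !scalerA; congr (_ *: _).
    by rewrite -epsE expr2.
  rewrite scaler_sumr; apply: eq_bigr => i _.
  by rewrite scalerA -betaE total_map_sel -scalemxAr -scalemxAl.
- exact: mCk_bundle_frame.
- exact: bundle_frame_unit.
- exact: mCk_total_map.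
- move=> i mu; apply: filterS (total_jacE i mu) => y <-.
  by rewrite /bundle_frame row_mxEr.
- move=> i j; near=> y.
  have cy : chart_img c y by near: y; exact: near_chart_img.
  have cfE : comp2 (curvature_form proj q (fun i => kahler_form (@g i))) c y =
    \sum_i (q i)%:~R *: (base_jac i y *m
      (J0 *m comp2 (@g i) (cc i) (base_map i y)) *m (base_jac i y)^T).
    by near: y; exact: comp2_curvature_form.
  have cs : mCk 1 (comp1 sigma c) y.
    by near: y; exact/mCk_near_mCk/mCk_connection.
  have pE k l : mpartial k (bundle_frame eps) y l 0 =
      eps * partial k (fun y => comp1 sigma c y l 0) y.
    rewrite mpartialE.
    transitivity (partial k (fun y => eps * comp1 sigma c y l 0) y).
      apply: near_eq_partial; near=> w.
      have -> : 0 = lshift N 0 :> 'I_(1 + N) by apply/val_inj.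
      by rewrite /bundle_frame row_mxEl mxE.
    rewrite partialM; [|exact: differentiable_cst|exact: Ck_differentiable (cs l 0)].
    by rewrite partial_cst mul0r add0r.
  rewrite !pE -mulrBr (dsigma ac cy) cfE /frame_torsion fr mulmx0 mul0mx add0r.
  rewrite base_twist_metric bdiagZ total_jac_bdiag !summxE mulr_sumr.
  apply: eq_bigr => k _; rewrite total_map_sel -scalemxAr -scalemxAl -scalemxAr -scalemxAl.
  rewrite scalerA [in LHS]mxE [in RHS]mxE mulrA; congr (_ * _); by field.
- apply: (@mCk_base_metric R m e gg) => i.
  apply: (mCk_comp2 (rg i)) => //; exact: img.
- have [] // := @bdiag_inv R m e (fun i => beta i *: gg i (total_map x0 *m sel i)).
  move=> i; rewrite unitmxZ ?unitfE //; exact: comp2_metric_unit (img i).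
- near=> z; rewrite bdiag_tr; apply: eq_bdiag => i.
  by rewrite linearZ /= comp2_metric_sym.
- apply: filterS near_base_img => z zi; rewrite base_twist_metric bdiag_tr bdiagN.
  apply: eq_bdiag => i; rewrite linearZ /= -scalerN; congr (_ *: _).
  exact: kahler_form_antisym (zi i).
Unshelve. all: by end_near. Qed.

Lemma bundle_Rm_norm : Rm_norm (bundle_metric proj sigma g a b) p =
  tau^-1 * Num.sqrt (rmnorm2 (frame_metric (base_metric gg beta) (total_map x0))
    (fun k l => frame_curv (base_metric gg beta) base_twist k l (total_map x0))).
Proof.
have sf := bundle_submersion_frame.
have := curvature_normZ tau0 (submersion_metric_unit sf)
  (mCkS (submersion_metric_Ck sf)) (submersion_metric_sym sf).
rewrite (submersion_curvature_norm sf) => <-.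
rewrite /Rm_norm -/c; congr (curvature_norm _ x0); apply/funext => y.
by rewrite scalerA mulfV ?gt_eqF // scale1r.
Qed.

End Scaled.

End BundleChart.

(** * Curvature bounds uniform in the point and the time *)

Lemma near_all_fin2 {R : realType} {T : topologicalType} (I : finType)
    (P : I -> T -> R -> Prop) (x : T) :
  (forall i, \forall y \near x & C \near +oo, P i y C) ->
  \forall y \near x & C \near +oo, forall i, P i y C.
Proof.
move=> h; have FF : Filter (filter_prod (nbhs x) (pinfty_nbhs R)) by typeclasses eauto.
exact: (@filter_forall _ _ (fun i (z : T * R) => P i z.1 z.2) _ FF h).
Qed.

Section CompactBounds.
Context {R : realType} {d : nat} {M : manifold R d}.
Variable g : M -> 'M[R]_d.
Hypothesis rg : riemannian_metric g.

Definition chart_bound (C : R) (c : chart R d M) (z : 'rV[R]_d) : Prop :=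
  [/\ forall j k, `|comp2 g c z j k| <= C,
      forall j k, `|invmx (comp2 g c z) j k| <= C,
      forall l j k, `|mpartial l (comp2 g c) z j k| <= C &
      forall l l' j k, `|mpartial l (mpartial l' (comp2 g c)) z j k| <= C].

Lemma compact_chart_bound : compact [set: M] ->
  exists C, forall p : M, exists c, [/\ atlas c, chart_dom c p & chart_bound C c (chart_map c p)].
Proof.
move=> /compact_near_coveringP cM.
pose Q (C : R) (p : M) := exists c, [/\ atlas c, chart_dom c p & chart_bound C c (chart_map c p)].
(* Near covering along C tending to infinity: if each point has a neighbourhood on which all large C
   are valid bounds, one C is valid on M. *)
suff : \forall C \near +oo, [set: M] `<=` Q C.
  by move=> /filter_ex [C QC]; exists C => p; exact: QC.
apply: cM => p0 _; pose c := chart_at p0; pose z0 := chart_map c p0.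
have ac : atlas c by exact: chart_at_atlas.
have cp0 : chart_dom c p0 by exact: chart_at_dom.
have cz0 : chart_img c z0 by exact: chart_map_img.
have loc (f : 'rV[R]_d -> R) : differentiable f z0 ->
    \forall p \near p0 & C \near +oo, `|f (chart_map c p)| <= C.
  move=> /differentiable_continuous cf.
  have cfc : {for p0, continuous (fun p => f (chart_map c p))}.
    by apply: (@continuous_comp _ _ _ (chart_map c) f) => //; exact: chart_map_continuous.
  exists ([set p | `|f (chart_map c p)| <= `|f z0| + 1], [set C | `|f z0| + 1 <= C]).
    split => /=; last exact: nbhs_pinfty_ge.
    have /(_ _ _ ltr01) := (cvgrPdist_le _ _).1 cfc; apply: filterS => p /= h.
    by rewrite -lerBlDl (le_trans _ h) // distrC lerB_dist.
  by move=> [p C] /= [h1 h2]; exact: le_trans h1 h2.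
have cG : mCk 3 (comp2 g c) z0 by exact: mCk_comp2.
have uG : comp2 g c z0 \in unitmx by exact: comp2_metric_unit.
have near_entry (A : 'rV[R]_d -> 'M[R]_d) : mCk 1 A z0 ->
    \forall p \near p0 & C \near +oo, forall j k, `|A (chart_map c p) j k| <= C.
  move=> cA; apply: near_all_fin2 => j; apply: near_all_fin2 => k.
  exact: (loc (fun z => A z j k) (Ck_differentiable (cA j k))).
have n1 := near_entry _ (mCkS (mCkS cG)).
have n2 := near_entry _ (mCk_inv uG (mCkS (mCkS cG))).
have n3 l := near_entry _ (mCkS (mCk_mpartial l cG)).
have n4 l l' := near_entry _ (mCk_mpartial l (mCk_mpartial l' cG)).
have n5 : \forall p \near p0 & C \near (+oo : set_system R), chart_dom c p.
  exists (chart_dom c, setT) => /=; last by move=> [p C] [].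
  split; last exact: filterT.
  by apply: open_nbhs_nbhs; split => //; exact: chart_dom_open.
have n3' : \forall p \near p0 & C \near +oo, forall l j k,
   `|mpartial l (comp2 g c) (chart_map c p) j k| <= C by apply: near_all_fin2 => l; exact: n3.
have n4' : \forall p \near p0 & C \near +oo, forall l l' j k,
   `|mpartial l (mpartial l' (comp2 g c)) (chart_map c p) j k| <= C.
  by apply: near_all_fin2 => l; apply: near_all_fin2 => l'; exact: n4.
have FF : Filter (filter_prod (nbhs p0) (pinfty_nbhs R)) by typeclasses eauto.
have n6 := @filterI _ _ FF _ _ (@filterI _ _ FF _ _ n1 n2) (@filterI _ _ FF _ _ n3' n4').
apply: (@filterS _ _ FF) (@filterI _ _ FF _ _ n6 n5) => -[p C] /= [[[h1 h2] [h3 h4]] h5].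
by exists c; split.
Qed.

End CompactBounds.

Section BundleBound.
Context {R : realType} {m : nat} {n : 'I_m -> nat}.
Local Notation e := (fun i => (n i + n i)%N).
Local Notation N := (\sum_(i < m) (n i + n i))%N.
Context {M : forall i, manifold R (n i + n i)} {P : manifold R (1 + N)}.
Variables (g : forall i, M i -> 'M[R]_(n i + n i)) (act : R -> P -> P)
  (proj : forall i, P -> M i) (sigma : P -> 'cV[R]_(1 + N)) (q : 'I_m -> int).
Hypotheses (rg : forall i, riemannian_metric (@g i))
  (hol : forall i, holomorphic_atlas (M i))
  (herm : forall i x, J0 *m @g i x *m J0^T = @g i x)
  (cpt : forall i, compact [set: M i])
  (bdl : principal_circle_bundle act proj)
  (cnx : principal_connection act sigma)
  (dsigma : exterior_derivative_is sigma
    (curvature_form proj q (fun i => kahler_form (@g i)))).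

(** [bundle_Rm_norm] allows any charts of the M_i around the projections of the point, so those of
    [compact_chart_bound] can be taken; the uniform bounds are then applied over all pairs of a time
    and a point. *)
Lemma bundle_Rm_bound (a : R -> R) (b : R -> 'I_m -> R) (T0 c C : R) :
  0 < T0 -> 0 < c ->
  (forall t, T0 <= t -> 0 < a t <= t) ->
  (forall t, T0 <= t -> forall i, c * t <= b t i <= C * t) ->
  exists K, forall t, T0 <= t -> forall p,
    Rm_norm (bundle_metric proj sigma g (a t) (b t)) p <= K / t.
Proof.
move=> T00 c0 at_ bt.
have chP i : exists Cch : R * (M i -> chart R (n i + n i) (M i)), forall p : M i,
    [/\ atlas (Cch.2 p), chart_dom (Cch.2 p) p &
        chart_bound (@g i) Cch.1 (Cch.2 p) (chart_map (Cch.2 p) p)].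
  have [K KP] := compact_chart_bound (rg i) (@cpt i).
  exists (K, fun p : M i => projT1 (cid (KP p))) => p.
  exact: projT2 (cid (KP p)).
pose K i := (projT1 (cid (chP i))).1.
pose ch i := (projT1 (cid (chP i))).2.
have acc p i : atlas (ch i (proj i p)) by have [] := projT2 (cid (chP i)) (proj i p).
have ccp p i : chart_dom (ch i (proj i p)) (proj i p).
  by have [] := projT2 (cid (chP i)) (proj i p).
have cbd p i : chart_bound (@g i) (K i) (ch i (proj i p)) (chart_map (ch i (proj i p)) (proj i p)).
  by have [] := projT2 (cid (chP i)) (proj i p).
pose cc p i := ch i (proj i p).
pose I : Type := (R * P)%type.
pose Pr (t : I) := T0 <= t.1.
pose eps (t : R) := Num.sqrt (t^-1 * a t).
pose beta (t : R) i := t^-1 * b t i.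
pose gg (p : P) := (fun i => comp2 (@g i) (cc p i)).
pose z p := total_map proj p (cc p) (Defs.coord p).
pose h (t : I) := base_metric (gg t.2) (beta t.1).
pose Z (t : I) : 'M[R]_N := base_twist q (eps t.1) (beta t.1).
have t0 t : T0 <= t -> 0 < t by exact: lt_le_trans.
have eps0 t : T0 <= t -> 0 < eps t.
  move=> tt; have /andP[a0 _] := at_ _ tt; have tp := t0 t tt.
  by rewrite /eps sqrtr_gt0 mulr_gt0 ?invr_gt0.
have eps1 t : T0 <= t -> eps t <= 1.
  move=> tt; have /andP[a0 al] := at_ _ tt; have tp := t0 t tt.
  by rewrite /eps -[leRHS]sqrtr1 ler_sqrt ?ltr01 // mulrC ler_pdivrMr // mul1r.
have epsE t : T0 <= t -> eps t ^+ 2 = t^-1 * a t.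
  move=> tt; have /andP[a0 _] := at_ _ tt; have tp := t0 t tt.
  by rewrite /eps sqr_sqrtr // ltW // mulr_gt0 ?invr_gt0.
have betac t i : T0 <= t -> c <= beta t i <= C.
  move=> tt; have /andP[b1 b2] := bt _ tt i; have tp := t0 t tt.
  by rewrite /beta mulrC ler_pdivlMr // ler_pdivrMr // b1 b2.
have beta0 t i : T0 <= t -> 0 < beta t i.
  by move=> tt; have /andP[b1 _] := betac t i tt; exact: lt_le_trans b1.
have sf (t : I) : Pr t -> submersion_frame
    (fun y => t.1^-1 *: comp2 (bundle_metric proj sigma g (a t.1) (b t.1)) (chart_at t.2) y)
    (bundle_frame proj sigma t.2 (cc t.2) (eps t.1)) (total_map proj t.2 (cc t.2))
    (h t) (Z t) (Defs.coord t.2).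
  move=> tt; apply: (bundle_submersion_frame rg hol herm bdl cnx dsigma
    (acc t.2) (ccp t.2)) => //.
  - by rewrite gt_eqF ?eps0.
  - exact: epsE.
  - by move=> i; rewrite gt_eqF ?beta0.
have zE p i : z p *m sel i = chart_map (cc p i) (proj i p).
  by rewrite total_map_sel /base_map coordK.
have img p i : chart_img (cc p i) (z p *m sel i).
  by rewrite zE; apply: chart_map_img; exact: ccp.
have cg k p i : mCk k (gg p i) (z p *m sel i).
  exact: (mCk_comp2 (rg i) k (acc p i) (img p i)).
have ug p i : gg p i (z p *m sel i) \in unitmx.
  exact: (comp2_metric_unit (rg i) (acc p i) (img p i)).
have ubeta i : ubr Pr (fun t => beta t.1 i).
  exists C => t tt; have /andP[_ b2] := betac t.1 i tt.
  by rewrite ger0_norm // ltW //; exact: beta0.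
have ubetaV i : ubr Pr (fun t => (beta t.1 i)^-1).
  exists c^-1 => t tt; have /andP[b1 _] := betac t.1 i tt.
  have bp := beta0 t.1 i tt.
  rewrite ger0_norm; last by rewrite invr_ge0 ltW.
  by rewrite lef_pV2 ?posrE.
have ueps : ubr Pr (fun t => eps t.1).
  by exists 1 => t tt; rewrite ger0_norm ?eps1 // ltW //; exact: eps0.
have bg i : ubm Pr (fun t => gg t.2 i (z t.2 *m sel i)).
  by exists (K i) => t _ j k; rewrite zE; have [+ _ _ _] := cbd t.2 i; exact.
have bgI i : ubm Pr (fun t => invmx (gg t.2 i (z t.2 *m sel i))).
  by exists (K i) => t _ j k; rewrite zE; have [_ + _ _] := cbd t.2 i; exact.
have bdg i l : ubm Pr (fun t => mpartial l (gg t.2 i) (z t.2 *m sel i)).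
  by exists (K i) => t _ j k; rewrite zE; have [_ _ + _] := cbd t.2 i; exact.
have bddg i l l' : ubm Pr (fun t => mpartial l (mpartial l' (gg t.2 i)) (z t.2 *m sel i)).
  by exists (K i) => t _ j k; rewrite zE; have [_ _ _ +] := cbd t.2 i; exact.
have [B BP] : ubr Pr (fun t => rmnorm2 (frame_metric (h t) (z t.2))
    (fun k l => frame_curv (h t) (Z t) k l (z t.2))).
  apply: ubr_frame_rmnorm2.
  - by move=> t tt; exact: sf_base_Ck (sf t tt).
  - by move=> t tt; exact: sf_base_unit (sf t tt).
  - by move=> t tt; exact: sf_base_sym (sf t tt).
  - by apply: ubm_bdiag => i; exact: ubmZ.
  - apply: (@eq_ubm _ _ _ _ _ _ (fun t =>
      bdiag (fun i => (beta t.1 i)^-1 *: invmx (gg t.2 i (z t.2 *m sel i))))).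
      move=> t tt; rewrite /h /base_metric.
      have [|_ ->] := @bdiag_inv R m e (fun i => beta t.1 i *: gg t.2 i (z t.2 *m sel i)).
        by move=> i; rewrite unitmxZ ?unitfE ?gt_eqF ?beta0.
      apply: eq_bdiag => i; rewrite invmxZ // unitmxZ //.
      by rewrite unitfE gt_eqF ?beta0.
    by apply: ubm_bdiag => i; exact: ubmZ.
  - move=> mu; apply: (@eq_ubm _ _ _ _ _ _ (fun t => bdiag (fun i => beta t.1 i *:
       \sum_k sel i mu k *: mpartial k (gg t.2 i) (z t.2 *m sel i)))).
      by move=> t tt; exact: mpartial_base_metric.
    apply: ubm_bdiag => i; apply: ubmZ => //; apply: ubm_sum => k _.
    by apply: ubmZ => //; exact: ubr_cst.
  - move=> nu mu; apply: (@eq_ubm _ _ _ _ _ _ (fun t => bdiag (fun i => beta t.1 i *: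
       \sum_l sel i nu l *: \sum_k sel i mu k *:
         mpartial l (mpartial k (gg t.2 i)) (z t.2 *m sel i)))).
      by move=> t tt; exact: mpartial2_base_metric.
    apply: ubm_bdiag => i; apply: ubmZ => //; apply: ubm_sum => l _.
    apply: ubmZ; first exact: ubr_cst.
    apply: ubm_sum => k _; by apply: ubmZ => //; exact: ubr_cst.
  - apply: ubm_bdiag => i; apply: ubmZ; last exact: ubm_cst.
    apply: (@eq_ubr _ _ _ _ (fun t => eps t.1 * (q i)%:~R * (2^-1 * (beta t.1 i)^-1))).
      by move=> t tt; rewrite invfM.
    apply: ubrM; first by apply: ubrM => //; exact: ubr_cst.
    by apply: ubrM => //; exact: ubr_cst.
exists (Num.sqrt B) => t tt p.
rewrite (bundle_Rm_norm rg hol herm bdl cnx dsigma (acc p) (ccp p) (t0 t tt)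
  _ (epsE t tt) (fun i => erefl (beta t i))).
- rewrite mulrC ler_pM2r ?invr_gt0; last exact: t0.
  rewrite ler_wsqrtr //.
  exact: le_trans (ler_norm _) (BP (t, p) tt).
- by rewrite gt_eqF ?eps0.
- by move=> i; rewrite gt_eqF ?beta0.
Qed.

End BundleBound.

(** * Asymptotics of the flow *)

(* No measurability is needed: the integral of a nonnegative function is a
   supremum over the simple functions below it. *)
Lemma integral_mono d (T : measurableType d) (R : realType)
    (mu : {measure set T -> \bar R}) (D : set T) (f g : T -> \bar R) :
  (forall x, D x -> 0 <= f x)%E -> (forall x, D x -> f x <= g x)%E ->
  (\int[mu]_(x in D) f x <= \int[mu]_(x in D) g x)%E.
Proof.
move=> f0 fg; rewrite !ge0_integralE //; last first.
  by move=> x Dx; exact: le_trans (f0 _ Dx) (fg _ Dx).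
apply: le_ereal_sup => _ [h hf <-]; exists h => // x.
by apply: le_trans (hf x) _; exact: lee_restrict.
Qed.

(** The comparison is made for the extended integral, whose finiteness it also yields, and is then
    transferred to the real one. *)
Lemma Rintegral_itv_bound (R : realType) (f : R -> R) (u K : R) : 0 <= u ->
  (forall x, 0 <= x <= u -> 0 <= f x <= K) ->
  0 <= Rintegral lebesgue_measure `[0, u] f <= K * u.
Proof.
move=> u0 fK; apply/andP; split.
  by apply: Rintegral_ge0 => x /=; rewrite in_itv /= => /fK/andP[].
have le : (\int[lebesgue_measure]_(x in `[0%R, u]) (f x)%:E <= (K * u)%:E)%E.
  have -> : ((K * u)%:E = \int[lebesgue_measure]_(x in `[0%R, u]) (cst K%:E x))%E.
    rewrite integral_cst //= lebesgue_measure_itv /= lte_fin.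
    have [->|u00] := eqVneq u 0; first by rewrite ltxx mulr0 mule0.
    by rewrite lt_neqAle eq_sym u00 u0 /= sube0.
  apply: integral_mono => x /=; rewrite in_itv /= => /fK/andP[]; by rewrite !lee_fin.
rewrite /Rintegral.
have ge : (0 <= \int[lebesgue_measure]_(x in `[0%R, u]) (f x)%:E)%E.
  by apply: integral_ge0 => x /=; rewrite in_itv /= => /fK/andP[]; rewrite lee_fin.
by rewrite -lee_fin fineK // ge0_fin_numE // (le_lt_trans le) // ltry.
Qed.

Lemma itv_bounded (R : realType) (f : R -> R) (u : R) : 0 < u ->
  f @ (0 : R)^'+ --> f 0 -> (forall x, 0 < x -> derivable f x 1) ->
  exists K, forall x, 0 <= x <= u -> `|f x| <= K.
Proof.
move=> u0 f0 df.
have cf x : 0 < x -> {for x, continuous f}.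
  by move=> x0; apply: differentiable_continuous; apply/derivable1_diffP/df.
have cont : {within `[0, u], continuous f}.
  apply/continuous_within_itvP => //; split => //.
    by move=> x; rewrite in_itv /= => /andP[x0 _]; exact: cf.
  by apply: cvg_at_left_filter; exact: cf.
have [M _ hM] := EVT_max (ltW u0) cont.
have [m _ hm] := EVT_min (ltW u0) cont.
exists (`|f M| + `|f m|) => x xu.
have /hM h1 : x \in `[0, u]%R by rewrite in_itv.
have /hm h2 : x \in `[0, u]%R by rewrite in_itv.
rewrite ler_norml; apply/andP; split.
  rewrite lerNl (le_trans _ (_ : - f m <= _)) ?lerN2 //.
  by rewrite (le_trans (ler_norm _)) // normrN lerDr.
by rewrite (le_trans h1) // (le_trans (ler_norm _)) // lerDl.
Qed.

Section FlowAsymptotics.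
Context {R : realType} {m : nat}.
Variables (n p : 'I_m -> nat) (q : 'I_m -> int) (c0 a0 : R) (Y : R -> 'I_m -> R)
  (a : R -> R) (b : R -> 'I_m -> R).
Hypotheses (m0 : (0 < m)%N) (p0 : forall i, (0 < p i)%N)
  (sd : small_data_constant n p q c0) (YS : Y_solution n p q Y)
  (Y0 : forall u, 0 <= u -> forall i, 0 < Y u i) (Yc : \sum_i Y 0 i <= c0)
  (a00 : 0 < a0) (cor : corresponding n q a0 Y a b).

Let anc : ancient_solution n p q a b.
Proof.
have [_ /(_ Y YS _ Yc)] := sd.
case=> [u u0 i|_]; first exact/ltW/Y0.
by move=> /(_ Y0 a0 a b a00 cor) [].
Qed.

Lemma flow_pos t : 0 <= t -> 0 < a t /\ forall i, 0 < b t i.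
Proof. by move=> t0; have [/(_ t t0)] := anc. Qed.

Lemma E_ge0 (y : 'I_m -> R) : 0 <= E n q y.
Proof. by apply: sumr_ge0 => i _; rewrite mulr_ge0 ?sqr_ge0 // mulr_ge0 ?sqr_ge0. Qed.

(** Large tau forces large u; this converts the limit of Y as u tends to infinity into a statement
    about tau. *)
Lemma tau_bounded U : 0 < U -> exists B, forall u, 0 <= u <= U -> tau_of_u n q a0 Y u <= B.
Proof.
move=> U0.
have YB i : exists K, forall x, 0 <= x <= U -> `|Y x i| <= K.
  have [c dY] := YS i; apply: (@itv_bounded _ (Y^~ i)) => // x x0.
  by have [] := dY x x0.
pose K i := projT1 (cid (YB i)).
have KP i x : 0 <= x <= U -> `|Y x i| <= K i := projT2 (cid (YB i)) x.
pose KE := \sum_i (n i)%:R * (q i)%:~R ^+ 2 * K i ^+ 2.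
have EB x : 0 <= x <= U -> 0 <= E n q (Y x) <= KE.
  move=> xU; rewrite E_ge0 /=; apply: ler_sum => i _.
  apply: ler_wpM2l; first by apply: mulr_ge0 => //; exact: sqr_ge0.
  have K0 : 0 <= K i by exact: le_trans (KP i x xU).
  by rewrite -[Y x i ^+ 2]ger0_norm ?sqr_ge0 // normrX ler_pXn2r ?nnegrE // KP.
have KE0 : 0 <= KE.
  have U00 : 0 <= (0 : R) <= U by rewrite lexx ltW.
  by have /andP[e0 e1] := EB 0 U00; exact: le_trans e1.
have aB x : 0 <= x <= U -> 0 <= a_of_u n q a0 Y x <= a0 * expR (KE * U).
  move=> /andP[x0 xU]; rewrite /a_of_u mulr_ge0 ?expR_ge0 ?(ltW a00) //=.
  rewrite ler_wpM2l ?(ltW a00) // ler_expR.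
  (* Two nested estimates: E is bounded on [0, U], so a is, and then its integral tau. *)
  have /andP[_ h] : 0 <= Rintegral lebesgue_measure `[0, x] (fun z => E n q (Y z)) <= KE * x.
    apply: Rintegral_itv_bound => // z /andP[z0 zx]; apply: EB.
    by rewrite z0 (le_trans zx).
  by rewrite (le_trans h) // ler_wpM2l.
exists (a0 * expR (KE * U) * U) => u /andP[u0 uU].
have /andP[_ h] : 0 <= tau_of_u n q a0 Y u <= a0 * expR (KE * U) * u.
  apply: Rintegral_itv_bound => // z /andP[z0 zx]; apply: aB.
  by rewrite z0 (le_trans zx).
by rewrite (le_trans h) // ler_wpM2l // mulr_ge0 ?expR_ge0 // ltW.
Qed.

(** At the time tau(u) the ratio is Y_i(u), and every time is attained. *)
Lemma flow_ratio_cvg0 (eps : R) : 0 < eps ->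
  exists2 T, 0 < T & forall t, T <= t -> forall i, a t / b t i <= eps.
Proof.
move=> e0.
have [_ /(_ Y YS _ Yc)] := sd.
case=> [u u0 i|Yl]; first exact/ltW/Y0.
move=> /(_ Y0 a0 a b a00 cor) [surj _].
have YU : \forall u \near +oo, forall i, Y u i <= eps.
  apply: (@filter_forall _ _ (fun i u => Y u i <= eps)) => i.
  have /cvgrPdist_le /(_ _ e0) := Yl i.
  apply: filterS => u; rewrite sub0r normrN; exact: le_trans (ler_norm _).
have [U [Ur hU]] := YU.
pose U' := Num.max 1 (U + 1).
have U'0 : 0 < U' by rewrite lt_max ltr01.
have [B hB] := tau_bounded U'0.
exists (Num.max 1 (B + 1)); first by rewrite lt_max ltr01.
move=> t; rewrite ge_max => /andP[t1 tB] i.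
have [u u0 tauE] := surj t (le_trans ler01 t1).
have uU : U < u.
  rewrite ltNge; apply/negP => uU; have : t <= B.
    rewrite -tauE hB // u0 /= le_max; apply/orP; right.
    by apply: le_trans uU _; rewrite lerDl.
  by move=> /(le_trans tB); rewrite gerDl ler10.
have [aE bE] := cor u0; rewrite -tauE aE bE invfM invrK mulrA.
have au0 : 0 < a_of_u n q a0 Y u by rewrite mulr_gt0 ?expR_gt0.
by rewrite divff ?gt_eqF // mul1r; exact: hU.
Qed.

Lemma flow_growth : exists T0 c C : R, [/\ 0 < T0, 0 < c &
  forall t, T0 <= t -> forall i, c * t <= b t i <= C * t].
Proof.
pose Q := \sum_i ((q i)%:~R ^+ 2 : R).
have Q0 : 0 <= Q by apply: sumr_ge0 => i _; rewrite sqr_ge0.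
(* With this threshold q_i^2 a / b_i is at most 1, so the derivative of b_i is at least 2 p_i - 1,
   hence at least 1. *)
have [T T0 hT] := @flow_ratio_cvg0 (Q + 1)^-1 ltac:(by rewrite invr_gt0 ltr_wpDl).
have [pos _ ode] := anc.
have db t i : T <= t -> 1 <= 2 * (p i)%:R - (q i)%:~R ^+ 2 * (a t / b t i) <= 2 * (p i)%:R.
  move=> Tt; have t0 : 0 <= t by rewrite ltW // (lt_le_trans T0).
  have [at0 /(_ i) bt0] := pos t t0.
  have r0 : 0 <= a t / b t i by rewrite divr_ge0 // ltW.
  have qQ : (q i)%:~R ^+ 2 <= Q :> R.
    by rewrite /Q (bigD1 i) //= lerDl sumr_ge0 // => j _; rewrite sqr_ge0.
  have h1 : (q i)%:~R ^+ 2 * (a t / b t i) <= 1.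
    apply: (@le_trans _ _ (Q * (Q + 1)^-1)).
      by apply: ler_pM => //; [rewrite sqr_ge0|exact: hT].
    by rewrite ler_pdivrMr ?mul1r ?lerDl // ltr_wpDl.
  have h2 : 0 <= (q i)%:~R ^+ 2 * (a t / b t i) by rewrite mulr_ge0 ?sqr_ge0.
  have h3 : 1 <= (p i)%:R :> R by rewrite ler1n p0.
  apply/andP; split; lra.
have bt t i : T < t -> t - T <= b t i - b T i <= 2 * (p i)%:R * (t - T).
  move=> Tt.
  have der x : T <= x -> is_derive x 1 (b^~ i)
      (2 * (p i)%:R - (q i)%:~R ^+ 2 * (a x / b x i)).
    by move=> Tx; have [_] := ode x (lt_le_trans T0 Tx); apply.
  have [x] : exists2 x, x \in `]T, t[%R & b t i - b T i =
      (2 * (p i)%:R - (q i)%:~R ^+ 2 * (a x / b x i)) * (t - T).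
    apply: (MVT Tt (f := b^~ i)).
      by move=> x; rewrite in_itv /= => /andP[Tx _]; exact/der/ltW.
    apply: derivable_within_continuous => x; rewrite in_itv /= => /andP[Tx _].
    by have [] := der x Tx.
  rewrite in_itv /= => /andP[Tx _] ->.
  have /andP[d1 d2] := db x i (ltW Tx).
  have tT : 0 < t - T by rewrite subr_gt0.
  by rewrite -{1}[t - T]mul1r !ler_pM2r // d1 d2.
(* From t >= 2 T follows t - T >= t / 2, and from t >= 1 the initial value b T i is at most b T i *
   t. Summing over i gives one constant for all factors. *)
exists (2 * T + 1), 2^-1, (\sum_i (b T i + 2 * (p i)%:R)); split => //.
- by rewrite addr_gt0 // mulr_gt0.
move=> t Tt i; have Tlt : T < t by lra.
have /andP[h1 h2] := bt t i Tlt.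
have [_ bpos] := pos T (ltW T0); have bTi := bpos i.
apply/andP; split; first lra.
have t1 : 1 <= t by lra.
have h3 : b T i + 2 * (p i)%:R <= \sum_i (b T i + 2 * (p i)%:R).
  rewrite [leRHS](bigD1 i) //= lerDl sumr_ge0 // => j _.
  by rewrite addr_ge0 // ltW.
have t0 : 0 <= t by lra.
apply: le_trans (ler_wpM2r t0 h3).
have h4 : b T i <= b T i * t by rewrite ler_peMr // ltW.
have h5 : 2 * (p i)%:R * (t - T) <= 2 * (p i)%:R * t.
  by rewrite ler_wpM2l ?mulr_ge0 // gerBl ltW.
lra.
Qed.

(** Write a = (a / b_i) b_i for one factor i, which exists as m > 0: the ratio is small and b_i
    grows at most linearly. *)
Lemma flow_fibre_cvg0 (eps : R) : 0 < eps ->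
  exists2 T, 0 < T & forall t, T <= t -> a t <= eps * t.
Proof.
move=> e0; have [T1 [c [C [T10 cpos hT1]]]] := flow_growth.
pose i0 := Ordinal m0.
pose C' := Num.max 1 C.
have C'0 : 0 < C' by rewrite lt_max ltr01.
have [T2 T20 hT2] := flow_ratio_cvg0 (divr_gt0 e0 C'0).
exists (Num.max T1 T2); first by rewrite lt_max T10.
move=> t; rewrite ge_max => /andP[tT1 tT2].
have t0 : 0 < t by exact: lt_le_trans tT1.
have [at0 /(_ i0) bt0] := flow_pos (ltW t0).
have /andP[_ h1] := hT1 t tT1 i0.
have h2 := hT2 t tT2 i0.
have : a t <= eps / C' * b t i0 by rewrite -ler_pdivrMr.
move=> /le_trans; apply.
apply: (@le_trans _ _ (eps / C' * (C' * t))); last by rewrite mulrA divfK ?gt_eqF.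
rewrite ler_wpM2l ?(ltW (divr_gt0 e0 C'0)) // (le_trans h1) // ler_wpM2r ?(ltW t0) //.
by rewrite le_max lexx orbT.
Qed.

End FlowAsymptotics.

(** * Compactness of the bundle *)

Section OpenMap.
Context {R : realType} {N : nat}.
Implicit Types (psi : 'rV[R]_N -> 'rV[R]_N).

Lemma norm_entry (v : 'rV[R]_N) k : `|v 0 k| <= `|v|.
Proof.
rewrite [leRHS]/Num.norm /= mx_normrE.
by apply: (le_trans _ (le_bigmax _ _ (0, k))).
Qed.

(** The norm on rows is the maximum norm; its differentiable substitute is the squared Euclidean
    norm, comparable to it by the next two lemmas. *)
Definition sqn (v : 'rV[R]_N) : R := \sum_k v 0 k ^+ 2.

Lemma sqn_le v (r : R) : `|v| <= r -> sqn v <= N%:R * r ^+ 2.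
Proof.
move=> vr; rewrite mulr_natl -[X in _ *+ X]card_ord -sumr_const.
apply: ler_sum => k _; rewrite -[v 0 k ^+ 2]ger0_norm ?sqr_ge0 // normrX.
have r0 : 0 <= r by exact: le_trans vr.
by rewrite ler_pXn2r ?nnegrE // (le_trans (norm_entry v k)).
Qed.

Lemma sqn_ge v : `|v| ^+ 2 <= sqn v.
Proof.
have s0 : 0 <= sqn v by apply: sumr_ge0 => k _; rewrite sqr_ge0.
have [->|/mx_norm_neq0[[a k] /= vE]] := eqVneq `|v| 0; first by rewrite expr0n.
have nE : `|v| = `|v 0 k| by move: vE; rewrite (ord1 a).
rewrite nE -normrX ger0_norm ?sqr_ge0 // /sqn (bigD1 k) //= lerDl sumr_ge0 // => j _.
by rewrite sqr_ge0.
Qed.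

(* The minimiser of v |-> |psi v - y|^2 over a small closed ball is interior, so
   its gradient (psi v - y) d psi^T vanishes there. *)
Lemma open_map_id psi (e : R) : 0 < e -> mCk 2 psi 0 ->
  (forall i k, partial i (fun y => psi y 0 k) 0 = (i == k)%:R) ->
  exists2 del, 0 < del & forall y, `|y - psi 0| < del -> exists2 v, `|v| < e & psi v = y.
Proof.
move=> e0 cpsi jpsi.
pose J (v : 'rV[R]_N) : 'M[R]_N := \matrix_(i, k) partial i (fun y => psi y 0 k) v.
have J0 : J 0 = 1%:M by apply/matrixP => i k; rewrite !mxE jpsi.
have cJ : mCk 1 J 0.
  move=> i k; apply: Ck_near (Ck_partial i (cpsi 0 k)).
  by near=> y; rewrite mxE.
have uJ : \forall v \near (0 : 'rV[R]_N), J v \in unitmx.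
  by apply: near_unitmx => //; rewrite J0 unitmx1.
have [r0 /= r00 hr0] := (nbhs_ballP _ _).1 (filterI uJ (mCk_near_mCk (mCkS cpsi))).
have d0 : differentiable psi 0.
  by apply: differentiable_row => k; exact: Ck_differentiable (cpsi 0 k).
have half0 : 0 < 2^-1 :> R by rewrite invr_gt0.
have [r1 r10 hr1] := differentiable_eps half0 d0.
pose r := Num.min e (Num.min r0 r1) / 2.
have min0 : 0 < Num.min e (Num.min r0 r1) by rewrite !lt_min e0 r00 r10.
have rpos : 0 < r by rewrite divr_gt0.
have rlt : r < Num.min e (Num.min r0 r1) by rewrite /r ltr_pdivrMr // ltr_pMr // ltr1n.
move: (rlt); rewrite !lt_min => /and3P[re rr0 rr1].
have est v : `|v| <= r -> `|psi v - psi 0 - v| <= 2^-1 * `|v|.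
  move=> vr; have := hr1 v (le_lt_trans vr rr1); rewrite addr0.
  have -> : 'd psi 0 v = v.
    rewrite -mul_rV_lin1 -[lin1_mx _]/(jacobian psi 0) jacobianE.
      by rewrite -[X in _ *m X]/(J 0) J0 mulmx1.
    by move=> k; exact: Ck_differentiable (cpsi 0 k).
  by [].
have good v : `|v| <= r -> J v \in unitmx /\ mCk 1 psi v.
  by move=> vr; apply: hr0; rewrite -ball_normE /= sub0r normrN (le_lt_trans vr).
have N10 : 0 < N%:R + 1 :> R by rewrite ltr_wpDl.
(* So that r / 2 = (N + 2) del. On the sphere of radius r, psi is then at distance at least (N + 1)
   del from y, and (N + 1)^2 del^2 exceeds N del^2, which bounds f at the centre: the minimum is
   interior. *)
pose del := r / (2 * (N%:R + 2)).
have N20 : 0 < 2 * (N%:R + 2) :> R by rewrite mulr_gt0 // ltr_wpDl.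
have del0 : 0 < del by rewrite divr_gt0.
exists del => // y ydel.
pose f v := sqn (psi v - y).
have fE v : f v = \sum_k (psi v 0 k - y 0 k) * (psi v 0 k - y 0 k).
  by apply: eq_bigr => k _; rewrite !mxE expr2.
have fd v : `|v| <= r -> differentiable f v.
  move=> /good[_ cv]; have -> : f = (fun v => \sum_k (psi v 0 k - y 0 k) * (psi v 0 k - y 0 k)).
    by apply/funext => w.
  apply: differentiable_bigsum => k _.
  have dk : differentiable (fun v => psi v 0 k - y 0 k) v.
    by apply: differentiableB; [exact: Ck_differentiable (cv 0 k)|exact: differentiable_cst].
  exact: differentiableM.
pose B := closed_ball_ Num.Def.normr (0 : 'rV[R]_N) r.
have BP v : B v <-> `|v| <= r by rewrite /B /closed_ball_ /= sub0r normrN.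
have cB : compact B.
  apply: bounded_closed_compact; last exact: closed_closed_ball_.
  exists r; split; first exact: num_real.
  by move=> M rM v /BP vr; apply: le_trans (ltW rM); exact: vr.
have B0 : B !=set0 by exists 0; apply/BP; rewrite normr0 ltW.
have fc : {within B, continuous f}.
  apply: continuous_in_subspaceT => v /set_mem /BP vr.
  by apply: differentiable_continuous; exact: fd.
have [v0 /set_mem /BP v0r vmin] := EVT_min_rV B0 cB fc.
have f0 : f v0 <= N%:R * del ^+ 2.
  apply: le_trans (vmin 0 _) _; first by apply/mem_set/BP; rewrite normr0 ltW.
  by apply: sqn_le; rewrite distrC ltW.
have v0lt : `|v0| < r.
  rewrite lt_neqAle v0r andbT; apply/eqP => v0E.
  have h1 : 2^-1 * r <= `|psi v0 - psi 0|.
    have := est v0 v0r; rewrite v0E => h.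
    have := ler_normB (psi v0 - psi 0) (psi v0 - psi 0 - v0).
    have -> : psi v0 - psi 0 - (psi v0 - psi 0 - v0) = v0 by rewrite opprB addrC subrK.
    rewrite v0E; lra.
  have h2 : `|psi v0 - psi 0| <= `|psi v0 - y| + `|y - psi 0|.
    by apply: le_trans (ler_normD _ _); rewrite addrA subrK.
  have rE : r = 2 * (N%:R + 2) * del by rewrite /del mulrC divfK // gt_eqF.
  have h3 : (N%:R + 1) * del <= `|psi v0 - y|.
    have h4 : 2^-1 * r = (N%:R + 2) * del by rewrite [in LHS]rE -mulrA mulKf // pnatr_eq0.
    have h5 : (N%:R + 2) * del = (N%:R + 1) * del + del by ring.
    lra.
  have h4 : ((N%:R + 1) * del) ^+ 2 <= f v0.
    apply: le_trans (sqn_ge _); rewrite ler_pXn2r ?nnegrE // mulr_ge0 // ltW //.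
  have h5 : ((N%:R + 1) * del) ^+ 2 = N%:R * del ^+ 2 + (N%:R ^+ 2 + N%:R + 1) * del ^+ 2 by ring.
  have h6 : 0 < (N%:R ^+ 2 + N%:R + 1) * del ^+ 2 :> R.
    by rewrite mulr_gt0 ?exprn_gt0 // ltr_wpDl // addr_ge0 ?sqr_ge0.
  lra.
have [uJ0 c0] := good v0 v0r.
have pf i : partial i f v0 = 0.
  pose s := r - `|v0|.
  have s0 : 0 < s by rewrite subr_gt0.
  have inB t : t \in `](- s), s[%R -> `|t *: delta_mx 0 i + v0| <= r.
    rewrite in_itv /= => ts; have tn : `|t| < s by rewrite ltr_norml.
    rewrite (le_trans (ler_normD _ _)) // normrZ.
    have : `|t| * `|delta_mx 0 i : 'rV[R]_N| <= `|t|.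
      by rewrite ler_piMr // norm_delta_mx.
    rewrite /s in tn; lra.
  have der t : t \in `](- s), s[%R -> is_derive t 1
     (fun t => f (t *: delta_mx 0 i + v0)) (partial i f (t *: delta_mx 0 i + v0)).
    by move=> ts; apply: is_derive_line; apply: fd; exact: inB.
  have z : 0 \in `](- s), s[%R by rewrite in_itv /= oppr_lt0 s0.
  have := @derive1_at_min R (fun t => f (t *: delta_mx 0 i + v0)) (- s) s 0.
  rewrite ge0_cp ?ltW // => /(_ isT) => h.
  have h0 : is_derive (0 : R) 1 (fun t => f (t *: delta_mx 0 i + v0)) 0.
    apply: h => // [t ts|t ts]; first by have [] := der t ts.
    by rewrite scale0r add0r; apply: vmin; apply/mem_set/BP/inB.
  have [_ e1] := h0; have [_ e2] := der 0 z.
  by move: e2; rewrite e1 scale0r add0r => <-.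
have J_eq : J v0 *m (psi v0 - y)^T = 0.
  apply/matrixP => i j; rewrite ord1 [RHS]mxE mxE.
  have : 2 * (\sum_k J v0 i k * (psi v0 - y)^T k 0) = 0.
    rewrite -[RHS](pf i).
    have dk k : differentiable (fun v => psi v 0 k - y 0 k) v0.
      by apply: differentiableB; [exact: Ck_differentiable (c0 0 k)|exact: differentiable_cst].
    have -> : partial i f v0 =
        partial i (fun v => \sum_k (psi v 0 k - y 0 k) * (psi v 0 k - y 0 k)) v0.
      by apply: near_eq_partial; near=> w; exact: fE.
    rewrite partial_sum; last by move=> k _; exact: differentiableM.
    rewrite mulr_sumr; apply: eq_bigr => k _; rewrite partialM //.
    rewrite partialB; [|exact: Ck_differentiable (c0 0 k)|exact: differentiable_cst].
    rewrite partial_cst subr0 !mxE; ring.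
  by move/eqP; rewrite mulf_eq0 pnatr_eq0 /= => /eqP.
exists v0; first exact: lt_trans v0lt re.
apply/eqP; rewrite -subr_eq0; apply/eqP.
apply: (can_inj trmxK); rewrite trmx0.
by rewrite -[LHS]mul1mx -(mulVmx uJ0) -mulmxA J_eq mulmx0.
Unshelve. all: by end_near. Qed.

End OpenMap.

(** On the affine slice x + v W the derivative of phi in v is the identity, which reduces the claim
    to [open_map_id]. *)
Lemma open_map_submersion {R : realType} {d N : nat} (phi : 'rV[R]_d -> 'rV[R]_N)
    (x : 'rV[R]_d) (W : 'M[R]_(N, d)) (A : set 'rV[R]_d) : mCk 2 phi x ->
  W *m (\matrix_(a, k) partial a (fun y => phi y 0 k) x) = 1%:M ->
  nbhs x A -> nbhs (phi x) (phi @` A).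
Proof.
move=> cphi WJ nA.
pose l (v : 'rV[R]_N) : 'rV[R]_d := x + v *m W.
have l0 : l 0 = x by rewrite /l mul0mx addr0.
have cl k v : mCk k l v.
  by apply: mCkD; [exact: mCk_cst|exact: mCk_linear].
have lA : \forall v \near (0 : 'rV[R]_N), A (l v).
  have : {for (0 : 'rV[R]_N), continuous l}.
    apply: differentiable_continuous; apply: differentiable_row => k.
    exact: Ck_differentiable (cl 1%N 0 0 k).
  by move=> c; apply: c; rewrite l0.
have [e /= e0 he] := (nbhs_ballP _ _).1 lA.
have [|i k|del del0 hdel] := @open_map_id R N (phi \o l) e e0.
- by apply: mCk_comp; rewrite ?l0.
- rewrite /= (@partial_chain _ _ _ i (fun v => phi v 0 k) l).
  + rewrite l0; transitivity ((W *m \matrix_(a, k) partial a (fun y => phi y 0 k) x) i k).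
      rewrite mxE; apply: eq_bigr => j _; rewrite mxE; congr (_ * _).
      have -> : (fun y => l y 0 j) = (fun y => x 0 j + (y *m W) 0 j).
        by apply/funext => y; rewrite mxE.
      rewrite partialD; first by rewrite partial_cst add0r partial_linear.
        exact: differentiable_cst.
      exact: Ck_differentiable (mCk_linear 1 W 0 0 j).
    by rewrite WJ mxE.
  + by rewrite l0; exact: Ck_differentiable (cphi 0 k).
  + by move=> j; exact: Ck_differentiable (cl 1%N 0 0 j).
apply/nbhs_ballP; exists del => //= y; rewrite -ball_normE /= => yd.
have [|v ve <-] := hdel y; first by rewrite /= l0 distrC.
exists (l v) => //; apply: he; by rewrite -ball_normE /= sub0r normrN.
Qed.

Lemma floor_remainder {R : realType} (s w : R) : 0 < w ->
  exists k : int, 0 <= s - w * k%:~R <= w.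
Proof.
move=> w0; exists (Num.floor (s / w)).
have /andP[] := real_floor_itv (num_real (s / w)).
rewrite ler_pdivlMr // ltr_pdivrMr // intrD mulr1z mulrDl mul1r => k1 k2.
by rewrite subr_ge0 mulrC k1 /= lerBlDl ltW.
Qed.

Section BundleCompact.
Context {R : realType} {m : nat} {n : 'I_m -> nat}.
Local Notation e := (fun i => (n i + n i)%N).
Local Notation N := (\sum_(i < m) (n i + n i))%N.
Context {M : forall i, manifold R (n i + n i)} {P : manifold R (1 + N)}.
Variables (act : R -> P -> P)
  (proj : forall i, P -> M i) (sigma : P -> 'cV[R]_(1 + N)).
Hypotheses (bdl : principal_circle_bundle act proj)
  (cnx : principal_connection act sigma).

(** Openness of the projection to the product, read in coordinates as openness of [total_map]. *)
Lemma bundle_proj_open (p : P) (A : set P) : nbhs p A ->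
  exists B : forall i, set (M i), (forall i, nbhs (proj i p) (B i)) /\
    forall x : forall i, M i, (forall i, B i (x i)) -> exists2 p', A p' & forall i, proj i p' = x i.
Proof.
move=> nA; pose c := chart_at p; pose x0 : 'rV[R]_(1 + N) := Defs.coord p.
pose cc i := chart_at (proj i p).
have acc i : atlas (cc i) by exact: chart_at_atlas.
have ccp i : chart_dom (cc i) (proj i p) by exact: chart_at_dom.
have ac : atlas c by exact: chart_at_atlas.
have cx0 : chart_img c x0 by exact: coord_img.
have inv_x0 : chart_inv c x0 = p by exact: coordK.
pose phi := total_map proj p cc.
have uT : bundle_frame proj sigma p cc 1 x0 \in unitmx.
  by apply: (bundle_frame_unit bdl cnx acc ccp); rewrite oner_eq0.
pose A' := [set y | [/\ chart_img c y, A (chart_inv c y) &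
  forall i, chart_dom (cc i) (proj i (chart_inv c y))]].
have nA' : nbhs x0 A'.
  have n1 := near_chart_img ac cx0.
  have n2 : \forall y \near x0, A (chart_inv c y).
    by have := chart_inv_continuous ac cx0; apply; rewrite inv_x0.
  have n3 := base_map_dom bdl acc ccp.
  near=> y; split; [near: y; exact: n1|near: y; exact: n2|near: y; exact: n3].
have cphi : mCk 2 phi x0 by exact: (mCk_total_map bdl acc ccp).
(* The lower rows of the inverse frame are lifts of the base coordinate vectors. *)
pose W : 'M[R]_(N, 1 + N) := dsubmx (invmx (bundle_frame proj sigma p cc 1 x0)).
have WJ : W *m (\matrix_(a, k) partial a (fun y => phi y 0 k) x0) = 1%:M.
  have -> : \matrix_(a, k) partial a (fun y => phi y 0 k) x0 =
      rsubmx (bundle_frame proj sigma p cc 1 x0).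
    rewrite /bundle_frame row_mxKr; apply/matrixP => a k; rewrite mxE.
    by rewrite (nbhs_singleton (total_jacE bdl acc ccp a k)).
  rewrite /W mulmx_rsub mul_dsub_mx mulVmx //.
  by rewrite scalar_mx_block -[LHS]/(drsubmx _) block_mxKdr.
have [del /= del0 hdel] := (nbhs_ballP _ _).1 (open_map_submersion cphi WJ nA').
pose lin i (q : M i) : 'rV[R]_N :=
  (chart_map (cc i) q - chart_map (cc i) (proj i p)) *m (@sel R m e i)^T.
have m10 : 0 < m%:R + 1 :> R by rewrite ltr_wpDl.
(* The m displacements add up to less than del; the added 1 also keeps the radius positive for m =
   0. *)
pose B i := [set q : M i | chart_dom (cc i) q /\ `|lin i q| < del / (m%:R + 1)].
exists B; split=> [i|x Bx].
  have n1 : \forall q \near proj i p, chart_dom (cc i) q.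
    by apply: open_nbhs_nbhs; split => //; exact: chart_dom_open.
  have n2 : \forall q \near proj i p, `|lin i q| < del / (m%:R + 1).
    have cl : {for chart_map (cc i) (proj i p), continuous
        (fun w : 'rV[R]_(n i + n i) => (w - chart_map (cc i) (proj i p)) *m (@sel R m e i)^T)}.
      apply: differentiable_continuous; apply: differentiable_row => k.
      apply: Ck_differentiable; apply: (mCkM (A := fun w => w - _)).
        by apply: mCkB; [exact: mCk_id|exact: mCk_cst].
      exact: mCk_cst.
    have cc_c : {for proj i p, continuous (chart_map (cc i))} by exact: chart_map_continuous.
    have cont : {for proj i p, continuous (lin i)} by exact: continuous_comp cc_c cl.
    have /(_ _ _ (divr_gt0 del0 m10)) := (cvgrPdist_lt _ _).1 cont.
    by apply: filterS => q; rewrite /lin subrr mul0mx sub0r normrN.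
  exact: filterI n1 n2.
pose y : 'rV[R]_N := phi x0 + \sum_i lin i (x i).
have yE i : y *m sel i = chart_map (cc i) (x i).
  rewrite /y mulmxDl total_map_sel mulmx_suml [X in _ + X](bigD1 i) //=.
  rewrite [X in _ + (_ + X)]big1 ?addr0 => [|j ji].
    by rewrite -mulmxA sel_tr_mul mulmx1 /base_map inv_x0 addrC subrK.
  by rewrite -mulmxA sel_tr_mul0 // mulmx0.
have [y' [cy' Ay' dy'] phiy'] : (phi @` A') y.
  apply: hdel; rewrite -ball_normE /= /y opprD addrA subrr sub0r normrN.
  apply: le_lt_trans (ler_norm_sum _ _ _) _.
  apply: (@le_lt_trans _ _ (\sum_(i < m) del / (m%:R + 1))).
    by apply: ler_sum => i _; have [_ /ltW] := Bx i.
  rewrite sumr_const card_ord -(mulr_natl (del / _)) mulrCA gtr_pMr //.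
  by rewrite ltr_pdivrMr // mul1r ltrDl.
exists (chart_inv c y') => // i.
have := yE i; rewrite -phiy' total_map_sel /base_map => cE.
have [dx _] := Bx i.
by rewrite -(chart_mapK (acc i) (dy' i)) cE chart_mapK.
Unshelve. all: by end_near. Qed.

Lemma act_periodic (s : R) (p : P) : exists2 s', s' \in `[0, 2 * pi]%R & act s p = act s' p.
Proof.
have [[act0 actD _] per _ _ _] := bdl.
have pi2 : 0 < 2 * pi :> R by rewrite mulr_gt0 ?pi_gt0.
have [k kP] := floor_remainder s pi2.
exists (s - 2 * pi * k%:~R); first by rewrite in_itv.
have sE : s = (s - 2 * pi * k%:~R) + 2 * pi * k%:~R by rewrite subrK.
by rewrite {1}sE actD; congr (act _ _); apply/per; exists k.
Qed.

(** Near (s, p) the action factors through the map r into chart coordinates, where the bundle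
    structure provides continuity in both variables. *)
Lemma act_continuous (s : R) (p : P) :
  {for (s, p), continuous (fun z : R * P => act z.1 z.2)}.
Proof.
have [[act0 actD sact] _ _ _ _] := bdl.
pose c := chart_at p; pose x0 : 'rV[R]_(1 + N) := Defs.coord p.
have ac : atlas c by exact: chart_at_atlas.
have cx0 : chart_img c x0 by exact: coord_img.
pose Psi (z : 'rV[R]_(1 + (1 + N))) : P := act (lsubmx z 0 0) (chart_inv c (rsubmx z)).
pose r (z : R * P) : 'rV[R]_(1 + (1 + N)) := row_mx z.1%:M (chart_map c z.2).
have cPsi : {for r (s, p), continuous Psi}.
  have [cP _] := sact c ac; apply: cP => /=.
  by rewrite row_mxKr.
have cr : {for (s, p), continuous r}.
  have rE z : r z = z.1 *: row_mx 1%:M 0 + chart_map c z.2 *m row_mx 0 1%:M.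
    rewrite mul_mx_row mulmx0 mulmx1 scale_row_mx scaler0 add_row_mx addr0 add0r.
    by rewrite scalemx1.
  have -> : r = (fun z => z.1 *: row_mx 1%:M 0 + chart_map c z.2 *m row_mx 0 1%:M).
    exact/funext.
  apply: cvgD.
    apply: cvgZr_tmp; exact: cvg_fst.
  have cl : {for chart_map c p, continuous (fun w : 'rV[R]_(1 + N) =>
      w *m row_mx (0 : 'M[R]_(1 + N, 1)) 1%:M)}.
    apply: differentiable_continuous; apply: differentiable_row => k.
    exact: Ck_differentiable (mCk_linear 1 _ _ 0 k).
  have cc2 : {for (s, p), continuous (fun z : R * P => chart_map c z.2)}.
    apply: (@continuous_comp _ _ _ snd (chart_map c)); first exact: cvg_snd.
    exact: chart_map_continuous ac (chart_at_dom p).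
  exact: continuous_comp cc2 cl.
have ract : \forall z \near (s, p), Psi (r z) = act z.1 z.2.
  have : \forall z \near (s, p), chart_dom c z.2.
    have : \forall q \near p, chart_dom c q.
      by apply: open_nbhs_nbhs; split; [exact: chart_dom_open|exact: chart_at_dom].
    by move=> h; exact: (@cvg_snd _ _ (nbhs s) (nbhs p) _ _ h).
  by apply: filterS => z cz; rewrite /Psi row_mxKl row_mxKr mxE mulr1n chart_mapK.
have cPr : {for (s, p), continuous (Psi \o r)} by exact: continuous_comp cr cPsi.
move=> A; rewrite -(nbhs_singleton ract) => /cPr.
move=> h; have FF : Filter (nbhs (s, p)) by typeclasses eauto.
by apply: (@filterS2 _ _ FF ((Psi \o r) @^-1` A) _ _ _ h ract) => z /= + <-; exact.
Qed.

(** A property holding locally on P holds on all orbits near a given one, since [0, 2 pi] is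
    compact; by openness of the projection it then holds over a neighbourhood in the base, and the
    base is compact by Tychonoff's theorem. *)
Lemma bundle_compact : (forall i, compact [set: M i]) -> compact [set: P].
Proof.
move=> cpt; apply/compact_near_coveringP => I F Q FF nQ.
have [_ _ _ [psurj orb] _] := bdl.
(* Tube lemma along the orbit, for the product of the neighbourhood filter of p with F. *)
have nQact (p : P) : \forall p' \near p & i \near F, forall s, Q i (act s p').
  have /compact_near_coveringP cs := @segment_compact R 0 (2 * pi).
  have FG : Filter (filter_prod (nbhs p) F) by typeclasses eauto.
  have := cs _ (filter_prod (nbhs p) F) (fun pi s => Q pi.2 (act s pi.1)) FG.
  have cov (s : R) : `[0, 2 * pi]%classic s ->
     \forall s' \near s & pi \near filter_prod (nbhs p) F, Q pi.2 (act s' pi.1).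
    move=> _; have [[U J] /= [nU FJ] UJ] := nQ (act s p) Logic.I.
    have [[S V] /= [nS nV] SV] := act_continuous nU.
    exists (S, [set pi | V pi.1 /\ J pi.2]) => /=.
      by split => //; exists (V, J).
    move=> [s' [p' i]] /= [Ss' [Vp' Ji]].
    by apply: (UJ (act s' p', i)); split => //; exact: (SV (s', p')).
  move=> /(_ cov); apply: (@filterS _ _ FG) => -[p' i] /= h s.
  have [s' s'in ->] := act_periodic s p'.
  by apply: h.
pose X : topologicalType := prod_topology (fun i : 'I_m => M i).
have cX : compact [set: X].
  have := @tychonoff 'I_m (fun i => M i) (fun i => setT) cpt.
  by congr compact; apply/seteqP; split => x.
move/compact_near_coveringP : cX => cX.
have : \forall i \near F, [set: X] `<=` [set x | forall p, (forall j, proj j p = x j) -> Q i p].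
  apply: (cX _ F (fun i x => forall p, (forall j, proj j p = x j) -> Q i p)) => // x _.
  have [p px] := psurj x.
  have [[U J] /= [nU FJ] UJ] := nQact p.
  have [B [nB hB]] := bundle_proj_open nU.
  exists ([set y : X | forall j, B j (y j)], J) => /=.
    split => //; apply: (@near_all_fin X _ (fun j (y : X) => B j (y j)) x) => j.
    have : nbhs (x j) (B j) by rewrite -px.
    by apply: (@proj_continuous _ (fun i => M i) j x).
  move=> [y i] /= [By Ji] p1 p1y.
  have [p' Up' p'y] := hB y By.
  have [s ->] : exists s, p1 = act s p'.
    by apply/orb => j; rewrite p'y p1y.
  exact: (UJ (p', i)).
apply: filterS => i Qi p _; exact: (Qi (fun j => proj j p) _ p).
Qed.

End BundleCompact.

(** * Volume *)

Section Integral.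
Context {R : realType}.

Lemma integral_rV_ge0 d (f : 'rV[R]_d -> \bar R) : (forall x, 0 <= f x)%E ->
  (0 <= integral_rV f)%E.
Proof.
elim: d f => [|d ih] f f0 /=; first exact: f0.
by apply: integral_ge0 => x _; apply: ih => v; exact: f0.
Qed.

(** The integrand is supported in a cube of side 2 r; one coordinate is integrated at a time. *)
Lemma integral_rV_bound d (f : 'rV[R]_d -> \bar R) (K r : R) : 0 <= r ->
  (forall x : 'rV[R]_d, 0 <= f x <= K%:E)%E ->
  (forall x : 'rV[R]_d, ~ (forall i, `|x 0 i| <= r) -> f x = 0%E) ->
  (integral_rV f <= (K * (2 * r) ^+ d)%:E)%E.
Proof.
move=> r0; elim: d f K => [|d ih] f K fK f0 /=.
  by rewrite expr0 mulr1; have /andP[] := fK 0.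
have f00 x : (0 <= f x)%E by have /andP[] := fK x.
have K0 : 0 <= K by have /andP[h1 h2] := fK 0; rewrite -lee_fin (le_trans h1).
pose F (x : R) := integral_rV (fun v : 'rV[R]_d => f (row_mx (x%:M : 'rV[R]_1) v)).
have F0 x : (0 <= F x)%E by apply: integral_rV_ge0 => v.
have FK x : (F x <= (K * (2 * r) ^+ d)%:E)%E.
  apply: ih => // v nv; apply: f0 => h; apply: nv => i.
  by rewrite -(row_mxEr (x%:M : 'rV[R]_1) v 0 i); exact: h (rshift 1 i).
have Fout x : ~ (`|x| <= r) -> F x = 0%E.
  move=> xr; apply/eqP; rewrite eq_le F0 andbT.
  (* Outside the slab the induction hypothesis is applied with the bound K = 0. *)
  have -> : (0 = (0 * (2 * r) ^+ d)%:E :> \bar R)%E by rewrite mul0r.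
  have fz v : f (row_mx (x%:M : 'rV[R]_1) v) = 0%E.
    apply: f0 => h; apply: xr.
    have := row_mxEl (x%:M : 'rV[R]_1) v 0 0; rewrite [RHS]mxE eqxx mulr1n => xE.
    by have := h (lshift d (0 : 'I_1)); rewrite [X in `|X|]xE.
  by apply: ih => // v; rewrite fz lexx.
have -> : (\int[lebesgue_measure]_x F x =
    \int[lebesgue_measure]_(x in `[(- r)%R, r]%classic) F x)%E.
  rewrite [RHS]integral_mkcond; apply: eq_integral => x _; rewrite patchE.
  case: ifPn => // /negP xr; apply: Fout => xr'; apply: xr; rewrite inE /= in_itv /=.
  by rewrite -ler_norml.
apply: le_trans (_ : (\int[lebesgue_measure]_(x in `[(- r)%R, r]%classic)
    (cst (K * (2 * r) ^+ d)%:E) x <= _)%E).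
  by apply: integral_mono.
rewrite integral_cst //= lebesgue_measure_itv /= lte_fin.
case: ifPn => [_|].
  rewrite -EFinB -EFinM lee_fin opprK exprS.
  by rewrite (_ : K * (2 * r * (2 * r) ^+ d) = K * (2 * r) ^+ d * (r + r)) //; ring.
by rewrite mule0 lee_fin mulr_ge0 // exprn_ge0 // mulr_ge0.
Qed.

End Integral.

Section BundleVolume.
Context {R : realType} {m : nat} {n : 'I_m -> nat}.
Local Notation e := (fun i => (n i + n i)%N).
Local Notation N := (\sum_(i < m) (n i + n i))%N.
Context {M : forall i, manifold R (n i + n i)} {P : manifold R (1 + N)}.
Variables (g : forall i, M i -> 'M[R]_(n i + n i)) (act : R -> P -> P)
  (proj : forall i, P -> M i) (sigma : P -> 'cV[R]_(1 + N)) (q : 'I_m -> int).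
Hypotheses (rg : forall i, riemannian_metric (@g i))
  (hol : forall i, holomorphic_atlas (M i))
  (herm : forall i x, J0 *m @g i x *m J0^T = @g i x)
  (bdl : principal_circle_bundle act proj)
  (cnx : principal_connection act sigma)
  (dsigma : exterior_derivative_is sigma
    (curvature_form proj q (fun i => kahler_form (@g i))))
  (cptP : compact [set: P]).

Lemma det_bdiag_scalar (b : 'I_m -> R) :
  \det (bdiag (fun i => b i *: 1%:M) : 'M[R]_N) = \prod_s b (@tagnat.sig1 m e s).
Proof.
have -> : (bdiag (fun i => b i *: 1%:M) : 'M[R]_N) = diag_mx (\row_s b (@tagnat.sig1 m e s)).
  apply/matrixP => j j'; rewrite summxE mxE mxE.
  transitivity (\sum_i \sum_(k < n i + n i) (b (@tagnat.sig1 m e (@tagnat.Rank m e i k)) *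
     ((@tagnat.Rank m e i k == j)%:R * (@tagnat.Rank m e i k == j')%:R))).
    apply: eq_bigr => i _; rewrite -scalemxAr mulmx1 -scalemxAl mxE mxE mulr_sumr.
    by apply: eq_bigr => k _; rewrite !mxE tagnat.Rank1K ![_ == @tagnat.Rank _ _ _ _]eq_sym.
  rewrite (@sum_Rank R m e (fun s => b (tagnat.sig1 s) * ((s == j)%:R * (s == j')%:R))).
  rewrite (bigD1 j) //= [X in _ + X]big1 => [|s /negPf sj]; last by rewrite sj mul0r mulr0.
  by rewrite eqxx mul1r addr0 mulr_natr.
by rewrite det_diag; apply: eq_bigr => s _; rewrite mxE.
Qed.

(** The metric is S D S^T with a square matrix S independent of a and b, and D block diagonal; the
    scalars factor out of det D. *)
Lemma det_bundle_metric (a : R) (b : 'I_m -> R) (p : P) :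
  \det (bundle_metric proj sigma g a b p) =
  a * \prod_s b (@tagnat.sig1 m e s) * \det (bundle_metric proj sigma g 1 (fun=> 1) p).
Proof.
pose S : 'M[R]_(1 + N) := row_mx (sigma p) (\sum_i tangent (proj i) p *m (@sel R m e i)^T).
have SE (a' : R) (b' : 'I_m -> R) : bundle_metric proj sigma g a' b' p =
    S *m block_mx (a'%:M : 'M[R]_1) 0 0 (bdiag (fun i => b' i *: @g i (proj i p))) *m S^T.
  rewrite /S mul_row_block !mulmx0 addr0 add0r tr_row_mx mul_row_col.
  rewrite mul_mx_scalar -scalemxAl; congr (_ + _).
  rewrite /bdiag mulmx_sumr mulmx_suml; apply: eq_bigr => i _.
  have Ti : (\sum_j tangent (proj j) p *m (@sel R m e j)^T) *m sel i = tangent (proj i) p.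
    rewrite mulmx_suml [LHS](bigD1 i) //= [X in _ + X]big1 ?addr0 => [|j ji].
      by rewrite -mulmxA sel_tr_mul mulmx1.
    by rewrite -mulmxA sel_tr_mul0 // mulmx0.
  rewrite -scalemxAr -!scalemxAl -scalemxAr -!scalemxAl; congr (_ *: _).
  by rewrite /pullback2 -{1 2}Ti [X in _ = X *m _]mulmxA trmx_mul !mulmxA.
have detE (a' : R) (b' : 'I_m -> R) : \det (bundle_metric proj sigma g a' b' p) =
    \det S * \det S * (a' * \prod_s b' (@tagnat.sig1 m e s) *
      \det (bdiag (fun i => @g i (proj i p)) : 'M[R]_N)).
  rewrite SE !det_mulmx det_tr det_ublock det_scalar1.
  have -> : bdiag (fun i => b' i *: @g i (proj i p)) =
     bdiag (fun i => b' i *: 1%:M) *m bdiag (fun i => @g i (proj i p)).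
    by rewrite bdiagM; apply: eq_bdiag => i; rewrite -scalemxAl mul1mx.
  by rewrite det_mulmx det_bdiag_scalar; ring.
rewrite !detE big1_eq; ring.
Qed.

Lemma sqrt_det_bundle (a beta : R) (b : 'I_m -> R) c y : 0 <= a ->
  (forall i, 0 <= b i <= beta) ->
  Num.sqrt (\det (comp2 (bundle_metric proj sigma g a b) c y)) <=
  Num.sqrt (a * beta ^+ N) *
    Num.sqrt (\det (comp2 (bundle_metric proj sigma g 1 (fun=> 1)) c y)).
Proof.
move=> a0 bb; have pb : 0 <= \prod_s b (@tagnat.sig1 m e s) <= beta ^+ N.
  apply/andP; split; first by apply: prodr_ge0 => s _; have /andP[] := bb (tagnat.sig1 s).
  rewrite -[X in _ ^+ X]card_ord -prodr_const; apply: ler_prod => s _; exact: bb.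
have /andP[pb0 pb1] := pb.
have -> : \det (comp2 (bundle_metric proj sigma g a b) c y) =
   (a * \prod_s b (@tagnat.sig1 m e s)) *
   \det (comp2 (bundle_metric proj sigma g 1 (fun=> 1)) c y).
  by rewrite /comp2 /pull2 !det_mulmx det_bundle_metric; ring.
rewrite sqrtrM ?mulr_ge0 // ler_wpM2r ?sqrtr_ge0 // ler_wsqrtr //.
by rewrite ler_wpM2l.
Qed.

(** Local bounds for the reference metric a = b_i = 1, whose density is continuous in the chart;
    regularity of its components is taken from [bundle_submersion_frame] at tau = 1. *)
Lemma local_volume_bound (p : P) : exists rD : R * R, 0 <= rD.1 /\
  \forall y \near p, [/\ chart_dom (chart_at p) y, `|chart_map (chart_at p) y| <= rD.1 &
    Num.sqrt (\det (comp2 (bundle_metric proj sigma g 1 (fun=> 1)) (chart_at p)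
       (chart_map (chart_at p) y))) <= rD.2].
Proof.
set c := chart_at p; set G := bundle_metric _ _ _ _ _.
have ac : atlas c by exact: chart_at_atlas.
have cp : chart_dom c p by exact: chart_at_dom.
have cont : {for p, continuous (chart_map c)} by exact: chart_map_continuous.
have acc i : atlas (chart_at (proj i p)) by exact: chart_at_atlas.
have ccp i : chart_dom (chart_at (proj i p)) (proj i p) by exact: chart_at_dom.
have sf := @bundle_submersion_frame R m n M P g act proj sigma q rg hol herm bdl cnx dsigma
  p (fun i => chart_at (proj i p)) acc ccp 1 (fun=> 1) (fun=> 1) 1 1 (oner_neq0 R) _ _ _.
have {sf} cG : mCk 2 (comp2 G c) (chart_map c p).
  apply: (@mCk_near _ _ _ _ _ (fun y => 1^-1 *: comp2 G c y)).
    by near=> y; rewrite invr1 scale1r.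
  apply: submersion_metric_Ck (sf _ _ _).
  - by rewrite expr1n invr1 mulr1.
  - by move=> i; rewrite invr1 mulr1.
  - by move=> i; rewrite oner_neq0.
pose f y := \det (comp2 G c y).
have cf : {for chart_map c p, continuous f}.
  by apply: differentiable_continuous; exact: Ck_differentiable (Ck_det cG).
have cfc : {for p, continuous (f \o chart_map c)} by exact: continuous_comp cont cf.
exists (`|chart_map c p| + 1, Num.sqrt (`|f (chart_map c p)| + 1)); split.
  by rewrite addr_ge0.
have n1 : \forall y \near p, chart_dom c y.
  by apply: open_nbhs_nbhs; split => //; exact: chart_dom_open.
have n2 := (cvgrPdist_le _ _).1 cont 1 ltr01.
have n3 := (cvgrPdist_le _ _).1 cfc 1 ltr01.
near=> y; split => /=.
- by near: y; exact: n1.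
- have h : `|chart_map c p - chart_map c y| <= 1 by near: y; exact: n2.
  rewrite -[chart_map c y](subKr (chart_map c p)).
  by rewrite (le_trans (ler_normB _ _)) // lerD2l.
- have h : `|f (chart_map c p) - f (chart_map c y)| <= 1 by near: y; exact: n3.
  apply: ler_wsqrtr; apply: le_trans (ler_norm _) _.
  rewrite -[\det _](subKr (f (chart_map c p))).
  by rewrite (le_trans (ler_normB _ _)) // lerD2l.
Unshelve. all: by end_near. Qed.

(** The finite cover is chosen for the reference metric and serves all a and b through
    [sqrt_det_bundle]; the outer measure of any set is at most the sum over the whole cover. *)
Lemma bundle_volume_bound (p0 : P) : exists2 V : R, 0 <= V &
  forall (a beta : R) (b : 'I_m -> R) (A : set P), 0 <= a -> (forall i, 0 <= b i <= beta) ->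
  (volume (bundle_metric proj sigma g a b) A <= (Num.sqrt (a * beta ^+ N) * V)%:E)%E.
Proof.
pose rD p := projT1 (cid (local_volume_bound p)).
have rD0 p : 0 <= (rD p).1 by have [] := projT2 (cid (local_volume_bound p)).
pose O p : set P := interior [set y | [/\ chart_dom (chart_at p) y,
  `|chart_map (chart_at p) y| <= (rD p).1 &
    Num.sqrt (\det (comp2 (bundle_metric proj sigma g 1 (fun=> 1)) (chart_at p)
       (chart_map (chart_at p) y))) <= (rD p).2]].
have nO p : O p p by have [_] := projT2 (cid (local_volume_bound p)).
have oO p : open (O p) by exact: open_interior.
have OP p y : O p y -> [/\ chart_dom (chart_at p) y,
  `|chart_map (chart_at p) y| <= (rD p).1 &
    Num.sqrt (\det (comp2 (bundle_metric proj sigma g 1 (fun=> 1)) (chart_at p)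
       (chart_map (chart_at p) y))) <= (rD p).2] by exact: interior_subset.
(* [compact_cover] is stated for pointed types; the near covering property along
   the filter of large lists also yields a finite subcover. *)
have [s cov] : exists s : seq P, forall y, exists2 p, p \in s & O p y.
  pose FF (Q : set (seq P)) := exists s0 : seq P, forall s, {subset s0 <= s} -> Q s.
  have FFF : Filter FF.
    split; first by exists nil.
      move=> Q Q' [s0 h] [s0' h']; exists (s0 ++ s0') => s hs; split.
        by apply: h => y ys; apply: hs; rewrite mem_cat ys.
      by apply: h' => y ys; apply: hs; rewrite mem_cat ys orbT.
    by move=> Q Q' QQ' [s0 h]; exists s0 => s /h; exact: QQ'.
  move/compact_near_coveringP : cptP => /(_ _ FF (fun s y => exists2 p, p \in s & O p y) FFF).
  case=> [p _|s0 /(_ s0 (fun _ => id)) h]; last by exists s0 => y; exact: h.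
  exists (O p, [set s : seq P | p \in s]).
    split; first exact: open_nbhs_nbhs (conj (oO p) (nO p)).
    by exists [:: p] => s; apply; rewrite mem_head.
  by move=> [y s] /= [Oy ps]; exists p.
pose w p := (rD p).2 * (2 * (rD p).1) ^+ (1 + N).
have rD20 p : 0 <= (rD p).2.
  have [_ _] := OP p p (nO p); apply: le_trans; exact: sqrtr_ge0.
have w0 p : 0 <= w p by rewrite mulr_ge0 // exprn_ge0 // mulr_ge0.
exists (\sum_(p <- s) w p); first by apply: sumr_ge0.
move=> a beta b A a0 bb; set k := Num.sqrt (a * beta ^+ N).
have k0 : 0 <= k by exact: sqrtr_ge0.
have cv p : (chart_volume (bundle_metric proj sigma g a b) (chart_at p) (O p) <= (k * w p)%:E)%E.
  rewrite /w mulrA; apply: integral_rV_bound => // y.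
    rewrite !lee_fin mulr_ge0 ?sqrtr_ge0 //= ?indicE //.
    rewrite -[chart_map _ @` _]/(chart_map (chart_at p) @` O p).
    have [/set_mem[z Oz <-]|_] := boolP (y \in _); last by rewrite mulr0 mulr_ge0.
    rewrite mulr1; apply: le_trans (sqrt_det_bundle _ _ a0 bb) _.
    by rewrite ler_wpM2l //; have [] := OP p z Oz.
  move=> ny; rewrite indicE; have [/set_mem[z Oz zy]|_] := boolP (y \in _); last by rewrite mulr0.
  exfalso; apply: ny => i; have [_ h _] := OP p z Oz.
  by rewrite -zy (le_trans (norm_entry _ _)).
pose c' k := chart_at (nth p0 s k).
(* The finite cover is padded with empty sets to the sequence that [volume] asks for, with p0 as
   default centre. *)
pose O' k := if (k < size s)%N then O (nth p0 s k) else set0.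
have chO (B : set P) c : (0 <= chart_volume (bundle_metric proj sigma g a b) c B)%E.
  by apply: integral_rV_ge0 => y; rewrite lee_fin mulr_ge0 ?sqrtr_ge0 // indicE.
have ch0 c : chart_volume (bundle_metric proj sigma g a b) c set0 = 0%E.
  apply/eqP; rewrite eq_le chO andbT.
  have -> : (0 = (0 * (2 * 0) ^+ (1 + N))%:E :> \bar R)%E by rewrite mul0r.
  by apply: integral_rV_bound => // y; rewrite image_set0 indic0 mulr0 ?lexx.
apply: le_trans (_ : (\sum_(0 <= j <oo)
    chart_volume (bundle_metric proj sigma g a b) (c' j) (O' j) <= _)%E).
  apply: ereal_inf_lbound; exists c', O'; split => //.
    move=> j; rewrite /O'; split; first exact: chart_at_atlas.
    case: ifP => _; last by split => //; exact: open0.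
    by split => // y /OP[].
  move=> y _; have [p ps Oy] := cov y.
  exists (index p s) => //; rewrite /O' index_mem ps nth_index //.
rewrite (nneseries_split 0 (size s)); last by move=> j _; exact: chO.
rewrite add0n [X in (_ + X)%E]eseries0 ?adde0; last first.
  by move=> j sj _; rewrite /O' ltnNge sj /= ch0.
rewrite big_mkord mulr_sumr (big_nth p0) big_mkord -sumEFin.
by apply: lee_sum => j _; rewrite /O' ltn_ord; exact: cv.
Qed.
End BundleVolume.

(** An empty manifold has no singular simplices, so every cochain on it is cohomologous to 0,
    against [non_torsion] with multiplier 1. *)
Lemma primitive_class_nonempty (R : realType) d (M : manifold R d) (w : M -> 'M[R]_d) :
  primitive_integral_class w -> exists x : M, True.
Proof.
move=> [c [_ nt _ _]]; apply: contrapT => noM; apply: (nt 1 isT).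
by exists (fun=> 0) => // s _; exfalso; apply: noM; exists (s 0).
Qed.

Lemma collapse_ratio (R : realType) (N : nat) (kappa K C V : R) :
  0 < kappa -> 0 < K -> 0 <= C -> 0 <= V ->
  exists2 eps : R, 0 < eps & forall a t, 0 < t -> 0 <= a <= eps * t ->
    Num.sqrt (a * (C * t) ^+ N) * V < kappa * Num.sqrt (t / K) ^+ (1 + N).
Proof.
(* With eps = kappa^2 / D and x = C^N V^2, the squared left side is at most x / (x + 1) times the
   squared right side. The added 1 makes the inequality strict and keeps D positive when C or V is
   0. *)
move=> k0 K0 C0 V0; pose D := K ^+ (1 + N) * (C ^+ N * V ^+ 2 + 1).
have B0 : 0 <= C ^+ N * V ^+ 2 by rewrite mulr_ge0 // exprn_ge0.
have D0 : 0 < D by rewrite mulr_gt0 ?exprn_gt0 // ltr_wpDl.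
exists (kappa ^+ 2 / D); first by rewrite divr_gt0 ?exprn_gt0.
move=> a t t0 /andP[a0 ae].
rewrite -(ltr_pXn2r (isT : (0 < 2)%N)) ?nnegrE; first last.
  by rewrite mulr_ge0 ?exprn_ge0 ?sqrtr_ge0 // ltW.
  by rewrite mulr_ge0 ?sqrtr_ge0.
rewrite [in X in X < _]exprMn [in X in _ < X]exprMn sqr_sqrtr; last first.
  by rewrite mulr_ge0 // exprn_ge0 // mulr_ge0 // ltW.
rewrite exprAC sqr_sqrtr; last by rewrite ltW // divr_gt0.
rewrite expr_div_n.
apply: (@le_lt_trans _ _ (kappa ^+ 2 / D * t * (C ^+ N * t ^+ N) * V ^+ 2)).
  rewrite ler_wpM2r ?exprn_ge0 // exprMn ler_wpM2r // mulr_ge0 ?exprn_ge0 //.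
  exact: ltW.
have -> : kappa ^+ 2 / D * t * (C ^+ N * t ^+ N) * V ^+ 2 =
    kappa ^+ 2 * (t ^+ (1 + N) / K ^+ (1 + N)) * ((C ^+ N * V ^+ 2) / (C ^+ N * V ^+ 2 + 1)).
  rewrite /D add1n !exprS; field.
  rewrite !gt_eqF ?exprn_gt0 // ltr_wpDl //.
rewrite gtr_pMr; last by rewrite mulr_gt0 ?divr_gt0 ?exprn_gt0.
rewrite ltr_pdivrMr ?mul1r; last by rewrite ltr_wpDl.
by rewrite ltrDl.
Qed.

(** * The type I bound and the collapse at large scales *)

Section Main.
Context {R : realType} {m : nat} {n p : 'I_m -> nat} {q : 'I_m -> int}.
Local Notation N := (\sum_(i < m) (n i + n i))%N.
Context {M : forall i, manifold R (n i + n i)} {P : manifold R (1 + N)}.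
Variables (g : forall i, M i -> 'M[R]_(n i + n i)) (act : R -> P -> P)
  (proj : forall i, P -> M i) (sigma : P -> 'cV[R]_(1 + N))
  (c0 a0 : R) (Y : R -> 'I_m -> R) (a : R -> R) (b : R -> 'I_m -> R).
Hypotheses (m0 : (0 < m)%N) (pp : forall i, (0 < p i)%N)
  (ke : forall i, compact_kahler_einstein (@g i) (p i)%:R)
  (pic : forall i, primitive_integral_class
     (fun x => (2 * pi)^-1 *: kahler_form (@g i) x))
  (bdl : principal_circle_bundle act proj)
  (cnx : principal_connection act sigma)
  (dsigma : exterior_derivative_is sigma
    (curvature_form proj q (fun i => kahler_form (@g i))))
  (sd : small_data_constant n p q c0) (YS : Y_solution n p q Y)
  (Y0 : forall u, 0 <= u -> forall i, 0 < Y u i) (Yc : \sum_i Y 0 i <= c0)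
  (a00 : 0 < a0) (cor : corresponding n q a0 Y a b).

Let G tau := bundle_metric proj sigma g (a tau) (b tau).

Let rg i : riemannian_metric (@g i). Proof. by have [_ _ []] := ke i. Qed.
Let hol i : holomorphic_atlas (M i). Proof. by have [] := ke i. Qed.
Let herm i x : J0 *m @g i x *m J0^T = @g i x.
Proof. by have [_ _ [_ h] _ _] := ke i; exact: h. Qed.
Let cpt i : compact [set: M i]. Proof. by have [[]] := ke i. Qed.

Lemma bundle_nonempty : exists x : P, True.
Proof.
have [_ _ _ [surj _] _] := bdl.
have [x _] := surj (fun i => projT1 (cid (primitive_class_nonempty (@pic i)))).
by exists x.
Qed.

Lemma bundle_curvature_decay : exists K T0 : R, 0 < T0 /\
  forall t, T0 <= t -> forall x, Rm_norm (G t) x <= K / t.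
Proof.
have [T1 [c [C [T10 c1 cC]]]] := flow_growth pp sd YS Y0 Yc a00 cor.
have [T2 T20 a1] := flow_fibre_cvg0 m0 pp sd YS Y0 Yc a00 cor ltr01.
pose T0 := Num.max T1 T2.
have T00 : 0 < T0 by rewrite lt_max T10.
have TT t : T0 <= t -> T1 <= t /\ T2 <= t by rewrite ge_max => /andP.
have at_ t : T0 <= t -> 0 < a t <= t.
  move=> tt; have [_ t2] := TT t tt; have t0 : 0 <= t by exact: le_trans (ltW T00) tt.
  have [-> _] := flow_pos sd YS Y0 Yc a00 cor t0.
  by have := a1 t t2; rewrite mul1r.
have bt t : T0 <= t -> forall i, c * t <= b t i <= C * t.
  by move=> tt; have [t1 _] := TT t tt; exact: cC.
have [K hK] := bundle_Rm_bound rg hol herm cpt bdl cnx dsigma T00 c1 at_ bt.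
by exists K, T0; split.
Qed.

Lemma bundle_type_I : type_I G.
Proof.
have [K [T0 [T00 hK]]] := bundle_curvature_decay.
exists K, T0 => t tt _; have t0 : 0 < t by exact: lt_le_trans tt.
have -> : K%:E = (t%:E * (K / t)%:E)%E by rewrite -EFinM mulrCA mulfV ?gt_eqF ?mulr1.
apply: lee_wpmul2l; first by rewrite lee_fin ltW.
by apply: ge_ereal_sup => _ [x _ <-]; rewrite lee_fin; exact: hK.
Qed.

Lemma bundle_collapsed kappa : 0 < kappa -> ~ noncollapsed G kappa.
Proof.
move=> k0 nc; have [K [T0 [T00 hK]]] := bundle_curvature_decay.
have [x _] := bundle_nonempty.
have cP : compact [set: P] := bundle_compact bdl cnx cpt.
have [V V0 hV] := bundle_volume_bound rg hol herm bdl cnx dsigma cP x.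
have [T1 [c [C [T10 c1 cC]]]] := flow_growth pp sd YS Y0 Yc a00 cor.
have C0 : 0 <= C.
  have /andP[h1 h2] := cC T1 (lexx _) (Ordinal m0).
  by rewrite -(pmulr_lge0 _ T10); apply: le_trans (le_trans h1 h2); rewrite mulr_ge0 // ltW.
(* A positive constant is required for the radius rho = sqrt (t / K'). *)
pose K' := Num.max 1 K.
have K0 : 0 < K' by rewrite lt_max ltr01.
have [eps e0 he] := @collapse_ratio R N kappa K' C V k0 K0 C0 V0.
have [T2 T20 ha] := flow_fibre_cvg0 m0 pp sd YS Y0 Yc a00 cor e0.
pose t := Num.max T0 (Num.max T1 T2).
have tT0 : T0 <= t by rewrite le_max lexx.
have tT1 : T1 <= t by rewrite !le_max lexx orbT.
have tT2 : T2 <= t by rewrite !le_max lexx !orbT.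
have t0 : 0 < t by exact: lt_le_trans tT0.
have [at0 bt0] := flow_pos sd YS Y0 Yc a00 cor (ltW t0).
pose rho := Num.sqrt (t / K').
have rho0 : 0 < rho by rewrite sqrtr_gt0 divr_gt0.
have rE : rho ^- 2 = K' / t by rewrite sqr_sqrtr ?invf_div // ltW // divr_gt0.
have Rmle y : metric_ball (G t) x rho y -> Rm_norm (G t) y <= rho ^- 2.
  move=> _; rewrite rE; apply: le_trans (hK t tT0 y) _.
  by rewrite ler_pM2r ?invr_gt0 // le_max lexx orbT.
have bb i : 0 <= b t i <= C * t.
  by rewrite ltW //=; have /andP[] := cC t tT1 i.
(* The curvature bound holds on all of P and the volume bound for every subset, so nothing about the
   shape of the ball is required. *)
have /le_trans /(_ (hV (a t) (C * t) (b t) _ (ltW at0) bb)) := nc t (ltW t0) x rho rho0 Rmle.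
rewrite lee_fin leNgt => /negP; apply; apply: he => //.
by rewrite ltW //=; exact: ha.
Qed.

End Main.

Theorem theorem3p9 (R : realType) (m : nat) (n p : 'I_m -> nat) (q : 'I_m -> int)
  (M : forall i, manifold R (n i + n i))
  (g : forall i, M i -> 'M[R]_(n i + n i))
  (P : manifold R (\sum_(i < m) (n i + n i)).+1)
  (act : R -> P -> P) (proj : forall i, P -> M i)
  (sigma : P -> 'cV[R]_((\sum_(i < m) (n i + n i)).+1))
  (c0 a0 : R) (Y : R -> 'I_m -> R) (a : R -> R) (b : R -> 'I_m -> R) :
  (0 < m)%N ->
  (forall i, (0 < n i)%N) -> (forall i, (0 < p i)%N) -> (forall i, q i != 0) ->
  (forall i, compact_kahler_einstein (g i) (p i)%:R) ->
  (forall i, primitive_integral_class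
     (fun x => (2 * pi)^-1 *: kahler_form (g i) x)) ->
  principal_circle_bundle act proj ->
  principal_connection act sigma ->
  exterior_derivative_is sigma
    (curvature_form proj q (fun i => kahler_form (g i))) ->
  small_data_constant n p q c0 ->
  Y_solution n p q Y ->
  (forall u : R, 0 <= u -> forall i, 0 < Y u i) ->
  \sum_i Y 0 i <= c0 ->
  0 < a0 ->
  corresponding n q a0 Y a b ->
  let G := fun tau => bundle_metric proj sigma g (a tau) (b tau) in
  type_I G /\ forall kappa, 0 < kappa -> ~ noncollapsed G kappa.
Proof.
move=> m0 _ pp _ ke pic bdl cnx dsigma sd YS Y0 Yc a00 cor.
split; first exact: (bundle_type_I m0 pp ke bdl cnx dsigma sd YS Y0 Yc a00 cor).
move=> kappa.
exact: (bundle_collapsed m0 pp ke pic bdl cnx dsigma sd YS Y0 Yc a00 cor).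
Qed.
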